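(* Let $D$ be a discriminant form of the special shape described in the context, with level $N=|D|$, signature $r$, character $\chi_D$ and sign vector $\epsilon$, and let $k$ be an integer with $k\equiv \frac r2 \pmod 2$. Define $$\phi:\mathcal A^{\mathrm{inv}}(k,\rho_D)\to A^\epsilon(N,k,\chi_D),\qquad F=\sum_\gamma F_\gamma e_\gamma\mapsto i^{\frac r2}2^{-\omega(N)}N^{-\frac{k-1}{2}}F_0|_kW(N),$$ $$\psi:A^\epsilon(N,k,\chi_D)\to\mathcal A^{\mathrm{inv}}(k,\rho_D),\qquad f\mapsto i^{\frac r2}N^{\frac{k-1}{2}}\sum_{M\in\Gamma_0(N)\backslash \mathrm{SL}_2(\mathbb Z)}\left(f|_kW(N)|_kM\right)\rho_D(M^{-1})e_0 .$$ Then $\phi$ and $\psi$ are inverse isomorphisms between $\mathcal A^{\mathrm{inv}}(k,\rho_D)$ and $A^\epsilon(N,k,\chi_D)$. Explicitly, if $f=\sum_n a(n)q^n\in A^\epsilon(N,k,\chi_D)$ and $\psi(f)=F=\sum_\gamma F_\gamma e_\gamma$, then for every $\gamma\in D$ $$F_\gamma(\tau)=s(Nq(\gamma))\sum_{n\equiv Nq(\gamma)\ (\mathrm{mod}\ N\mathbb Z)}a(n)q^{\frac nN}=\sum_{n\equiv Nq(\gamma)\ (\mathrm{mod}\ N\mathbb Z)}s(n)a(n)q^{\frac nN}.$$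
   Context: Discriminant forms: a discriminant form is a finite abelian group $D$ with a quadratic form $q:D\to\mathbb Q/\mathbb Z$ whose bilinear form $(\beta,\gamma)=q(\beta+\gamma)-q(\beta)-q(\gamma)$ is nondegenerate. Its level is the smallest positive integer $N$ with $Nq(\gamma)=0$ for all $\gamma\in D$. Its signature in $\mathbb Z/8\mathbb Z$ is the signature mod 8 of any even lattice $L$ with $L'/L\cong D$. $\mathrm{Aut}(D)$ is the group of group automorphisms of $D$ preserving $q$. Shape of $D$: $D=\bigoplus_p D_p$ (orthogonal sum over primes; all but finitely many $D_p$ trivial). For odd $p$, $D_p$ is trivial or $D_p=p^{\delta_p}$, $\delta_p\in\{\pm1\}$: cyclic of order $p$ with a generator $\gamma$ with $q(\gamma)=a/p$, $\delta_p=\left(\frac{2a}{p}\right)$. For $p=2$, $D_2$ is one of: trivial; $2_t^{+2}$ with $t\in\{\pm2\}$, i.e. the orthogonal sum of two cyclic groups of order 2 whose generators both have $q$-value $\frac{t/2}{4}$; or $2_{t_1}^{+1}\oplus4_{t_2}^{\delta_2}$ with $t_1\in\{\pm1\}$, $t_2\in\{\pm1,\pm3\}$, $\delta_2=\left(\frac{2}{t_2}\right)$, i.e. the orthogonal sum of a cyclic group of order 2 with generator of $q$-value $t_1/4$ and a cyclic group of order 4 with generator of $q$-value $t_2/8$. Then the level is $N=|D|$ and the signature $r$ is even. Character: $\chi_D=\prod_{p\mid N}\chi_p$, a primitive Dirichlet character mod $N$; $\chi_p=\left(\frac{\cdot}{p}\right)$ for odd $p\mid N$; $\chi_2$ is trivial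 if $D_2$ is trivial, $\chi_2=\left(\frac{-4}{\cdot}\right)$ if $D_2=2_t^{+2}$, and $\chi_2=\left(\frac{-2a}{\cdot}\right)$ with $a=\left(\frac{-1}{t_1t_2}\right)$ if $D_2=2_{t_1}^{+1}\oplus4_{t_2}^{\delta_2}$. Sign vector: $\epsilon=(\epsilon_p)_{p\mid N}$ with $\epsilon_p=\chi_p(2N/p)\delta_p$ for odd $p$; $\epsilon_2=\chi_2(Nt/8)$ if $D_2=2_t^{+2}$; $\epsilon_2=\chi_2(t_2N/8)$ if $D_2=2_{t_1}^{+1}\oplus 4_{t_2}^{\delta_2}$. Slash operator: for $M=\begin{pmatrix}a&b\\c&d\end{pmatrix}\in\mathrm{GL}_2^+(\mathbb R)$, $(f|_kM)(\tau)=\det(M)^{k/2}(c\tau+d)^{-k}f(M\tau)$. $W(N)=\begin{pmatrix}0&-1\\N&0\end{pmatrix}$, $q=e^{2\pi i\tau}$, $e(x)=e^{2\pi ix}$. Weil representation: $\rho_D$ is the representation of $\mathrm{SL}_2(\mathbb Z)$ on $\mathbb C[D]$ (basis $e_\gamma$, $\gamma\in D$) with $\rho_D(T)e_\gamma=e(q(\gamma))e_\gamma$ and $\rho_D(S)e_\gamma=\frac{i^{-r/2}}{\sqrt{|D|}}\sum_{\beta\in D}e(-(\beta,\gamma))e_\beta$, where $T=\begin{pmatrix}1&1\\0&1\end{pmatrix}$, $S=\begin{pmatrix}0&-1\\1&0\end{pmatrix}$. Vector-valued forms: $\mathcal A(k,\rho_D)$ is the space of functions $F=\sum_\gamma F_\gamma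 e_\gamma:\mathbb H\to\mathbb C[D]$ with $\sum_\gamma (F_\gamma|_kM)e_\gamma=\rho_D(M)F$ for all $M\in\mathrm{SL}_2(\mathbb Z)$, each $F_\gamma$ holomorphic on $\mathbb H$ with a Fourier expansion at $\infty$ (in rational powers of $q$) having at most finitely many negative-power terms. $\mathcal A^{\mathrm{inv}}(k,\rho_D)$ is the subspace of $\mathrm{Aut}(D)$-invariant functions. Scalar-valued forms: $A(N,k,\chi_D)$ is the space of holomorphic $f$ on $\mathbb H$, meromorphic at all cusps, with $f|_kM=\chi_D(d)f$ for all $M=\begin{pmatrix}a&b\\c&d\end{pmatrix}\in\Gamma_0(N)$. $A^\epsilon(N,k,\chi_D)$ is the subspace of $f=\sum_na(n)q^n$ with $a(n)=0$ whenever $\chi_p(n)=-\epsilon_p$ for some prime $p\mid N$. $\omega(m)$ is the number of distinct prime divisors of $m$; $s(n)=2^{\omega(\gcd(n,N))}$ for $n\in\mathbb Z$ (with $\gcd(0,N)=N$); it depends only on $n$ mod $N$. *)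

(* Defs.v *)
From HB Require Import structures.
From mathcomp Require Import all_boot all_order all_algebra all_fingroup.
From mathcomp Require Import all_solvable.

Set Implicit Arguments.
Unset Strict Implicit.
Unset Printing Implicit Defensive.

Import Order.TTheory GRing.Theory Num.Theory.
Local Open Scope ring_scope.

(** * Kronecker symbols *)

Definition legendre (a : int) (p : nat) : int :=
  if (p %| a)%Z then 0
  else if [exists x : 'I_p, ((x : nat)%:Z ^+ 2 == a %[mod p])%Z] then 1 else -1.

Definition kronecker_prime (a : int) (p : nat) : int :=
  if p == 2%N then
    if (2 %| a)%Z then 0
    else if ((a == 1 %[mod 8]) || (a == -1 %[mod 8]))%Z then 1 else -1
  else legendre a p.

Definition kronecker (a n : int) : int :=
  if n == 0 then (`|a|%N == 1%N)%:R
  else (if (n < 0) && (a < 0) then -1 else 1) *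
       \prod_(p <- primes `|n|%N) kronecker_prime a p ^+ logn p `|n|%N.

(** * Discriminant forms *)

(* An element of Q/Z is represented by any rational lift, equality in Q/Z being
   [eqQZ]; only well-defined expressions in the lifts are used below. *)
Definition eqQZ (x y : rat) : Prop := x - y \is a Num.int.

Section DiscriminantForm.
Variables (D : finZmodType) (q : D -> rat).

Definition bil (b g : D) : rat := q (b + g) - q b - q g.

Definition discriminant_form : Prop :=
  [/\ forall (n : int) (g : D), eqQZ (q (g *~ n)) (n%:~R ^+ 2 * q g),
      forall b1 b2 g : D, eqQZ (bil (b1 + b2) g) (bil b1 g + bil b2 g)
    & forall g : D, (forall b : D, eqQZ (bil b g) 0) -> g = 0].

Definition kills_form (N : nat) : Prop := forall g : D, eqQZ (N%:R * q g) 0.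

Definition is_level (N : nat) : Prop :=
  [/\ (0 < N)%N, kills_form N
    & forall m : nat, (0 < m)%N -> kills_form m -> (N <= m)%N].

Definition form_automorphism (s : {perm D}) : Prop :=
  (forall x y : D, s (x + y) = s x + s y) /\ (forall x : D, eqQZ (q (s x)) (q x)).

End DiscriminantForm.

(** * Signature *)

(* The lattice is Z^n with Gram matrix [G]; vectors of Q^n are rows. *)
Definition even_gram (n : nat) (G : 'M[int]_n) : Prop :=
  [/\ G^T = G, \det G != 0 & forall i, (2 %| G i i)%Z].

Definition gram_signature (n : nat) (G : 'M[int]_n) (s : int) : Prop :=
  exists (P : 'M[rat]_n) (d : 'rV[rat]_n),
    [/\ P \in unitmx, P *m map_mx intr G *m P^T = diag_mx d
      & s = #|[set i | 0 < d 0 i]|%:Z - #|[set i | d 0 i < 0]|%:Z].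

Definition integral_vector (n : nat) (v : 'rV[rat]_n) : Prop :=
  forall i, v 0 i \is a Num.int.

Definition dual_vector (n : nat) (G : 'M[int]_n) (v : 'rV[rat]_n) : Prop :=
  integral_vector (v *m map_mx intr G).

Definition lattice_form (n : nat) (G : 'M[int]_n) (v : 'rV[rat]_n) : rat :=
  (v *m map_mx intr G *m v^T) 0 0 / 2.

(* [L'/L ~ D], given by a homomorphism [pi] from [L'] onto [D] with kernel [L];
   the values of [pi] outside [L'] are irrelevant. *)
Definition discriminant_of (n : nat) (G : 'M[int]_n)
    (D : finZmodType) (q : D -> rat) : Prop :=
  exists pi : 'rV[rat]_n -> D,
    [/\ forall v w, dual_vector G v -> dual_vector G w -> pi (v + w) = pi v + pi w,
        forall g : D, exists2 v, dual_vector G v & pi v = g,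
        forall v, dual_vector G v -> (pi v = 0 <-> integral_vector v)
      & forall v, dual_vector G v -> eqQZ (q (pi v)) (lattice_form G v)].

Definition is_signature (D : finZmodType) (q : D -> rat) (r : int) : Prop :=
  exists (n : nat) (G : 'M[int]_n) (s : int),
    [/\ even_gram G, discriminant_of G q, gram_signature G s
      & (r = s %[mod 8])%Z].

(** * The special shape, its character and its sign vector *)

Inductive two_part : Type :=
  | TwoTrivial
  | TwoTwo of int          (* 2_t^{+2} *)
  | TwoFour of int & int.  (* 2_{t1}^{+1} 4_{t2}^{delta_2} *)

Section Shape.
Variables (D : finZmodType) (q : D -> rat).

(* The generators are additive: ['O_p([set: D])] is the p-primary part of [D],
   [#[g]] is the additive order, [<[g]>] the subgroup generated by [g]. *)
Definition odd_part (p : nat) (delta : int) : Prop :=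
  'O_p([set: D])%g = 1%g \/
  exists (g : D) (a : int),
    [/\ #[g]%g = p, <[g]>%g = 'O_p([set: D])%g,
        eqQZ (q g) (a%:~R / p%:R) & delta = kronecker (2 * a) p].

Definition even_part (d2 : two_part) : Prop :=
  match d2 with
  | TwoTrivial => 'O_2([set: D])%g = 1%g
  | TwoTwo t =>
      (t = 2 \/ t = -2) /\
      exists g1 g2 : D,
        [/\ #[g1]%g = 2%N /\ #[g2]%g = 2%N,
            (<[g1]> \x <[g2]>)%g = 'O_2([set: D])%g,
            eqQZ (bil q g1 g2) 0,
            eqQZ (q g1) (t%:~R / 2 / 4) & eqQZ (q g2) (t%:~R / 2 / 4)]
  | TwoFour t1 t2 =>
      (t1 = 1 \/ t1 = -1) /\ [\/ t2 = 1, t2 = -1, t2 = 3 | t2 = -3] /\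
      exists g1 g2 : D,
        [/\ #[g1]%g = 2%N /\ #[g2]%g = 4%N,
            (<[g1]> \x <[g2]>)%g = 'O_2([set: D])%g,
            eqQZ (bil q g1 g2) 0,
            eqQZ (q g1) (t1%:~R / 4) & eqQZ (q g2) (t2%:~R / 8)]
  end.

Definition special_shape (delta : nat -> int) (d2 : two_part) : Prop :=
  even_part d2 /\ forall p : nat, prime p -> odd p -> odd_part p (delta p).

End Shape.

Definition chi2 (d2 : two_part) (n : int) : int :=
  match d2 with
  | TwoTrivial => 1
  | TwoTwo _ => kronecker (-4) n
  | TwoFour t1 t2 => kronecker (- 2 * kronecker (-1) (t1 * t2)) n
  end.

Definition chi_at (d2 : two_part) (p : nat) (n : int) : int :=
  if p == 2%N then chi2 d2 n else kronecker n p.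

Definition chiD (N : nat) (d2 : two_part) (n : int) : int :=
  \prod_(p <- primes N) chi_at d2 p n.

(* The divisions by 8 are exact, as 4 | N, t = +-2 in the first case and 8 | N
   in the second one; for [TwoTrivial] the index 2 does not occur. *)
Definition epsilon_at (N : nat) (delta : nat -> int) (d2 : two_part)
    (p : nat) : int :=
  if p == 2%N then
    match d2 with
    | TwoTrivial => 1
    | TwoTwo t => chi2 d2 (N%:Z * t %/ 8)%Z
    | TwoFour _ t2 => chi2 d2 (t2 * N%:Z %/ 8)%Z
    end
  else chi_at d2 p (2 * N %/ p)%N * delta p.

Definition omega (m : nat) : nat := size (primes m).

Definition s_mult (N : nat) (n : int) : nat := (2 ^ omega (gcdn `|n| N))%N.

(* N q(g) as an integer; the floor is exact when [N] is the level. *)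
Definition Nq (D : finZmodType) (q : D -> rat) (N : nat) (g : D) : int :=
  Num.floor (N%:R * q g).

(** * Integral matrices *)

Definition mat2 (A : Type) (a b c d : A) : 'M[A]_2 :=
  \matrix_(i, j) if i == 0 then (if j == 0 then a else b)
                 else (if j == 0 then c else d).

Definition matT : 'M[int]_2 := mat2 1 1 0 1.
Definition matS : 'M[int]_2 := mat2 0 (-1) 1 0.

Definition SL2Z (M : 'M[int]_2) : Prop := \det M = 1.

Definition Gamma0 (N : nat) (M : 'M[int]_2) : Prop := SL2Z M /\ (N %| M 1%R 0%R)%Z.

From mathcomp Require Import all_classical all_reals all_analysis.
From mathcomp Require Import complex.
Import numFieldNormedType.Exports.
Local Open Scope classical_set_scope.

(* A full set of representatives of Gamma_0(N) \ SL_2(Z). *)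
Definition coset_reps (N : nat) (E : set 'M[int]_2) : Prop :=
  (forall M, E M -> SL2Z M) /\
  forall M, SL2Z M ->
    exists! M', E M' /\ exists2 g, Gamma0 N g & M = g *m M'.

(** * Functions on the upper half-plane *)

Notation group_space R D := {ffun D -> R[i]^o}.

Section Forms.
Variable R : realType.

(* [R[i]^o] is the field of complex numbers with its structure of normed
   vector space over itself. *)
Local Notation C := (R[i]^o).

Definition upper : Type := {z : R[i] | 0 < complex.Im z}.

Definition e2pi (z : R[i]) : R[i] :=
  let x := 2 * pi * complex.Re z in
  (expR (- (2 * pi * complex.Im z)))%:C%C * (cos x +i* sin x)%C.

Definition autfactor (M : 'M[R]_2) (t : upper) : R[i] :=
  (M 1 0)%:C%C * val t + (M 1 1)%:C%C.

(* The quotient lies in the upper half-plane whenever [0 < \det M]; the default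
   value [t] is then not used. *)
Definition mobius (M : 'M[R]_2) (t : upper) : upper :=
  insubd t (((M 0 0)%:C%C * val t + (M 0 1)%:C%C) / autfactor M t).

Definition slash (k : int) (M : 'M[R]_2) (f : upper -> C) : upper -> C :=
  fun t => (\det M `^ (k%:~R / 2))%:C%C * autfactor M t ^ (- k) * f (mobius M t).

Definition realmx (M : 'M[int]_2) : 'M[R]_2 := map_mx intr M.

Definition matW (N : nat) : 'M[R]_2 := mat2 0 (-1) N%:R 0.

Definition extend0 (f : upper -> C) (z : C) : C :=
  if insub (z : R[i]) is Some t then f t else 0.

Definition holomorphic (f : upper -> C) : Prop :=
  forall t : upper, derivable (extend0 f) (val t : C) 1.

(* f(tau) = sum over n of a(n) e(n tau / h), with finitely many negative n. *)
Definition fourier (h : nat) (f : upper -> C) (a : int -> C) : Prop :=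
  exists n0 : int, (forall n : int, n < n0 -> a n = 0) /\
    forall t : upper,
      series (fun j : nat =>
        a (n0 + j%:Z) * e2pi ((n0 + j%:Z)%:~R * val t / h%:R) : C) @ \oo --> f t.

Definition meromorphic_infty (f : upper -> C) : Prop :=
  exists (h : nat) (a : int -> C), (0 < h)%N /\ fourier h f a.

(** * Scalar-valued forms *)

Definition scalar_forms (N : nat) (k : int) (chi : int -> int) : set (upper -> C) :=
  [set f | [/\ holomorphic f,
     forall M, SL2Z M -> meromorphic_infty (slash k (realmx M) f)
   & forall M, Gamma0 N M ->
       forall t, slash k (realmx M) f t = (chi (M 1 1))%:~R * f t]].

Definition scalar_forms_eps (N : nat) (k : int) (delta : nat -> int)
    (d2 : two_part) : set (upper -> C) :=
  [set f | scalar_forms N k (chiD N d2) f /\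
     exists a : int -> C, fourier 1 f a /\
       forall (n : int) (p : nat), p \in primes N ->
         chi_at d2 p n = - epsilon_at N delta d2 p -> a n = 0].

(** * The Weil representation and vector-valued forms *)

Section Vector.
Variables (D : finZmodType) (q : D -> rat).

Local Notation group_space := (group_space R D).

Definition basis_vec (g : D) : group_space := [ffun b => (b == g)%:R].

(* [r] is meant to be even. Only the values of [rho] on SL_2(Z) matter. *)
Definition weil_rep (r : int)
    (rho : 'M[int]_2 -> {linear group_space -> group_space}) : Prop :=
  [/\ forall v, rho 1%:M v = v,
      forall M M' v, SL2Z M -> SL2Z M' -> rho (M *m M') v = rho M (rho M' v),
      forall g, rho matT (basis_vec g) = e2pi (ratr (q g)) *: basis_vec g
    & forall g, rho matS (basis_vec g) =
        ('i%C ^ (- (r %/ 2)%Z) / (Num.sqrt #|D|%:R)%:C%C) *: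
        \sum_(b : D) e2pi (ratr (- bil q b g)) *: basis_vec b].

Variable rho : 'M[int]_2 -> {linear group_space -> group_space}.

Definition component (F : upper -> group_space) (g : D) : upper -> C :=
  fun t => F t g.

Definition vector_forms (k : int) : set (upper -> group_space) :=
  [set F | (forall M, SL2Z M -> forall t : upper,
              \sum_(g : D) slash k (realmx M) (component F g) t *: basis_vec g
              = rho M (F t)) /\
           forall g, holomorphic (component F g) /\
                     meromorphic_infty (component F g)].

Definition vector_forms_inv (k : int) : set (upper -> group_space) :=
  [set F | vector_forms k F /\
     forall s : {perm D}, form_automorphism q s ->
       forall (g : D) (t : upper), F t (s g) = F t g].

Definition phi (N : nat) (r k : int) (F : upper -> group_space) : upper -> C :=
  fun t => 'i%C ^ (r %/ 2)%Z * 2 ^- omega N *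
    (N%:R `^ (- ((k - 1)%:~R / 2)))%:C%C * slash k (matW N) (component F 0) t.

(* The sum over Gamma_0(N) \ SL_2(Z) is computed on representatives [E]. *)
Definition psi (N : nat) (r k : int) (E : set 'M[int]_2) (f : upper -> C) :
    upper -> group_space :=
  fun t => ('i%C ^ (r %/ 2)%Z * (N%:R `^ ((k - 1)%:~R / 2))%:C%C) *:
    \sum_(M \in E)
      (slash k (realmx M) (slash k (matW N) f) t *: rho (invmx M) (basis_vec 0)).

End Vector.

Definition linear_on (U V : lmodType R[i]) (A : set U) (f : U -> V) : Prop :=
  forall (c : R[i]) (x y : U), A x -> A y -> f (c *: x + y) = c *: f x + f y.

Definition inverse_isomorphisms (U V : lmodType R[i]) (A : set U) (B : set V)
    (f : U -> V) (g : V -> U) : Prop :=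
  [/\ forall x, A x -> B (f x), forall y, B y -> A (g y),
      linear_on A f /\ linear_on B g,
      forall x, A x -> g (f x) = x & forall y, B y -> f (g y) = y].

End Forms.

(* Main.v *)
(** Put f'(tau) = f(tau / N). Splitting D into its primary components and
    evaluating Gauss sums gives rho_D(M) e_0 = chi_D(a) e_0 for M in Gamma_0(N),
    so F_0 is a chi_D-eigenform of Gamma_0(N), and the sum of all F_g, a multiple
    of F_0 | S, is one of Gamma^0(N). If N q(g) is prime to N, the coefficient of
    rho_D(M^-1) e_0 at e_g vanishes unless the lower left entry of M is prime to
    N; hence only the cosets of S^-1 T^i contribute to psi(f)_g, which is
    therefore the part of f' with exponents congruent to N q(g).

    There are prod_p (1 + epsilon_p chi_p(j)) elements g with N q(g) = j mod N.
    By the sign condition, y = 2^omega(N) f' - sum_g psi(f)_g thus has no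
    exponents prime to N. Removing from a form on Gamma^0(N) the exponents
    divisible by a prime p | N is injective, because chi_D is primitive; doing so
    for all p kills y, so y = 0, that is phi(psi(f)) = f. Finally Aut(D) acts
    transitively on the level sets of q, so that an invariant F is determined by
    sum_g F_g, which gives psi(phi(F)) = F and the explicit formula. *)
Require Import Defs.
From mathcomp Require Import all_boot all_order all_algebra all_fingroup all_solvable all_field.
From mathcomp Require Import zify ring lra.
Set Implicit Arguments.
Unset Strict Implicit.
Unset Printing Implicit Defensive.
Import Order.TTheory GRing.Theory Num.Theory.
Local Open Scope ring_scope.

(** * Legendre and Kronecker symbols *)

(** Two obstacles shape the proof. The formula for rho_D(M) e_0 must be checked on words in S and T,
    while the local computation only sees congruences. It is replaced by a family v(a, c) attached
    to first columns, built one prime at a time and subject to the rules of S and T; induction over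
    words identifies it with rho_D(M) e_0. Gauss sums enter only through G(x) = chi_p(x) G(1), a
    consequence of counting the values of q, and through G(1) G(-1) = |D_p|. The constant of
    rho_D(S) is tied to the sum of all e(q(g)) by the relation T S T S = S T^-1 applied to e_0.
    Removing the exponents divisible by one prime destroys the eigenproperty under Gamma^0(N), so
    this step cannot be iterated as it stands. What survives is the eigenproperty under the elements
    of Gamma^0(N) congruent to 1 modulo N/N_p, for each prime p not yet treated: modulo N they
    commute with the translations T^(N/p') used for the other primes p'. This part is linear algebra
    over SL_2(Z/N), where exponents congruent to j are selected by a finite average over the T^i. *)

Lemma finField_prim_root (F : finFieldType) :
  exists z : F, (#|F|.-1).-primitive_root z.
Proof.
have c1 : (1 < #|F|)%N by exact: finNzRing_gt1.
pose rs := enum (predC1 (0 : F)).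
suff /hasP[z _ zP] : has (#|F|.-1).-primitive_root rs by exists z.
have n0 : (0 < #|F|.-1)%N by lia.
apply: (has_prim_root n0 _ (enum_uniq _)); last by rewrite -cardE cardC1.
apply/allP=> x; rewrite mem_enum inE => xn0.
rewrite unity_rootE -(inj_eq (mulfI xn0)) -exprS prednK ?expf_card ?mulr1//.
by lia.
Qed.

Lemma finField_euler (F : finFieldType) (x : F) : odd #|F| -> x != 0 ->
  (exists y, y ^+ 2 = x) <-> x ^+ #|F|./2 = 1.
Proof.
move=> oF xn0.
have c1 : (1 < #|F|)%N by exact: finNzRing_gt1.
have [z zP] := finField_prim_root F.
have e y : y != 0 -> y ^+ #|F|.-1 = 1 :> F.
  move=> yn0; apply: (mulfI yn0); rewrite -exprS prednK ?expf_card ?mulr1 //; lia.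
have hE : (#|F|./2 * 2 = #|F|.-1)%N by lia.
split=> [[y yx]|xh].
  rewrite -yx -exprM mulnC hE e //; apply: contraNneq xn0 => y0.
  by rewrite -yx y0 expr0n.
have [[i /= _] xi] := prim_rootP zP (e _ xn0).
have : (#|F|.-1 %| i * #|F|./2)%N by rewrite (prim_order_dvd zP) exprM -xi xh.
rewrite -hE mulnC dvdn_pmul2r; last by lia.
by move=> /dvdnP[j ij]; exists (z ^+ j); rewrite -exprM -ij.
Qed.

Lemma finField_expf_half (F : finFieldType) (x : F) : odd #|F| -> x != 0 ->
  (x ^+ #|F|./2 == 1) || (x ^+ #|F|./2 == -1).
Proof.
move=> oF xn0; rewrite -eqf_sqr expr1n -exprM.
have -> : (#|F|./2 * 2 = #|F|.-1)%N by lia.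
have c1 : (1 < #|F|)%N by exact: finNzRing_gt1.
apply/eqP/(mulfI xn0); rewrite -exprS prednK ?expf_card ?mulr1 //; lia.
Qed.

Section Legendre.
Variables (p : nat) (pp : prime p) (op : odd p).

Let p2 : (2 < p)%N. Proof. by have := prime_gt1 pp; lia. Qed.

Lemma intFp_eq (a b : int) :
  (a%:~R == b%:~R :> 'F_p) = (a == b %[mod p])%Z.
Proof. by rewrite -subr_eq0 -rmorphB /= -(dvdz_pcharf (pchar_Fp pp)) eqz_mod_dvd. Qed.

(** Identities between Legendre symbols are proved in ['F_p], where Euler's criterion turns the
    symbols into powers. As p > 2, the values -1, 0 and 1 stay distinct there. *)
Lemma intFp_small_inj (a b : int) : (-1 <= a <= 1) -> (-1 <= b <= 1) ->
  a%:~R = b%:~R :> 'F_p -> a = b.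
Proof.
move=> ha hb /eqP; rewrite intFp_eq eqz_mod_dvd => /dvdzP[k abk].
have : k = 0 \/ 1 <= k \/ k <= -1 by lia.
by case=> [|[|]] hk; move: abk; rewrite ?hk; nia.
Qed.

Lemma legendre_range a : -1 <= legendre a p <= 1.
Proof. by rewrite /legendre; case: ifP => // _; case: ifP. Qed.

Lemma legendreE (a : int) : (legendre a p)%:~R = a%:~R ^+ p./2 :> 'F_p.
Proof.
rewrite /legendre (dvdz_pcharf (pchar_Fp pp)).
have oF : odd #|'F_p| by rewrite card_Fp.
case: eqP => [->|/eqP a0]; first by rewrite expr0n; case: eqP => //; lia.
have := finField_euler oF a0; rewrite card_Fp // => eul.
case: existsP => [[x]|nex].
  rewrite -intFp_eq => /eqP xa.
  apply/esym/eul; exists (x : nat)%:~R.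
  by rewrite -xa rmorphXn.
have := finField_expf_half oF a0; rewrite card_Fp // => /orP[/eqP h|/eqP -> //].
case: nex.
case/eul: h => y ya.
have yp : (y < p)%N by apply: leq_trans (ltn_ord y) _; rewrite Fp_cast.
exists (Ordinal yp); rewrite -intFp_eq rmorphXn /= -ya.
by rewrite -[X in _ == X ^+ _](natr_Zp y).
Qed.

Lemma legendreM a b : legendre (a * b) p = legendre a p * legendre b p.
Proof.
apply: intFp_small_inj; rewrite ?legendre_range //.
  by have := legendre_range a; have := legendre_range b; nia.
by rewrite rmorphM /= !legendreE rmorphM exprMn.
Qed.

Lemma legendre_mod a b : (a = b %[mod p])%Z -> legendre a p = legendre b p.
Proof.
move=> /eqP; rewrite -intFp_eq => /eqP ab.
by apply: intFp_small_inj; rewrite ?legendre_range // !legendreE ab.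
Qed.

Lemma legendre_eq0 a : (legendre a p == 0) = (p %| a)%Z.
Proof. by rewrite /legendre; case: ifP => // _; case: ifP. Qed.

Lemma legendre1 : legendre 1 p = 1.
Proof.
apply: intFp_small_inj; rewrite ?legendre_range // legendreE.
by rewrite expr1n.
Qed.

Lemma legendreN1 : legendre (-1) p = if (p %% 4 == 1)%N then 1 else -1.
Proof.
apply: intFp_small_inj; rewrite ?legendre_range //; first by case: ifP.
rewrite legendreE rmorphN1 -signr_odd.
have -> : odd p./2 = ~~ (p %% 4 == 1)%N by lia.
by case: ifP.
Qed.

Lemma exists_nonresidue : exists a : int, legendre a p = -1.
Proof.
have [z zP] := finField_prim_root 'F_p.
exists (z : nat)%:Z; apply: intFp_small_inj; rewrite ?legendre_range //.
have zE : (z : nat)%:~R = z by rewrite -[in RHS](natr_Zp z).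
rewrite card_Fp // in zP.
have z0 : z != 0.
  apply/eqP => z0; have := prim_expr_order zP.
  rewrite z0 expr0n; case: eqP => [|_ /eqP]; first by lia.
  by rewrite eq_sym oner_eq0.
have oF : odd #|'F_p| by rewrite card_Fp.
have := finField_expf_half oF z0; rewrite card_Fp // legendreE zE.
case/orP => [|/eqP-> //]; rewrite -(prim_order_dvd zP) => /dvdn_leq; lia.
Qed.

End Legendre.

(* A primitive eighth root of unity w of F_(p^2) has (w + 1/w)^2 = 2, and the
   Frobenius fixes w + 1/w exactly when p = +-1 mod 8. *)
Lemma legendre2 (p : nat) : prime p -> odd p ->
  legendre 2 p = if (p %% 8 == 1)%N || (p %% 8 == 7)%N then 1 else -1.
Proof.
move=> pp op; apply: (intFp_small_inj pp op); rewrite ?legendre_range //.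
  by case: ifP.
have [F pF cF] := @pPrimePowerField p 2 pp isT.
have p2 : (2 < p)%N by have := prime_gt1 pp; lia.
have [z zP] := finField_prim_root F.
rewrite cF in zP.
have d8 : (8 %| (p ^ 2).-1)%N.
  have [h ph] : exists h, p = (4 * h + 1)%N \/ p = (4 * h + 3)%N.
    by exists (p %/ 4)%N; lia.
  by case: ph => ->; apply/dvdnP; [exists (2 * h ^ 2 + h)%N|exists (2 * h ^ 2 + 3 * h + 1)%N]; lia.
pose w := z ^+ ((p ^ 2).-1 %/ 8).
have wP : 8.-primitive_root w.
  have := exp_prim_root zP ((p ^ 2).-1 %/ 8).
  suff -> : ((p ^ 2).-1 %/ gcdn ((p ^ 2).-1 %/ 8) (p ^ 2).-1 = 8)%N by [].
  have e := divnK d8.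
  have n0 : (0 < (p ^ 2).-1)%N by rewrite -subn1 subn_gt0; nia.
  have -> : gcdn ((p ^ 2).-1 %/ 8) (p ^ 2).-1 = ((p ^ 2).-1 %/ 8)%N.
    by apply/gcdn_idPl/dvdnP; exists 8; rewrite mulnC e.
  by rewrite -{1}e mulKn //; lia.
clearbody w; have w8 : w ^+ 8 = 1 by exact: prim_expr_order.
have w4 : w ^+ 4 = -1.
  have : (w ^+ 4 == 1) || (w ^+ 4 == -1) by rewrite -eqf_sqr -exprM w8 expr1n.
  by case/orP => /eqP // h; have := prim_order_dvd wP 4; rewrite h eqxx.
pose y := w + w ^+ 7.
have y2 : y ^+ 2 = 2.
  have -> : y ^+ 2 = w ^+ 2 + 2 * w ^+ 8 + w ^+ 2 * w ^+ 4 * w ^+ 8 by rewrite /y; ring.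
  by rewrite w8 w4; ring.
have wp : w ^+ p = w ^+ (p %% 8) by rewrite -(prim_expr_mod wP).
have yp : y ^+ p = w ^+ (p %% 8) + w ^+ ((7 * p) %% 8).
  rewrite -[y ^+ p](pFrobenius_autE pF) rmorphD /= !pFrobenius_autE -exprM.
  by rewrite wp -[w ^+ (7 * p)](prim_expr_mod wP).
have y0 : y != 0.
  apply/eqP => y0; move: y2; rewrite y0 expr0n /= => /esym/eqP.
  by rewrite -(dvdn_pcharf pF) => /dvdn_leq; lia.
have yh : y ^+ p = y * 2 ^+ p./2.
  rewrite -y2 -exprM -exprS; congr (_ ^+ _); lia.
(* The computation takes place in [F], the symbol lives in ['F_p]; both have characteristic p, so
   the same integers vanish in them. *)
have key (b : int) : 2 ^+ p./2 = b%:~R :> F -> (legendre 2 p)%:~R = b%:~R :> 'F_p.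
  move=> h; rewrite (legendreE pp op).
  apply/eqP; rewrite -[X in X ^+ _]/(2%:~R) -rmorphXn intFp_eq // eqz_mod_dvd.
  by rewrite (dvdz_pcharf pF) rmorphB /= rmorphXn /= h subrr.
apply: key; apply: (mulfI y0); rewrite -yh yp.
have : [\/ (p %% 8 = 1)%N, (p %% 8 = 3)%N, (p %% 8 = 5)%N | (p %% 8 = 7)%N].
  have : (p %% 8 = 1 \/ p %% 8 = 3 \/ p %% 8 = 5 \/ p %% 8 = 7)%N by lia.
  by case=> [|[|[|]]]; [constructor 1|constructor 2|constructor 3|constructor 4].
have w7 : w ^+ 7 = - w ^+ 3 by rewrite (exprD _ 4 3) w4 mulN1r.
have w5 : w ^+ 5 = - w by rewrite (exprD _ 4 1) w4 mulN1r.
case=> h; rewrite -modnMmr h /= /y.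
- by rewrite mulr1.
- by rewrite w5 w7 rmorphN1; ring.
- by rewrite w5 w7 rmorphN1; ring.
- by rewrite expr1 mulr1 addrC.
Qed.

(** [kronecker] is defined by factoring its lower argument, whereas the characters needed below are
    given by residues. Complete multiplicativity reduces the comparison to the primes, -1 and 0. The
    condition on the absolute value of [a] reflects the convention (1/0) = (-1/0) = 1. *)
Lemma kronecker_completely_multiplicative (a : int) (chi : int -> int) :
  chi 1 = 1 -> (forall x y, chi (x * y) = chi x * chi y) ->
  chi 0 = 0 -> `|a|%N != 1%N -> chi (-1) = (if a < 0 then -1 else 1) ->
  (forall p : nat, prime p -> kronecker_prime a p = chi p) ->
  forall n, kronecker a n = chi n.
Proof.
move=> chi1 chiM chi0 a1 chiN chip n; rewrite /kronecker.
case: eqP => [->|/eqP n0]; first by rewrite chi0 (negPf a1).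
have pos (m : nat) : (0 < m)%N ->
    \prod_(p <- primes m) kronecker_prime a p ^+ logn p m = chi m%:Z.
  move=> m0; rewrite [in RHS](prod_prime_decomp m0) prime_decompE big_map.
  transitivity (\prod_(p <- primes m) chi (p ^ logn p m)%N).
    rewrite !big_seq; apply: eq_bigr => p; rewrite mem_primes => /andP[pp _].
    rewrite chip //; elim: (logn p m) => [|k ih]; first by rewrite chi1.
    by rewrite exprS expnS PoszM chiM ih.
  elim: (primes m) => [|p s ih]; first by rewrite !big_nil chi1.
  by rewrite !big_cons /= PoszM chiM ih.
rewrite pos ?absz_gt0 //; case: ltP => h /=.
  by rewrite -chiN -chiM; congr chi; lia.
by rewrite mul1r; congr chi; lia.
Qed.

Definition chi_m4 (n : int) : int :=
  if (n %% 4 == 1)%Z then 1 else if (n %% 4 == 3)%Z then -1 else 0.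

(* [chi_8 1] and [chi_8 (-1)] are the two primitive characters modulo 8. *)
Definition chi_8 (s n : int) : int :=
  if (n %% 8 == 1)%Z then 1 else if (n %% 8 == 3)%Z then - s
  else if (n %% 8 == 5)%Z then -1 else if (n %% 8 == 7)%Z then s else 0.

Lemma chi_m4_mod x y : (x = y %[mod 4])%Z -> chi_m4 x = chi_m4 y.
Proof. by rewrite /chi_m4 => ->. Qed.

Lemma chi_8_mod s x y : (x = y %[mod 8])%Z -> chi_8 s x = chi_8 s y.
Proof. by rewrite /chi_8 => ->. Qed.

Lemma modz_lt (x : int) (n : nat) : (0 < n)%N ->
  exists2 i : nat, (i < n)%N & (x = i%:Z %[mod n])%Z.
Proof.
move=> n0; exists `|(x %% n)%Z|%N.
  by have := @ltz_mod x n; have := @modz_ge0 x n; lia.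
by rewrite gez0_abs ?modz_ge0 ?modz_mod //; lia.
Qed.

Lemma chi_m4M x y : chi_m4 (x * y) = chi_m4 x * chi_m4 y.
Proof.
have [i i4 xi] := @modz_lt x 4 isT; have [j j4 yj] := @modz_lt y 4 isT.
have xy : (x * y = i%:Z * j%:Z %[mod 4])%Z by rewrite -modzMml -modzMmr xi yj modzMml modzMmr.
rewrite (chi_m4_mod xi) (chi_m4_mod yj) (chi_m4_mod xy).
move: i i4 j j4 {xi yj xy}.
by do 4?[case=> //]; move=> _; do 4?[case=> //].
Qed.

Lemma chi_8M s x y : s = 1 \/ s = -1 -> chi_8 s (x * y) = chi_8 s x * chi_8 s y.
Proof.
have [i i4 xi] := @modz_lt x 8 isT; have [j j4 yj] := @modz_lt y 8 isT.
have xy : (x * y = i%:Z * j%:Z %[mod 8])%Z by rewrite -modzMml -modzMmr xi yj modzMml modzMmr.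
rewrite (chi_8_mod s xi) (chi_8_mod s yj) (chi_8_mod s xy).
move: i i4 j j4 {xi yj xy} => i i4 j j4 [] ->; move: i i4 j j4;
by do 8?[case=> //]; move=> _; do 8?[case=> //].
Qed.

Lemma odd_prime_cases (p : nat) : prime p -> p = 2%N \/ odd p.
Proof. by case/even_prime; [left|right]. Qed.

Lemma kronecker_m4 n : kronecker (-4) n = chi_m4 n.
Proof.
apply: kronecker_completely_multiplicative => //; first exact: chi_m4M.
move=> p pp; case: (odd_prime_cases pp) => [-> //|op].
rewrite /kronecker_prime; case: eqP => [p2|_]; first by rewrite p2 in op.
rewrite (_ : -4 = -1 * (2 * 2)) // !(legendreM pp op).
have := legendre2 pp op; rewrite (legendreN1 pp op) => ->.
rewrite /chi_m4; have [h|h] : (p %% 4 = 1 \/ p %% 4 = 3)%N by lia.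
- have -> : (p%:Z %% 4)%Z = 1 by lia.
  by rewrite h; case: ifP.
- have -> : (p%:Z %% 4)%Z = 3 by lia.
  by rewrite h; case: ifP.
Qed.

Lemma kronecker_8 s n : s = 1 \/ s = -1 -> kronecker (2 * s) n = chi_8 s n.
Proof.
move=> hs; apply: kronecker_completely_multiplicative => //.
- by move=> x y; apply: chi_8M.
- by case: hs => ->.
- by case: hs => ->.
move=> p pp; case: (odd_prime_cases pp) => [->|op]; first by case: hs => ->.
rewrite /kronecker_prime; case: eqP => [p2|_]; first by rewrite p2 in op.
rewrite !(legendreM pp op) (legendre2 pp op).
have -> : legendre s p = if (p %% 4 == 1)%N then 1 else s.
  by case: hs => ->; rewrite ?legendreN1 ?legendre1 //; case: ifP.
rewrite /chi_8.
have : (p %% 8 = 1 \/ p %% 8 = 3 \/ p %% 8 = 5 \/ p %% 8 = 7)%N by lia.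
case=> [|[|[|]]] h.
- have [-> ->] : (p%:Z %% 8)%Z = 1 /\ (p %% 4 = 1)%N by lia.
  by rewrite h /= ?mul1r ?mulr1.
- have [-> ->] : (p%:Z %% 8)%Z = 3 /\ (p %% 4 = 3)%N by lia.
  by rewrite h /= mulN1r.
- have [-> ->] : (p%:Z %% 8)%Z = 5 /\ (p %% 4 = 1)%N by lia.
  by rewrite h /= ?mul1r ?mulr1.
- have [-> ->] : (p%:Z %% 8)%Z = 7 /\ (p %% 4 = 3)%N by lia.
  by rewrite h /= mul1r.
Qed.

Lemma kronecker_odd_prime n (p : nat) : prime p -> odd p -> kronecker n p = legendre n p.
Proof.
move=> pp op; rewrite /kronecker; case: eqP => [|_]; first by have := prime_gt1 pp; lia.
rewrite absz_nat primes_prime // big_seq1 logn_prime // eqxx expr1 /=.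
by rewrite mul1r /kronecker_prime; case: eqP => // p2; rewrite p2 in op.
Qed.

(** [qchar_primitive] is primitivity for a power P of p: chi is nontrivial on the classes congruent
    to 1 modulo P/p. For P = p it only asks for a value -1. *)
Record quadratic_char (p P : nat) (chi : int -> int) : Prop := QuadraticChar {
  qchar_mod : forall x y, (x = y %[mod P])%Z -> chi x = chi y;
  qcharM : forall x y, chi (x * y) = chi x * chi y;
  qchar_eq0 : forall x, (chi x == 0) = (p %| x)%Z;
  qchar_range : forall x, [\/ chi x = 0, chi x = 1 | chi x = -1];
  qchar_primitive : exists t : int, chi (1 + (P %/ p)%N%:Z * t) = -1 }.

Lemma legendre_char (p : nat) : prime p -> odd p ->
  quadratic_char p p (fun n => kronecker n p).
Proof.
move=> pp op; split=> *; rewrite ?kronecker_odd_prime //.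
- exact: legendre_mod.
- exact: legendreM.
- exact: legendre_eq0.
- rewrite /legendre; case: ifP => _; first by constructor 1.
  by case: ifP => _; [constructor 2|constructor 3].
- have [a ha] := exists_nonresidue pp op; exists (a - 1).
  rewrite kronecker_odd_prime // divnn prime_gt0 //= mul1r -ha; congr legendre; lia.
Qed.

Lemma chi_m4_char : quadratic_char 2 4 (kronecker (-4)).
Proof.
split=> *; rewrite ?kronecker_m4.
- exact: chi_m4_mod.
- exact: chi_m4M.
- rewrite /chi_m4; case: ifP; [lia|case: ifP; lia].
- rewrite /chi_m4; case: ifP => _; first by constructor 2.
  by case: ifP => _; [constructor 3|constructor 1].
- by exists 1; rewrite kronecker_m4.
Qed.

Lemma chi_8_char s : s = 1 \/ s = -1 -> quadratic_char 2 8 (kronecker (2 * s)).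
Proof.
move=> hs; split=> *; rewrite ?kronecker_8 //.
- exact: chi_8_mod.
- exact: chi_8M.
- rewrite /chi_8; case: hs => ->; do ![case: ifP => ?]; try lia.
- by rewrite /chi_8; case: hs => ->; do ![case: ifP => _];
    first [by constructor 1|by constructor 2|by constructor 3].
- by exists 1; rewrite kronecker_8.
Qed.

Lemma qchar1 p P chi : prime p -> quadratic_char p P chi -> chi 1 = 1.
Proof.
move=> pp h; have := qcharM h 1 1; rewrite mulr1.
have : chi 1 != 0 by rewrite (qchar_eq0 h) dvdz1; have := prime_gt1 pp; lia.
by case: (qchar_range h 1) => ->.
Qed.

(** * Quadratic forms on finite abelian groups *)

Section EqQZ.
Implicit Types x y z : rat.

Lemma eqQZ_refl x : eqQZ x x. Proof. by rewrite /eqQZ subrr. Qed.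
Lemma eqQZ_sym x y : eqQZ x y -> eqQZ y x.
Proof. by rewrite /eqQZ -opprB rpredN. Qed.
Lemma eqQZ_trans y x z : eqQZ x y -> eqQZ y z -> eqQZ x z.
Proof. by move=> h1 h2; rewrite /eqQZ -(subrKA y) rpredD. Qed.
Lemma eqQZD x y x' y' : eqQZ x x' -> eqQZ y y' -> eqQZ (x + y) (x' + y').
Proof. by move=> h1 h2; rewrite /eqQZ opprD addrACA rpredD. Qed.
Lemma eqQZN x y : eqQZ x y -> eqQZ (- x) (- y).
Proof. by rewrite /eqQZ -opprD rpredN. Qed.
Lemma eqQZB x y x' y' : eqQZ x x' -> eqQZ y y' -> eqQZ (x - y) (x' - y').
Proof. by move=> h1 h2; apply: eqQZD => //; apply: eqQZN. Qed.
Lemma eqQZZ (n : int) x y : eqQZ x y -> eqQZ (n%:~R * x) (n%:~R * y).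
Proof. by move=> h; rewrite /eqQZ -mulrBr rpredM // intr_int. Qed.
Lemma eqQZMn (n : nat) x y : eqQZ x y -> eqQZ (n%:R * x) (n%:R * y).
Proof. exact: (@eqQZZ n%:Z). Qed.
Lemma eqQZ0 x : eqQZ x 0 <-> x \is a Num.int.
Proof. by rewrite /eqQZ subr0. Qed.
Lemma eqQZ_int x y : eqQZ x y -> (x \is a Num.int) = (y \is a Num.int).
Proof.
move=> h; apply/idP/idP => hx.
  by rewrite -[y](subKr x) rpredB //.
by rewrite -[x](subrK y) rpredD //.
Qed.

Lemma divz_int (n : int) (P : nat) : (0 < P)%N ->
  ((n%:~R / P%:R : rat) \is a Num.int) = (P %| n)%Z.
Proof.
move=> P0; have Pn : (P%:R : rat) != 0 by rewrite pnatr_eq0; lia.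
apply/idP/idP => [/intrP[m hm]|/dvdzP[m ->]].
  apply/dvdzP; exists m; apply: (@intr_inj rat).
  by rewrite rmorphM /= -hm divfK.
by rewrite rmorphM /= mulfK // intr_int.
Qed.

Lemma eqQZ_coprime (m1 m2 : nat) x : coprime m1 m2 ->
  eqQZ (m1%:R * x) 0 -> eqQZ (m2%:R * x) 0 -> eqQZ x 0.
Proof.
rewrite !eqQZ0 => co h1 h2; have [[u v] /= uv] := @coprimezP m1 m2 co.
have : ((u * m1%:Z + v * m2%:Z)%:~R : rat) * x = x.
  by rewrite uv mul1r.
move=> <-; rewrite rmorphD !rmorphM /= mulrDl -!mulrA; rewrite rpredD // rpredM ?intr_int //.
Qed.

End EqQZ.

Section Torsion.
Variable D : finZmodType.

Definition tor (m : nat) : {set D} := [set x : D | x *+ m == 0].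

Lemma torP m x : reflect (x *+ m = 0) (x \in tor m).
Proof. by rewrite inE; apply: eqP. Qed.

Lemma tor0 m : 0 \in tor m. Proof. by rewrite inE mul0rn. Qed.
Lemma torD m x y : x \in tor m -> y \in tor m -> x + y \in tor m.
Proof. by rewrite !inE mulrnDl => /eqP-> /eqP->; rewrite addr0. Qed.
Lemma torN m x : (- x \in tor m) = (x \in tor m).
Proof. by rewrite !inE mulNrn oppr_eq0. Qed.
Lemma torB m x y : x \in tor m -> y \in tor m -> x - y \in tor m.
Proof. by move=> hx hy; rewrite torD // torN. Qed.
Lemma torMn m x n : x \in tor m -> x *+ n \in tor m.
Proof. by rewrite !inE mulrnAC => /eqP->; rewrite mul0rn. Qed.
Lemma torMz m x n : x \in tor m -> x *~ n \in tor m.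
Proof. by case: n => n hx; rewrite ?NegzE ?mulrNz ?torN; apply: torMn. Qed.

Lemma tor_dvd m n x : (m %| n)%N -> x \in tor m -> x \in tor n.
Proof. by move=> /dvdnP[k ->]; rewrite !inE mulnC mulrnA => /eqP->; rewrite mul0rn. Qed.

Lemma tor_mod m x i j : x \in tor m -> (i = j %[mod m])%N -> x *+ i = x *+ j.
Proof.
move=> /torP hx ij.
have h n : x *+ n = x *+ (n %% m) by rewrite [in LHS](divn_eq n m) mulrnDr mulnC mulrnA hx mul0rn add0r.
by rewrite h ij -h.
Qed.

(** The Chinese remainders [n1] and [n2] are orthogonal idempotents modulo m1 m2; multiplying by
    them inverts the addition of the two parts. *)
Lemma tor_sum_split (V : nmodType) (F : D -> V) m1 m2 : coprime m1 m2 ->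
  \sum_(x in tor (m1 * m2)) F x =
  \sum_(y in tor m1) \sum_(z in tor m2) F (y + z).
Proof.
move=> co; rewrite pair_big /=.
set n1 := chinese m1 m2 1 0; set n2 := chinese m1 m2 0 1.
have n11 : (n1 = 1 %[mod m1])%N by exact: chinese_modl.
have n12 : (n1 = 0 %[mod m2])%N by exact: chinese_modr.
have n21 : (n2 = 0 %[mod m1])%N by exact: chinese_modl.
have n22 : (n2 = 1 %[mod m2])%N by exact: chinese_modr.
clearbody n1 n2.
rewrite (reindex_onto (fun yz : D * D => yz.1 + yz.2) (fun x => (x *+ n1, x *+ n2))) /=.
  apply: eq_bigl => -[y z] /=.
  have c2 : (n1 + n2 = 1 %[mod m1 * m2])%N.
    apply/eqP; rewrite chinese_remainder //.
    by rewrite -modnDm n11 n21 modnDm eqxx -modnDm n12 n22 modnDm eqxx.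
  apply/idP/idP.
    case/andP => hyz /eqP[e1 e2]; apply/andP; split.
      rewrite -e1; move: n12 => /eqP; rewrite eqn_mod_dvd // subn0 => /dvdnP[k ->].
      have e : (k * m2 * m1 = m1 * m2 * k)%N by rewrite mulnC (mulnC k) mulnA.
      by apply/torP; rewrite -mulrnA e mulrnA (torP _ _ hyz) mul0rn.
    rewrite -e2; move: n21 => /eqP; rewrite eqn_mod_dvd // subn0 => /dvdnP[k ->].
    have e : (k * m1 * m2 = m1 * m2 * k)%N by rewrite -mulnA mulnC.
    by apply/torP; rewrite -mulrnA e mulrnA (torP _ _ hyz) mul0rn.
  case/andP => hy hz; apply/andP; split.
    by apply: torD; [apply: tor_dvd (dvdn_mulr _ (dvdnn _)) hy|apply: tor_dvd (dvdn_mull _ (dvdnn _)) hz].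
  rewrite !mulrnDl (tor_mod hy n11) (tor_mod hz n12) (tor_mod hy n21) (tor_mod hz n22).
  by rewrite !mulr1n !mulr0n add0r addr0.
move=> x hx.
have c2 : (n1 + n2 = 1 %[mod m1 * m2])%N.
  apply/eqP; rewrite chinese_remainder //.
  by rewrite -modnDm n11 n21 modnDm eqxx -modnDm n12 n22 modnDm eqxx.
by rewrite -mulrnDr (tor_mod hx c2).
Qed.

Lemma card_tor m1 m2 : coprime m1 m2 -> #|tor (m1 * m2)| = (#|tor m1| * #|tor m2|)%N.
Proof.
move=> co; rewrite -sum1_card (tor_sum_split _ co) /= -sum_nat_const.
by apply: eq_bigr => y _; rewrite sum1_card.
Qed.

Lemma sum_dprod_cycles (V : nmodType) (F : D -> V) (g1 g2 : D) (G : {group D}) :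
  (<[g1]> \x <[g2]>)%g = G ->
  \sum_(x in G) F x = \sum_(i < #[g1]%g) \sum_(j < #[g2]%g) F (g1 *+ i + g2 *+ j).
Proof.
move=> dG; have [_ mG _ tI] := dprodP dG; rewrite pair_big /=.
pose f (ij : 'I_#[g1]%g * 'I_#[g2]%g) := g1 *+ ij.1 + g2 *+ ij.2.
have injf : injective f.
  move=> [i j] [i' j']; rewrite /f /= => e.
  have e1 : g1 *+ i - g1 *+ i' = g2 *+ j' - g2 *+ j.
    by apply/eqP; rewrite subr_eq addrAC -subr_eq opprK e addrC eqxx.
  have h1 : g1 *+ i - g1 *+ i' \in (<[g1]> :&: <[g2]>)%g.
    rewrite inE {2}e1; apply/andP; split.
      by apply: groupM; rewrite ?groupV; apply: mem_cycle.
    by apply: groupM; rewrite ?groupV; apply: mem_cycle.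
  move: (h1); rewrite tI inE => /eqP /eqP; rewrite subr_eq0 => /eqP ei.
  move: h1; rewrite e1 tI inE => /eqP /eqP; rewrite subr_eq0 => /eqP ej.
  congr pair; apply: val_inj => /=.
    have : (g1 ^+ i == g1 ^+ i')%g by apply/eqP.
    by rewrite eq_expg_mod_order !modn_small // => /eqP.
  have : (g2 ^+ j == g2 ^+ j')%g by apply/eqP.
  by rewrite eq_expg_mod_order !modn_small // => /eqP.
have -> : G = f @: setT :> {set D}.
  apply/setP => x; rewrite -mG; apply/mulsgP/imsetP.
    move=> [y z /cycleP[i ->] /cycleP[j ->] ->].
    exists (Ordinal (ltn_pmod i (order_gt0 g1)), Ordinal (ltn_pmod j (order_gt0 g2))) => //.
    by rewrite /f /=; congr (_ + _); apply/esym/expg_mod_order.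
  move=> [[i j] _ ->]; exists (g1 *+ i) (g2 *+ j) => //; exact: mem_cycle.
rewrite big_imset /=; last by move=> a b _ _; apply: injf.
by apply: eq_bigl => ij; rewrite inE.
Qed.

End Torsion.

Section QuadraticForm.
Variables (D : finZmodType) (q : D -> rat) (Dform : discriminant_form q).

Lemma qZ (n : int) g : eqQZ (q (g *~ n)) (n%:~R ^+ 2 * q g).
Proof. by case: Dform. Qed.
Lemma bilDl b1 b2 g : eqQZ (bil q (b1 + b2) g) (bil q b1 g + bil q b2 g).
Proof. by case: Dform. Qed.
Lemma bil_nondeg g : (forall b, eqQZ (bil q b g) 0) -> g = 0.
Proof. by case: Dform => _ _; apply. Qed.

Lemma bilC b g : bil q b g = bil q g b.
Proof. by rewrite /bil (addrC b g); ring. Qed.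
Lemma bilDr b g1 g2 : eqQZ (bil q b (g1 + g2)) (bil q b g1 + bil q b g2).
Proof. by rewrite bilC (bilC b g1) (bilC b g2); apply: bilDl. Qed.
Lemma qD b g : q (b + g) = q b + q g + bil q b g.
Proof. by rewrite /bil; ring. Qed.
Lemma q0 : eqQZ (q 0) 0.
Proof. by have := qZ 0 0; rewrite mulr0z expr0n mul0r. Qed.
Lemma qN g : eqQZ (q (- g)) (q g).
Proof. by have := qZ (-1) g; rewrite mulrN1z rmorphN1 sqrrN expr1n mul1r. Qed.
Lemma bil0l g : eqQZ (bil q 0 g) 0.
Proof.
have := bilDl 0 0 g; rewrite addr0 => /eqQZ_sym.
by rewrite /eqQZ addrK subr0.
Qed.
Lemma bil0r g : eqQZ (bil q g 0) 0.
Proof. by rewrite bilC; apply: bil0l. Qed.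
Lemma bilMnl n b g : eqQZ (bil q (b *+ n) g) (n%:R * bil q b g).
Proof.
elim: n => [|n ih]; first by rewrite mulr0n mul0r; apply: bil0l.
rewrite mulrS -natr1 mulrDl mul1r addrC.
by apply: eqQZ_trans (bilDl _ _ _) _; apply: eqQZD => //; apply: eqQZ_refl.
Qed.
Lemma bilNl b g : eqQZ (bil q (- b) g) (- bil q b g).
Proof.
have h := eqQZ_trans (eqQZ_sym (bilDl (- b) b g)) _.
have := h 0; rewrite addNr => /(_ (bil0l g)).
by rewrite /eqQZ subr0 opprK.
Qed.
Lemma bilNr b g : eqQZ (bil q b (- g)) (- bil q b g).
Proof. by rewrite bilC (bilC b); apply: bilNl. Qed.
Lemma bilMnr n b g : eqQZ (bil q b (g *+ n)) (n%:R * bil q b g).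
Proof. by rewrite bilC (bilC b); apply: bilMnl. Qed.

Lemma bil_tor m b g : b \in tor D m -> eqQZ (m%:R * bil q b g) 0.
Proof.
move=> /torP hb; apply: eqQZ_trans (eqQZ_sym (bilMnl m b g)) _.
by rewrite hb; apply: bil0l.
Qed.
Lemma bil_coprime m1 m2 b g : coprime m1 m2 -> b \in tor D m1 -> g \in tor D m2 ->
  eqQZ (bil q b g) 0.
Proof.
move=> co hb hg; apply: (eqQZ_coprime co); first exact: bil_tor.
by rewrite bilC; apply: bil_tor.
Qed.

Variables (N : nat) (Nlevel : is_level q N).

Lemma level_gt0 : (0 < N)%N. Proof. by case: Nlevel. Qed.
Lemma level_q g : eqQZ (N%:R * q g) 0. Proof. by case: Nlevel => _ h _; apply: h. Qed.
Lemma level_bil b g : eqQZ (N%:R * bil q b g) 0.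
Proof.
rewrite /bil !mulrBr -[0](subr0) -[X in X - 0](subr0) .
by apply: eqQZB (level_q _); apply: eqQZB; apply: level_q.
Qed.
Lemma tor_level : tor D N = setT.
Proof.
apply/setP => x; rewrite !inE; apply/eqP/bil_nondeg => b.
exact: eqQZ_trans (bilMnr _ _ _) (level_bil _ _).
Qed.

(** From q(P x) = 0 one only gets P^2 q(x) = 0. The level also gives P M q(x) = 0, and since P and M
    are coprime the spare factor disappears. *)
Lemma hall_kills (P M : nat) x : N = (P * M)%N -> coprime P M ->
  x \in tor D P -> eqQZ (P%:R * q x) 0.
Proof.
move=> NE co /torP hx; apply: (eqQZ_coprime co).
  rewrite mulrA -expr2; have := qZ P x; rewrite -pmulrn hx => h.
  exact: eqQZ_trans (eqQZ_sym h) q0.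
by rewrite mulrA -natrM mulnC -NE; apply: level_q.
Qed.

Section Hall.
Variables (P M : nat) (NE : N = (P * M)%N) (co : coprime P M).

Lemma hall_gt0 : (0 < P)%N /\ (0 < M)%N.
Proof. by have := level_gt0; rewrite NE muln_gt0 => /andP. Qed.

Lemma hall_decomp (x : D) : exists y z, [/\ y \in tor D P, z \in tor D M & x = y + z].
Proof.
exists (x *+ chinese P M 1 0), (x *+ chinese P M 0 1).
set n1 := chinese _ _ _ _; set n2 := chinese _ _ _ _.
have n11 : (n1 = 1 %[mod P])%N by exact: chinese_modl.
have n12 : (n1 = 0 %[mod M])%N by exact: chinese_modr.
have n21 : (n2 = 0 %[mod P])%N by exact: chinese_modl.
have n22 : (n2 = 1 %[mod M])%N by exact: chinese_modr.
clearbody n1 n2.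
have xN : x \in tor D N by rewrite tor_level inE.
split.
- move: n12 => /eqP; rewrite eqn_mod_dvd // subn0 => /dvdnP[k ->].
  have e : (k * M * P = N * k)%N by rewrite NE mulnC (mulnC k) mulnA.
  by apply/torP; rewrite -mulrnA e mulrnA (torP _ _ xN) mul0rn.
- move: n21 => /eqP; rewrite eqn_mod_dvd // subn0 => /dvdnP[k ->].
  have e : (k * P * M = N * k)%N by rewrite NE -mulnA mulnC.
  by apply/torP; rewrite -mulrnA e mulrnA (torP _ _ xN) mul0rn.
rewrite -mulrnDr -[LHS]mulr1n; apply: tor_mod xN _.
apply/eqP; rewrite NE chinese_remainder //.
by rewrite -[((_ + _) %% P)%N]modnDm n11 n21 modnDm eqxx -[((_ + _) %% M)%N]modnDm n12 n22 modnDm eqxx.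
Qed.

Lemma hall_nondeg x : x \in tor D P -> (forall y, y \in tor D P -> eqQZ (bil q y x) 0) -> x = 0.
Proof.
move=> hx h; apply: bil_nondeg => b; have [y [z [hy hz ->]]] := hall_decomp b.
rewrite -[0]addr0; apply: eqQZ_trans (bilDl _ _ _) _; apply: eqQZD; first exact: h.
by apply: bil_coprime hz hx; rewrite coprime_sym.
Qed.

(** If P/d killed q on the P-torsion, then (P/d) M would kill q on all of [D], against the
    minimality of N. *)
Lemma hall_level d : (1 < d)%N -> (d %| P)%N ->
  exists2 x, x \in tor D P & ~ eqQZ ((P %/ d)%:R * q x) 0.
Proof.
move=> d1 /dvdnP[e Pe]; have [P0 M0] := hall_gt0.
have d0 : (0 < d)%N by lia.
have e0 : (0 < e)%N by move: P0; rewrite Pe muln_gt0 => /andP[].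
have -> : (P %/ d = e)%N by rewrite Pe mulnK.
have [/existsP[x /andP[hx hn]]|] :=
    boolP [exists x in tor D P, ~~ (e%:R * q x \is a Num.int)].
  by exists x => // /eqQZ0; apply/negP.
rewrite negb_exists => /forallP h.
have kill : kills_form q (e * M).
  move=> g; have [y [z [hy hz ->]]] := hall_decomp g.
  have := bil_coprime co hy hz => /(eqQZMn (e * M)%N); rewrite mulr0 qD.
  move: (bil q y z) => B hB; rewrite !mulrDr -[0]addr0 -[X in X + 0]addr0.
  apply: eqQZD; last exact: hB.
  apply: eqQZD.
    have := h y; rewrite negb_and hy /= negbK => /eqQZ0 /(eqQZMn M).
    by rewrite mulr0 mulrA natrM (mulrC e%:R).
  have NE' : N = (M * P)%N by rewrite NE mulnC.
  have co' : coprime M P by rewrite coprime_sym.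
  have := hall_kills NE' co' hz => /(eqQZMn e); rewrite mulr0.
  by rewrite mulrA natrM.
case: Nlevel => N0 _ /(_ (e * M)%N); rewrite muln_gt0 e0 M0 => /(_ isT kill).
rewrite NE Pe => hle; exfalso.
have : (e * M < e * d * M)%N by rewrite ltn_mul2r M0 /= -[X in (X < _)%N]muln1 ltn_mul2l e0.
lia.
Qed.
End Hall.
End QuadraticForm.

(** * The primary components *)

Lemma card_sqrt_modp (p : nat) (c j : int) : prime p -> odd p -> ~~ (p %| c)%Z ->
  ((\sum_(i < p) (c * i%:Z ^+ 2 == j %[mod p])%Z)%N)%:Z = 1 + legendre (c * j) p.
Proof.
move=> pp op pc; have p2 : (2 < p)%N by have := prime_gt1 pp; lia.
have -> : (\sum_(i < p) (c * i%:Z ^+ 2 == j %[mod p])%Z)%N =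
    (\sum_(y : 'F_p) ((c * j)%:~R == y ^+ 2 :> 'F_p))%N.
  rewrite -(big_mkord xpredT (fun i => nat_of_bool (c * i%:Z ^+ 2 == j %[mod p])%Z)).
  rewrite -[X in index_iota 0 X](Fp_cast pp) big_mkord.
  have cn : c%:~R != 0 :> 'F_p by rewrite -(dvdz_pcharf (pchar_Fp pp)).
  (* With y = c i, the equation c i^2 = j becomes y^2 = c j. *)
  rewrite [RHS](reindex_inj (mulfI cn)) /=; apply: eq_bigr => i _; congr nat_of_bool.
  rewrite -(intFp_eq pp) !rmorphM /= -[(i : nat)%:~R]/(i%:R) natr_Zp.
  rewrite -[in LHS](inj_eq (mulfI cn)) eq_sym; congr (_ == _); ring.
have eul (d : int) (y : 'F_p) : y ^+ 2 = d%:~R ->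
    [exists x : 'I_p, ((x : nat)%:Z ^+ 2 == d %[mod p])%Z].
  move=> yd; have yp : (y < p)%N by apply: leq_trans (ltn_ord y) _; rewrite Fp_cast.
  apply/existsP; exists (Ordinal yp); rewrite -(intFp_eq pp) rmorphXn /= -yd.
  by rewrite -pmulrn natr_Zp.
rewrite /legendre (dvdz_pcharf (pchar_Fp pp)); case: eqP => [->|/eqP d0].
  rewrite (bigD1 (0 : 'F_p)) // expr0n eqxx big1 // => y y0.
  by rewrite eq_sym expf_eq0 (negPf y0).
case: existsP => [[x]|nex].
  rewrite -(intFp_eq pp) rmorphXn /= => /eqP xd; set z : 'F_p := (_%:~R) in xd.
  have z0 : z != 0 by apply: contraNneq d0 => z0; rewrite -xd z0 expr0n.
  have zN : - z != z.
    rewrite -subr_eq0 -opprD oppr_eq0 -mulr2n.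
    by rewrite -mulr_natl mulf_eq0 negb_or z0 andbT -(dvdn_pcharf (pchar_Fp pp)) gtnNdvd.
  rewrite (bigD1 z) //= (bigD1 (- z)) //= sqrrN xd eqxx big1 // => y /andP[y1 y2].
  by rewrite -xd eq_sym eqf_sqr (negPf y1) (negPf y2).
rewrite big1 // => y _; case: eqP => // /esym yd.
by case: nex; apply/existsP; apply: eul yd.
Qed.

Section LocalStructure.
Variables (D : finZmodType) (q : D -> rat) (Dform : discriminant_form q).
Variables (N : nat) (Nlevel : is_level q N).

(** The shape is stated with p-cores; everything below works with torsion subgroups, which are
    described by equations. *)
Lemma pcore_tor p : prime p -> 'O_p([set: D])%g = tor D N`_p :> {set D}.
Proof.
move=> pp; have N0 := level_gt0 Nlevel.
have ab : abelian [set: D].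
  by apply/centsP => x _ y _; rewrite /commute; apply: addrC.
have hall := nilpotent_pcore_Hall p (abelian_nil ab).
apply/setP => x; rewrite (mem_normal_Hall hall (pcore_normal _ _)) ?inE // /p_elt.
have ordE n : (x *+ n == 0) = (#[x]%g %| n)%N by rewrite order_dvdn.
have oN : (#[x]%g %| N)%N.
  by rewrite -ordE; apply/eqP/torP; rewrite (tor_level Dform Nlevel) inE.
rewrite ordE; apply/idP/idP => [h|h].
  by rewrite -(part_pnat_id h); apply: partn_dvd.
exact: pnat_dvd h (part_pnat _ _).
Qed.

Lemma mem_dprod_cycles (g1 g2 : D) (G : {group D}) x :
  (<[g1]> \x <[g2]>)%g = G -> x \in G ->
  exists i j, [/\ (i < #[g1]%g)%N, (j < #[g2]%g)%N & x = g1 *+ i + g2 *+ j].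
Proof.
move=> dG; have [_ mG _ tI] := dprodP dG.
rewrite -mG => /mulsgP[y z /cycleP[i ->] /cycleP[j ->] ->].
exists (i %% #[g1]%g)%N, (j %% #[g2]%g)%N; split; rewrite ?ltn_pmod ?order_gt0 //.
by congr (_ + _); apply/esym/expg_mod_order.
Qed.

Lemma q_orthogonal_sum (g1 g2 : D) i j : eqQZ (bil q g1 g2) 0 ->
  eqQZ (q (g1 *+ i + g2 *+ j)) (i%:R ^+ 2 * q g1 + j%:R ^+ 2 * q g2).
Proof.
move=> h; rewrite qD -[X in eqQZ _ X]addr0; apply: eqQZD.
  by apply: eqQZD; have := qZ Dform (_ : nat) (_ : D); [move=> /(_ i g1)|move=> /(_ j g2)];
    rewrite -!pmulrn.
apply: eqQZ_trans (bilMnl Dform _ _ _) _; rewrite -(mulr0 i%:R); apply: eqQZMn.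
apply: eqQZ_trans (bilMnr Dform _ _ _) _; rewrite -(mulr0 j%:R); apply: eqQZMn.
exact: h.
Qed.

Section Prime.
Variables (p : nat) (pN : p \in primes N).

Let P := (N`_p)%N.
Let M := (N %/ P)%N.

Lemma prime_of_mem : prime p. Proof. by move: pN; rewrite mem_primes => /andP[]. Qed.
Let pp := prime_of_mem.

Lemma pfactor_level : N = (P * M)%N.
Proof. by rewrite /M mulnC divnK // dvdn_part. Qed.
Lemma pfactor_level_coprime : coprime P M.
Proof.
have N0 := level_gt0 Nlevel.
have -> : M = (N`_p^')%N.
  by apply/eqP; rewrite -(eqn_pmul2l (part_gt0 p N)) -pfactor_level partnC.
exact: coprime_partC.
Qed.
Lemma dvd_pfactor_level : (p %| P)%N.
Proof.
have N0 := level_gt0 Nlevel.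
rewrite /P p_part -{1}(expn1 p) dvdn_exp2l // logn_gt0 //.
Qed.

Lemma pfactor_gt0 : (0 < P)%N. Proof. exact: part_gt0. Qed.

(** Reads off the exact power of p in the level from the values of q on one component: by
    [hall_level] no proper divisor of P kills them. *)
Lemma pfactor_levelE c : (c %| P)%N -> (forall x, x \in tor D P -> eqQZ (c%:R * q x) 0) -> P = c.
Proof.
move=> cP h; have c0 : (0 < c)%N by rewrite (dvdn_gt0 _ cP) // pfactor_gt0.
have [Pc|Pc] := leqP (P %/ c) 1.
  apply/eqP; rewrite eqn_leq (dvdn_leq pfactor_gt0 cP) andbT.
  by rewrite -(divnK cP) -[X in (_ <= X)%N]mul1n leq_mul2r Pc orbT.
have [] := hall_level Dform Nlevel pfactor_level pfactor_level_coprime Pc.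
  by apply/dvdnP; exists c; rewrite mulnC divnK.
move=> x hx []; have -> : (P %/ (P %/ c))%N = c; last exact: h.
by rewrite -{1}(divnK cP) mulKn // ltnW.
Qed.

(** The cofactor M appears because q is scaled by the whole of N and not by P. This is the origin of
    the factor N/p in the signs epsilon_p. *)
Lemma count_cond x (n j : int) : eqQZ (q x) (n%:~R / P%:R) ->
  ((N%:R * q x - j%:~R) / P%:R \is a Num.int) = (M%:Z * n == j %[mod P])%Z.
Proof.
move=> h; have P0 := pfactor_gt0; have Pn : (P%:R : rat) != 0 by rewrite pnatr_eq0; lia.
rewrite eqz_mod_dvd -divz_int //; apply: eqQZ_int.
have -> : (N%:R * q x - j%:~R) / P%:R = M%:R * q x - j%:~R / P%:R.
  by rewrite pfactor_level natrM; field.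
have -> : (M%:Z * n - j)%:~R / P%:R = M%:R * (n%:~R / P%:R) - j%:~R / P%:R :> rat.
  by rewrite rmorphB rmorphM /=; field.
by apply: eqQZB (eqQZ_refl _); apply: eqQZMn.
Qed.

Lemma card_count (C : pred D) (g1 g2 : D) (G : {group D}) :
  (<[g1]> \x <[g2]>)%g = G -> G = tor D P :> {set D} ->
  #|[set x in tor D P | C x]| =
  (\sum_(i < #[g1]%g) \sum_(j < #[g2]%g) C (g1 *+ i + g2 *+ j)%R)%N.
Proof.
move=> dG GE; rewrite -(sum_dprod_cycles (fun x => nat_of_bool (C x)) dG) GE.
rewrite -sum1dep_card big_mkcondr; apply: eq_bigr => x _; by case: (C x).
Qed.

(** Multiplication by an m that is -1 modulo P and 1 modulo M. Since m^2 = 1 modulo N, it is an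
    involution and preserves q. *)
Lemma neg_automorphism : exists s : {perm D}, [/\ form_automorphism q s,
  forall x, x \in tor D P -> s x = - x & forall z, z \in tor D M -> s z = z].
Proof.
have P0 := pfactor_gt0; have co := pfactor_level_coprime.
set m := chinese P M P.-1 1.
have mP : (m = P.-1 %[mod P])%N by exact: chinese_modl.
have mM : (m = 1 %[mod M])%N by exact: chinese_modr.
clearbody m.
have m2 : (m * m = 1 %[mod N])%N.
  apply/eqP; rewrite pfactor_level chinese_remainder //; apply/andP; split.
    rewrite -modnMm mP modnMm; case: (P) P0 => // k _ /=.
    case: k => [|k]; first by rewrite !modn1.
    have -> : (k.+1 * k.+1 = k * k.+2 + 1)%N by lia.
    by rewrite modnMDl.
  by rewrite -modnMm mM modnMm.
have xN x : x \in tor D N by rewrite (tor_level Dform Nlevel) inE.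
have inv (x : D) : (x *+ m) *+ m = x by rewrite -mulrnA (tor_mod (xN x) m2).
have inj : injective (fun x : D => x *+ m) by move=> x y /(congr1 (fun z => z *+ m)); rewrite !inv.
exists (perm inj); split.
- split=> [x y|x]; rewrite !permE ?mulrnDl //.
  have := qZ Dform m x; rewrite -pmulrn => h; apply: eqQZ_trans h _.
  have /dvdzP[k hk] : (N %| m%:Z * m%:Z - 1)%Z.
    by rewrite -eqz_mod_dvd -PoszM !modz_nat m2.
  rewrite /eqQZ -[X in _ - X]mul1r -mulrBl.
  have -> : (m%:Z%:~R ^+ 2 - 1 : rat) = k%:~R * N%:R.
    by rewrite pmulrn -rmorphM -hk rmorphB rmorphM /= expr2.
  rewrite -mulrA rpredM ?intr_int //; apply/eqQZ0; exact: (level_q Nlevel).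
- move=> x hx; rewrite permE (tor_mod hx mP); apply/eqP.
  by rewrite -subr_eq0 opprK -mulrSr prednK //; apply/eqP/torP.
- by move=> x hx; rewrite permE (tor_mod hx mM).
Qed.
End Prime.
End LocalStructure.

(** All that is used later about one primary component. [local_count] explains the sign vector: N q
    takes the values j with chi(j) = [eps] twice modulo N_p, those with chi(j) = 0 once, the others
    never. In [local_transitive] the automorphism fixes the complementary torsion, so that
    automorphisms found at different primes can be composed. *)
Record local_structure (D : finZmodType) (q : D -> rat) (N p : nat)
    (chi : int -> int) (eps : int) : Prop := LocalStructure {
  local_card : #|tor D N`_p| = (N`_p)%N;
  local_char : quadratic_char p N`_p chi;
  local_sign : eps = 1 \/ eps = -1;
  local_count : forall j : int,
    (#|[set x in tor D N`_p | (N%:R * q x - j%:~R) / (N`_p)%N%:R \is a Num.int]|)%:Z =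
    1 + eps * chi j;
  local_transitive : forall x y, x \in tor D N`_p -> y \in tor D N`_p ->
    eqQZ (q x) (q y) -> exists s : {perm D},
      [/\ form_automorphism q s, s x = y & forall z, z \in tor D (N %/ N`_p) -> s z = z] }.

Lemma eqQZ_div (m n : int) (P : nat) : (0 < P)%N ->
  eqQZ (m%:~R / P%:R) (n%:~R / P%:R) -> (m = n %[mod P])%Z.
Proof.
by move=> P0; rewrite /eqQZ -mulrBl -rmorphB divz_int // -eqz_mod_dvd => /eqP.
Qed.

Section Local.
Variables (D : finZmodType) (q : D -> rat) (Dform : discriminant_form q).
Variables (N : nat) (Nlevel : is_level q N).
Variables (delta : nat -> int) (d2 : two_part).
Variables (p : nat) (pN : p \in primes N).
Let P := (N`_p)%N.
Let M := (N %/ P)%N.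
Let pp := prime_of_mem pN.

Lemma id_automorphism x : exists s : {perm D},
  [/\ form_automorphism q s, s x = x & forall z, z \in tor D M -> s z = z].
Proof.
exists 1%g; split=> [|| z _]; rewrite ?perm1 //.
by split=> *; rewrite !perm1 //; apply: eqQZ_refl.
Qed.

Lemma opp_automorphism x : x \in tor D P -> exists s : {perm D},
  [/\ form_automorphism q s, s x = - x & forall z, z \in tor D M -> s z = z].
Proof.
move=> hx; have [s [h1 h2 h3]] := neg_automorphism Dform Nlevel pN.
by exists s; split=> //; apply: h2.
Qed.

Lemma pcore_nontrivial : 'O_p([set: D])%g = 1%g -> False.
Proof.
move=> O1; have := pcore_tor Dform Nlevel pp; rewrite O1 => tE.
have [] := hall_level Dform Nlevel (pfactor_level N p) (pfactor_level_coprime Nlevel p)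
  (prime_gt1 pp) (dvd_pfactor_level Nlevel pN).
move=> x; rewrite -tE => /set1P -> []; rewrite -[0](mulr0 (N`_p %/ p)%N%:R).
by apply: eqQZMn; apply: (q0 Dform).
Qed.

Lemma odd_local : odd p -> odd_part q p (delta p) ->
  local_structure q N p (chi_at d2 p) (epsilon_at N delta d2 p).
Proof.
move=> op [/pcore_nontrivial //|[g [a [og gO qg dE]]]].
have tE := pcore_tor Dform Nlevel pp.
(* The cyclic component is written as a product with a trivial second factor, to share the lemmas on
   two generators. *)
have dG : (<[g]> \x <[0 : D]>)%g = 'O_p([set: D])%g.
  by rewrite gO -[0]/(1%g : D) cycle1 dprodg1.
have o0 : #[0 : D]%g = 1%N by rewrite -[0]/(1%g : D) order1.
have bg0 : eqQZ (bil q g 0) 0 by exact: bil0r.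
have qE i : eqQZ (q (g *+ i)) ((i%:Z ^+ 2 * a)%:~R / p%:R).
  have := q_orthogonal_sum Dform i 0 bg0; rewrite mulr0n addr0 expr0n mul0r addr0 => h.
  apply: eqQZ_trans h _; have := eqQZZ (i%:Z ^+ 2) qg.
  by rewrite rmorphXn /= mulrA rmorphM rmorphXn.
have elt x : x \in tor D P -> exists2 i, (i < p)%N & x = g *+ i.
  rewrite -tE => hx; have [i [j [ip j0 ->]]] := mem_dprod_cycles dG hx.
  by exists i; rewrite -?og // mul0rn addr0.
have p0 : (0 < p)%N by exact: prime_gt0.
have Pp : P = p.
  apply: (pfactor_levelE Dform Nlevel (dvd_pfactor_level Nlevel pN)) => x /elt[i _ ->].
  apply: eqQZ_trans (eqQZMn p (qE i)) _; apply/eqQZ0.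
  by rewrite mulrC divfK ?pnatr_eq0 -?lt0n // intr_int.
have MM : N = (p * M)%N by rewrite -{1}Pp; apply: pfactor_level.
have coM : ~~ (p %| M)%N.
  have := pfactor_level_coprime Nlevel p; rewrite -/P -/M Pp prime_coprime //.
(* Otherwise q would vanish on the component, which [hall_level] excludes. *)
have pa : ~~ (p %| a)%Z.
  apply/negP => pa.
  have [] := hall_level Dform Nlevel (pfactor_level N p) (pfactor_level_coprime Nlevel p)
    (prime_gt1 pp) (dvd_pfactor_level Nlevel pN).
  move=> x /elt[i _ ->] []; rewrite -/P Pp divnn p0 mul1r.
  by apply: eqQZ_trans (qE i) _; apply/eqQZ0; rewrite divz_int // dvdz_mull.
have chiE n : chi_at d2 p n = legendre n p.
  by rewrite /chi_at; case: eqP => [p2|_]; [rewrite p2 in op|rewrite kronecker_odd_prime].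
have pMa : ~~ (p %| (M%:Z * a))%Z.
  by rewrite dvdzE abszM Euclid_dvdM // negb_or; apply/andP.
have leg4 : legendre (2 * 2) p = 1.
  have : legendre 2 p != 0.
    rewrite legendre_eq0 // dvdzE /= -prime_coprime // coprime_sym prime_coprime // dvdn2.
    by rewrite op.
  rewrite (legendreM pp op); have := qchar_range (legendre_char pp op) 2.
  by rewrite kronecker_odd_prime // => -[] ->.
(* The two factors 2, one from chi_p(2N/p) and one from delta_p, combine to the square 4. *)
have epsE : epsilon_at N delta d2 p = legendre (M%:Z * a) p.
  rewrite /epsilon_at; case: eqP => [p2|_]; first by rewrite p2 in op.
  rewrite chiE dE kronecker_odd_prime // -(legendreM pp op).
  have -> : (2 * N %/ p = 2 * M)%N by rewrite MM mulnCA mulKn.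
  have -> : (2 * M)%N%:Z * (2 * a) = 2 * 2 * (M%:Z * a) by rewrite PoszM; ring.
  by rewrite (legendreM pp op) leg4 mul1r.
split.
- by rewrite -tE -gO -[RHS]/P Pp -og.
- rewrite -/P Pp; have [h1 h2 h3 h4 [t h5]] := legendre_char pp op; split=> *; rewrite ?chiE.
  + exact: legendre_mod.
  + exact: legendreM.
  + exact: legendre_eq0.
  + by rewrite -(kronecker_odd_prime _ pp op); apply: h4.
  + by exists t; rewrite chiE -(kronecker_odd_prime _ pp op).
- rewrite epsE; have := qchar_range (legendre_char pp op) (M%:Z * a).
  rewrite kronecker_odd_prime // => -[] h; [|by left|by right].
  by move: pMa; rewrite -legendre_eq0 h.
- move=> j; rewrite (@card_count D N p _ _ _ _ dG tE) epsE chiE -(legendreM pp op).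
  rewrite -card_sqrt_modp // og o0; congr Posz; apply: eq_bigr => i _.
  rewrite big_ord_recl big_ord0 addn0 mul0rn addr0; congr nat_of_bool.
  have qE' : eqQZ (q (g *+ i)) ((i%:Z ^+ 2 * a)%:~R / P%:R) by rewrite Pp; apply: qE.
  by rewrite (count_cond pN j qE') -/P -/M Pp mulrCA mulrC.
- move=> x y hx hy; have [i ip xi] := elt x hx; have [j jp yj] := elt y hy.
  rewrite xi yj => h.
  have /(eqQZ_div p0)/eqP : eqQZ ((i%:Z ^+ 2 * a)%:~R / p%:R) ((j%:Z ^+ 2 * a)%:~R / p%:R).
    exact: eqQZ_trans (eqQZ_sym (qE i)) (eqQZ_trans h (qE j)).
  (* As p does not divide a, equal values of a i^2 force i = j or i = -j modulo p. *)
  rewrite eqz_mod_dvd -mulrBl subr_sqr !dvdzE !abszM !Euclid_dvdM // -!dvdzE (negPf pa) orbF.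
  rewrite -xi -yj; case/orP => hd.
    suff -> : y = x by exact: id_automorphism.
    rewrite xi yj; congr (_ *+ _).
    by move: hd; rewrite -eqz_mod_dvd !modz_nat !modn_small // => /eqP[->].
  suff -> : y = - x by exact: opp_automorphism.
  apply/eqP; rewrite -addr_eq0 xi yj -mulrnDr addnC.
  move: hd; rewrite -PoszD dvdzE /= => /dvdnP[k ->].
  have ogg : g *+ #[g]%g = 0 := expg_order g.
  by rewrite mulnC mulrnA -og ogg mul0rn.
Qed.
End Local.

Lemma kroneckerN1_small : [/\ kronecker (-1) 1 = 1, kronecker (-1) (-1) = -1,
  kronecker (-1) 3 = -1 & kronecker (-1) (-3) = 1].
Proof.
have h3 : kronecker (-1) 3 = -1 by rewrite (@kronecker_odd_prime _ 3) // legendreN1.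
split=> //; first by rewrite /kronecker /= big_nil.
  by rewrite /kronecker /= big_nil.
by move: h3; rewrite /kronecker /= mul1r => ->.
Qed.

Section TwoPart.
Variables (D : finZmodType) (q : D -> rat) (Dform : discriminant_form q).
Variables (N : nat) (Nlevel : is_level q N) (N2 : 2%N \in primes N).
Let P := (N`_2)%N.
Let M := (N %/ P)%N.

Section Generators.
Variables (g1 g2 : D) (e : nat) (a1 a2 : int).
Hypotheses (o1 : #[g1]%g = 2%N) (o2 : #[g2]%g = (2 ^ e)%N).
Hypothesis (dG : (<[g1]> \x <[g2]>)%g = 'O_2([set: D])%g).
Hypothesis (b12 : eqQZ (bil q g1 g2) 0).
Hypothesis (q1 : eqQZ (q g1) (a1%:~R / (2 ^ e.+1)%N%:R)).
Hypothesis (q2 : eqQZ (q g2) (a2%:~R / (2 ^ e.+1)%N%:R)).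
Hypothesis (oa2 : ~~ (2 %| a2)%Z).

(** Both nontrivial 2-parts fit this pattern: e = 1 and a1 = a2 = t/2 for 2_t^{+2}; e = 2, a1 = 2 t1
    and a2 = t2 for the sum of orders 2 and 4. In both cases 2^(e+1) is at once the order of the
    component and its level. *)
Lemma twoQ i j : eqQZ (q (g1 *+ i + g2 *+ j))
  ((i%:Z ^+ 2 * a1 + j%:Z ^+ 2 * a2)%:~R / (2 ^ e.+1)%N%:R).
Proof.
apply: eqQZ_trans (q_orthogonal_sum Dform _ _ b12) _.
have := eqQZD (eqQZZ (i%:Z ^+ 2) q1) (eqQZZ (j%:Z ^+ 2) q2).
have -> : (i%:Z ^+ 2 * a1 + j%:Z ^+ 2 * a2)%:~R / (2 ^ e.+1)%N%:R =
    (i%:Z ^+ 2)%:~R * (a1%:~R / (2 ^ e.+1)%N%:R) + (j%:Z ^+ 2)%:~R * (a2%:~R / (2 ^ e.+1)%N%:R) :> rat.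
  by rewrite !mulrA -mulrDl; ring.
by rewrite !rmorphXn.
Qed.

Lemma two_tor : 'O_2([set: D])%g = tor D P :> {set D}.
Proof. exact: (pcore_tor Dform Nlevel (prime_of_mem N2)). Qed.

Lemma two_elt x : x \in tor D P ->
  exists i j, [/\ (i < 2)%N, (j < 2 ^ e)%N & x = g1 *+ i + g2 *+ j].
Proof.
rewrite -two_tor => /(mem_dprod_cycles dG)[i [j [h1 h2 h3]]].
by exists i, j; rewrite -o2 -[X in (_ < X)%N]o1.
Qed.

(** The power cannot be smaller because a2 is odd: q(g2) alone has denominator 2^(e+1). *)
Lemma two_partE : P = (2 ^ e.+1)%N.
Proof.
have c0 : (0 < 2 ^ e.+1)%N by rewrite expn_gt0.
apply: (pfactor_levelE Dform Nlevel) => [|x /two_elt[i [j [_ _ ->]]]]; last first.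
  apply: eqQZ_trans (eqQZMn _ (twoQ i j)) _; apply/eqQZ0.
  by rewrite mulrC divfK ?pnatr_eq0 -?lt0n // intr_int.
have : eqQZ (N%:R * (a2%:~R / (2 ^ e.+1)%N%:R)) 0.
  by apply: eqQZ_trans (eqQZ_sym (eqQZMn N q2)) _; apply: level_q.
move=> /eqQZ0; rewrite mulrA -[N%:R]/(N%:Z%:~R) -rmorphM divz_int // dvdzE abszM /=.
rewrite Gauss_dvdl; last by rewrite coprime_pexpl // coprime2n; move: oa2; rewrite dvdzE /=; lia.
by rewrite p_part pfactor_dvdn ?(level_gt0 Nlevel) //; apply: dvdn_exp2l.
Qed.

Lemma two_cofactor_odd : odd M.
Proof.
by have := pfactor_level_coprime Nlevel 2; rewrite -/P -/M two_partE coprime_pexpl ?coprime2n.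
Qed.

Lemma two_card : #|tor D P| = P.
Proof.
have := sum_dprod_cycles (fun=> 1%N) dG; rewrite !sum_nat_const !muln1 !card_ord -two_tor => ->.
by rewrite o1 o2 two_partE expnS.
Qed.

Lemma two_count (j : int) :
  #|[set x in tor D P | (N%:R * q x - j%:~R) / P%:R \is a Num.int]| =
  (\sum_(i < 2) \sum_(k < 2 ^ e)
    (M%:Z * (i%:Z ^+ 2 * a1 + k%:Z ^+ 2 * a2) == j %[mod (2 ^ e.+1)%N])%Z)%N.
Proof.
rewrite (@card_count D N 2 _ _ _ _ dG two_tor) o1 o2.
apply: eq_bigr => i _; apply: eq_bigr => k _; congr nat_of_bool.
have h := twoQ i k; rewrite -[X in X%:R]two_partE in h.
by rewrite (count_cond N2 j h) -/P -/M two_partE.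
Qed.

Lemma two_q_inj i j i' j' : eqQZ (q (g1 *+ i + g2 *+ j)) (q (g1 *+ i' + g2 *+ j')) ->
  (i%:Z ^+ 2 * a1 + j%:Z ^+ 2 * a2 == i'%:Z ^+ 2 * a1 + j'%:Z ^+ 2 * a2 %[mod (2 ^ e.+1)%N])%Z.
Proof.
move=> h; apply/eqP/eqQZ_div; first by rewrite expn_gt0.
exact: eqQZ_trans (eqQZ_sym (twoQ i j)) (eqQZ_trans h (twoQ i' j')).
Qed.
End Generators.

(* The reflection in a 2-torsion element [c] with [q c = 1/2]. *)
Lemma reflection (c : D) : c \in tor D 2 -> eqQZ (q c) (1 / 2) ->
  exists s : {perm D}, [/\ form_automorphism q s,
    forall x, ~ eqQZ (bil q x c) 0 -> s x = x + c & forall z, z \in tor D M -> s z = z].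
Proof.
move=> hc qc.
have cc : c + c = 0 by have /torP := hc; rewrite mulr2n.
pose f x := if bil q x c \is a Num.int then x else x + c.
have b2 x : eqQZ (2%:R * bil q x c) 0 by rewrite bilC; apply: bil_tor.
have bD x y : (bil q (x + y) c \is a Num.int) = (bil q x c + bil q y c \is a Num.int).
  exact/eqQZ_int/(bilDl Dform).
have halfE x : bil q x c \isn't a Num.int -> eqQZ (bil q x c) (1 / 2).
  move=> hx; have /eqQZ0/intrP[m hm] := b2 x.
  have e : bil q x c = m%:~R / 2 by rewrite -hm; field.
  have [k mk] : exists k, m = 2 * k \/ m = 2 * k + 1 by exists (m %/ 2)%Z; lia.
  case: mk => mk; rewrite mk in e.
    move: hx; rewrite e rmorphM /=.
    have -> : 2%:~R * k%:~R / 2 = k%:~R :> rat by field.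
    by rewrite intr_int.
  rewrite e /eqQZ rmorphD rmorphM /=.
  have -> : (2%:~R * k%:~R + 1) / 2 - 1 / 2 = k%:~R :> rat by field.
  exact: intr_int.
(* (c, c) = q(0) - 2 q(c) is integral, so adding c does not change (x, c) modulo 1; hence [f] is an
   involution. *)
have bcc : bil q c c \is a Num.int.
  rewrite /bil cc; have -> : q 0 - q c - q c = (q 0 - 0) - 2%:R * (q c - 1 / 2) - 1 by field.
  have h0 : q 0 - 0 \is a Num.int by exact: (q0 Dform).
  by rewrite rpredB ?rpred1 // rpredB // rpredM // natr_int.
have fK x : f (f x) = x.
  have [h|h] := boolP (bil q x c \is a Num.int); first by rewrite /f h h.
  rewrite /f (negPf h) bD ifF; first by rewrite -addrA cc addr0.
  by apply/negP => h'; move/negP: h; apply; rewrite -[bil q x c](addrK (bil q c c)) rpredB.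
have inj := can_inj fK.
exists (perm inj); split.
- split=> [x y|x]; rewrite !permE /f.
    rewrite bD; have [hx|hx] := boolP (bil q x c \is a Num.int);
      have [hy|hy] := boolP (bil q y c \is a Num.int).
    + by rewrite rpredD.
    + have -> : (bil q x c + bil q y c \is a Num.int) = false.
        by apply/negP => h; move: hy; rewrite -[bil q y c](addKr (bil q x c)) rpredD ?rpredN.
      by rewrite addrA.
    + have -> : (bil q x c + bil q y c \is a Num.int) = false.
        by apply/negP => h; move: hx; rewrite -[bil q x c](addrK (bil q y c)) rpredB.
      by rewrite addrAC.
    + have := eqQZD (halfE _ hx) (halfE _ hy).
      have -> : 1 / 2 + 1 / 2 = 1 :> rat by field.
      move=> /eqQZ_int ->; rewrite rpred1.
      by rewrite addrACA cc addr0.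
  case: ifP => [_|/negbT /halfE h]; first exact: eqQZ_refl.
  rewrite qD; have := eqQZD (eqQZD (eqQZ_refl (q x)) qc) h.
  have -> : q x + 1 / 2 + 1 / 2 = q x + 1 by field.
  move=> h1; apply: eqQZ_trans h1 _; by rewrite /eqQZ addrC addKr rpred1.
- move=> x hx; rewrite permE /f; case: ifP => // h; case: hx.
  exact/eqQZ0.
- move=> z hz; rewrite permE /f; case: ifP => // /negP[]; apply/eqQZ0.
  apply: (bil_coprime Dform _ hz hc); rewrite coprime_sym.
  apply: coprime_dvdl (pfactor_level_coprime Nlevel 2).
  exact: (dvd_pfactor_level Nlevel N2).
Qed.

Variables (delta : nat -> int).

Lemma two_two_local t : even_part q (TwoTwo t) ->
  local_structure q N 2 (chi_at (TwoTwo t) 2) (epsilon_at N delta (TwoTwo t) 2).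
Proof.
move=> [ht [g1 [g2 [[o1 o2] dG b12 q1' q2']]]].
pose u : int := if t == 2 then 1 else -1.
have tu : t = 2 * u by rewrite /u; case: ht => ->.
have hu : u = 1 \/ u = -1 by rewrite /u; case: eqP; [left|right].
have qe : t%:~R / 2 / 4 = u%:~R / (2 ^ 2)%N%:R :> rat.
  by rewrite tu rmorphM /=; field.
rewrite qe in q1' q2'; clearbody u.
have o2' : #[g2]%g = (2 ^ 1)%N := o2.
have oa : ~~ (2 %| u)%Z by case: hu => ->.
have PE : P = 4%N := two_partE o1 o2' dG b12 q1' q2' oa.
have oM : odd M := two_cofactor_odd o1 o2' dG b12 q1' q2' oa.
have chiE n : chi_at (TwoTwo t) 2 n = chi_m4 n by rewrite /chi_at /= kronecker_m4.
have epsE : epsilon_at N delta (TwoTwo t) 2 = chi_m4 (M%:Z * u).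
  rewrite /epsilon_at /= kronecker_m4; congr chi_m4.
  have -> : N%:Z * t = M%:Z * u * 8.
    by rewrite tu {1}(pfactor_level N 2) -/P -/M PE PoszM; ring.
  by rewrite mulzK.
split.
- exact: (two_card o1 o2' dG b12 q1' q2' oa).
- rewrite -/P PE; have [h1 h2 h3 h4 [s h5]] := chi_m4_char.
  by split=> *; [apply: h1|apply: h2|apply: h3|apply: h4|exists s].
- rewrite epsE /chi_m4; case: hu => ->; case: ifP => [|h]; try by left.
    by case: ifP; [right|lia].
  by case: ifP; [right|lia].
- move=> j; rewrite (two_count o1 o2' dG b12 q1' q2' oa) epsE chiE.
  have [m m4 mE] := @modz_lt M 4 isT; have [k k4 kE] := @modz_lt j 4 isT.
  have -> : chi_m4 (M%:Z * u) = chi_m4 (m%:Z * u).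
    by apply: chi_m4_mod; rewrite -modzMml mE modzMml.
  rewrite (chi_m4_mod kE) !big_ord_recl !big_ord0 /= /bump /=.
  rewrite kE -![((M%:Z * _) %% _)%Z]modzMml mE ![((_ %% _)%Z * _ %% _)%Z]modzMml.
  have {}oM : odd m by lia.
  clear mE kE tu qe q1' q2' oa epsE.
  by case: hu => ->; move: m m4 oM k k4; do 4?[case=> //]; move=> _ _; do 4?[case=> //].
move=> x y hx hy h.
have [i [j [i2 j2 xE]]] := two_elt o1 o2' dG hx.
have [i' [j' [i2' j2' yE]]] := two_elt o1 o2' dG hy.
have := h; rewrite {1}xE {1}yE => /(two_q_inj b12 q1' q2').
have tor2 (g : D) : #[g]%g = 2%N -> g + g = 0.
  by move=> og; have := expg_order g; rewrite og => hg; rewrite -mulr2n; exact: hg.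
have key : (i, j) = (i', j') \/ (i, j) = (1%N, 0%N) /\ (i', j') = (0%N, 1%N)
    \/ (i, j) = (0%N, 1%N) /\ (i', j') = (1%N, 0%N) ->
    exists s : {perm D}, [/\ form_automorphism q s, s x = y &
      forall z, z \in tor D M -> s z = z].
  (* The values u (i^2 + j^2) modulo 4 separate all elements except g1 and g2. These are exchanged
     by the reflection in g1 + g2, whose q-value is u/2 = 1/2 modulo 1. *)
  have [||s [s1 s2 s3]] := @reflection (g1 + g2).
  - by apply/torP; rewrite mulr2n addrACA (tor2 g1) // (tor2 g2) // addr0.
  - rewrite qD -[1 / 2]addr0; apply: eqQZD b12.
    apply: eqQZ_trans (eqQZD q1' q2') _.
    rewrite /eqQZ; have -> : u%:~R / (2 ^ 2)%N%:R + u%:~R / (2 ^ 2)%N%:R - 1 / 2 =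
      (u - 1)%:~R / 2%:R :> rat by rewrite rmorphB /=; field.
    by rewrite divz_int //; case: hu => ->.
  have nb (g g' : D) : #[g]%g = 2%N -> eqQZ (q g) (u%:~R / (2 ^ 2)%N%:R) ->
      eqQZ (bil q g g') 0 -> ~ eqQZ (bil q g (g + g')) 0.
    move=> og qg bg hb.
    have h1 : eqQZ (bil q g g) 0.
      apply: eqQZ_trans (eqQZ_sym _) hb; apply: eqQZ_trans (bilDr Dform _ _ _) _.
      by rewrite -[X in eqQZ _ X]addr0; apply: eqQZD bg; apply: eqQZ_refl.
    move: h1; rewrite /bil tor2 // => h1.
    have h2 := eqQZB (eqQZB (q0 Dform) qg) qg.
    have := eqQZ_trans (eqQZ_sym h2) h1.
    have -> : 0 - u%:~R / (2 ^ 2)%N%:R - u%:~R / (2 ^ 2)%N%:R = (- u)%:~R / 2%:R :> rat.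
      by rewrite rmorphN /=; field.
    by move=> /eqQZ0; rewrite divz_int //; case: hu => ->.
  case=> [[ei ej]|[[[ei ej] [ei' ej']]|[[ei ej] [ei' ej']]]].
  - by rewrite xE yE ei ej; apply: id_automorphism.
  - exists s; split=> //; rewrite xE yE ei ej ei' ej' !mulr1n !mulr0n addr0 add0r.
    rewrite (s2 g1 (nb g1 g2 o1 q1' b12)).
    by rewrite addrA (tor2 g1) // add0r.
  - exists s; split=> //; rewrite xE yE ei ej ei' ej' !mulr1n !mulr0n addr0 add0r.
    have := nb g2 g1 o2 q2'; rewrite (bilC q g2 g1) (addrC g2 g1) => /(_ b12) /s2 ->.
    by rewrite addrCA (tor2 g2) // addr0.
move=> hh; apply: key; move: hh.
have : (i = 0 \/ i = 1)%N by clear -i2; lia.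
have : (i' = 0 \/ i' = 1)%N by clear -i2'; lia.
have : (j = 0 \/ j = 1)%N by clear -j2; lia.
have : (j' = 0 \/ j' = 1)%N by clear -j2'; lia.
clear -hu; by case: hu => ->; do 4![case=> ->]; move=> // _; auto.
Qed.

Lemma two_four_local t1 t2 : even_part q (TwoFour t1 t2) ->
  local_structure q N 2 (chi_at (TwoFour t1 t2) 2) (epsilon_at N delta (TwoFour t1 t2) 2).
Proof.
move=> [ht1 [ht2 [g1 [g2 [[o1 o2] dG b12 q1' q2']]]]].
have qe : t1%:~R / 4 = (2 * t1)%:~R / (2 ^ 3)%N%:R :> rat.
  by rewrite rmorphM /=; field.
rewrite qe in q1'.
have o2' : #[g2]%g = (2 ^ 2)%N := o2.
have oa : ~~ (2 %| t2)%Z by case: ht2 => ->.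
have PE : P = 8%N := two_partE o1 o2' dG b12 q1' q2' oa.
have oM : odd M := two_cofactor_odd o1 o2' dG b12 q1' q2' oa.
(* chi_2 is the symbol of -2a with a = (-1/(t1 t2)), that is of 2s with s = -a. *)
pose s := - kronecker (-1) (t1 * t2).
have sE : s = if (t1 * t2 == 1) || (t1 * t2 == -3) then -1 else 1.
  have [k1 k2 k3 k4] := kroneckerN1_small.
  rewrite /s; case: ht1 => ->; case: ht2 => ->;
    by rewrite ?(mul1r, mulN1r, opprK) ?(k1, k2, k3, k4).
have hs : s = 1 \/ s = -1 by rewrite sE; case: ifP; [right|left].
have chi2E n : chi2 (TwoFour t1 t2) n = chi_8 s n.
  rewrite /= -kronecker_8 //; congr kronecker; rewrite /s; ring.
have epsE : epsilon_at N delta (TwoFour t1 t2) 2 = chi_8 s (M%:Z * t2).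
  rewrite /epsilon_at -chi2E; congr (chi2 _).
  have -> : t2 * N%:Z = M%:Z * t2 * 8.
    by rewrite {1}(pfactor_level N 2) -/P -/M PE PoszM; ring.
  by rewrite mulzK.
split.
- exact: (two_card o1 o2' dG b12 q1' q2' oa).
- rewrite -/P PE; have [h1 h2 h3 h4 [w h5]] := chi_8_char hs.
  have e n : kronecker (2 * s) n = chi_at (TwoFour t1 t2) 2 n.
    by rewrite kronecker_8 // -chi2E.
  by split=> *; rewrite -?e; [apply: h1|apply: h2|apply: h3|apply: h4|exists w; rewrite -e].
- have h := qchar_range (chi_8_char hs) (M%:Z * t2).
  rewrite epsE -kronecker_8 //; case: h => h; [|by left|by right].
  move/eqP: h; rewrite (qchar_eq0 (chi_8_char hs)) => h; exfalso.
  by move: h; rewrite dvdzE abszM Euclid_dvdM // -!dvdzE (negPf oa) orbF dvdzE /= dvdn2 oM.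
- move=> j; rewrite (two_count o1 o2' dG b12 q1' q2' oa) epsE /chi_at eqxx chi2E.
  have [m m4 mE] := @modz_lt M 8 isT; have [k k4 kE] := @modz_lt j 8 isT.
  have -> : chi_8 s (M%:Z * t2) = chi_8 s (m%:Z * t2).
    by apply: chi_8_mod; rewrite -modzMml mE modzMml.
  rewrite (chi_8_mod _ kE) !big_ord_recl !big_ord0 /= /bump /=.
  rewrite kE -![((M%:Z * _) %% _)%Z]modzMml mE ![((_ %% _)%Z * _ %% _)%Z]modzMml.
  have {}oM : odd m by lia.
  rewrite sE; clear mE kE qe q1' q2' oa epsE s hs chi2E sE.
  by case: ht1 => ->; case: ht2 => ->; move: m m4 oM k k4; do 8?[case=> //]; move=> _ _; do 8?[case=> //].
move=> x y hx hy h.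
have [i [j [i2 j2 xE]]] := two_elt o1 o2' dG hx.
have [i' [j' [i2' j2' yE]]] := two_elt o1 o2' dG hy.
have := h; rewrite {1}xE {1}yE => /(two_q_inj b12 q1' q2') hh.
(* The value 2 t1 i^2 + t2 j^2 modulo 8 determines i modulo 2 and j modulo 4 up to sign. As 2 g1 =
   0, negation then carries one element to the other. *)
have [ei [ej|ej]] : i = i' /\ (j = j' \/ (j + j' = 4)%N).
- clear -hh i2 i2' j2 j2' ht1 ht2.
  have {}j2 : (j < 4)%N by []. have {}j2' : (j' < 4)%N by [].
  move: i i2 i' i2' j j2 j' j2' hh.
  case: ht1 => ->; case: ht2 => ->;
  by do 2?[case=> //]; move=> _; do 2?[case=> //]; move=> _;
     do 4?[case=> //]; move=> _; do 4?[case=> //]; move=> *; auto.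
- by rewrite xE yE ei ej; apply: id_automorphism.
have -> : y = - x; last exact: (opp_automorphism Dform Nlevel N2).
apply/eqP; rewrite -addr_eq0 xE yE ei addrACA -!mulrnDr (addnC j') ej addnn.
have h1 : g1 *+ #[g1]%g = 0 := expg_order g1.
have h2 : g2 *+ #[g2]%g = 0 := expg_order g2.
by rewrite -muln2 mulnC mulrnA -{1}o1 h1 mul0rn add0r -o2 h2.
Qed.

Lemma two_trivial_local : even_part q TwoTrivial -> False.
Proof. exact: (pcore_nontrivial Dform Nlevel N2). Qed.
End TwoPart.

Theorem local_structure_of_shape (D : finZmodType) (q : D -> rat) (N : nat)
    (delta : nat -> int) (d2 : two_part) (p : nat) :
  discriminant_form q -> special_shape q delta d2 -> is_level q N -> p \in primes N ->
  local_structure q N p (chi_at d2 p) (epsilon_at N delta d2 p).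
Proof.
move=> Dform [ev od] Nlevel pN; have pp := prime_of_mem pN.
case: (odd_prime_cases pp) => [p2|op]; last first.
  exact: (odd_local Dform Nlevel d2 pN op (od p pp op)).
rewrite p2 in pN *; case: d2 ev => [|t|t1 t2] ev.
- by have := two_trivial_local Dform Nlevel pN ev.
- exact: two_two_local ev.
- exact: two_four_local ev.
Qed.

Lemma prod_partn (n : nat) : (0 < n)%N -> (\prod_(p <- primes n) n`_p)%N = n.
Proof.
move=> n0; rewrite [RHS](prod_prime_decomp n0) prime_decompE big_map.
by apply: eq_bigr => p _; rewrite p_part.
Qed.

Lemma coprime_partn (n p p' : nat) : prime p -> prime p' -> p != p' -> coprime n`_p n`_p'.
Proof.
move=> pp pp' ne; rewrite !p_part coprimeXl // coprimeXr // prime_coprime //.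
by rewrite dvdn_prime2.
Qed.

Lemma coprime_prod_partn (n p : nat) (s : seq nat) : prime p -> all prime s -> p \notin s ->
  coprime n`_p (\prod_(p' <- s) n`_p')%N.
Proof.
move=> pp; elim: s => [|p' s ih]; first by rewrite big_nil coprimen1.
move=> /andP[pp' ps]; rewrite inE negb_or => /andP[ne ns].
by rewrite big_cons coprimeMr coprime_partn // ih.
Qed.

(** * Level sets of the quadratic form *)

(* Builds [N] up one primary component at a time; [k] is the complementary Hall divisor. *)
Lemma hall_ind (N : nat) (Q : nat -> seq nat -> Prop) : (0 < N)%N -> Q 1%N [::] ->
  (forall p m s, p \in primes N -> p \notin s -> coprime N`_p m ->
     (exists2 k, N = (N`_p * m * k)%N & coprime (N`_p * m) k) ->
     Q m s -> Q (N`_p * m)%N (p :: s)) ->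
  Q N (primes N).
Proof.
move=> N0 Q0 QS; rewrite -[X in Q X _](prod_partn N0).
have ap : all prime (primes N) by apply/allP=> p; rewrite mem_primes => /andP[].
have main s : forall t, t ++ s = primes N -> Q (\prod_(p <- s) N`_p)%N s.
  elim: s => [|p s ih] t ts; first by rewrite big_nil.
  have us : uniq (t ++ p :: s) by rewrite ts primes_uniq.
  have aps : all prime (t ++ p :: s) by rewrite ts.
  move: aps; rewrite all_cat /= => /and3P[pt pp ps].
  move: us; rewrite cat_uniq /= => /and4P[ut /norP[pnt nts] pns us].
  rewrite big_cons; apply: QS => //.
  - by rewrite -ts mem_cat inE eqxx orbT.
  - exact: coprime_prod_partn.
  - exists (\prod_(p <- t) N`_p)%N.
      by rewrite -[LHS](prod_partn N0) -ts big_cat big_cons /= mulnC.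
    rewrite coprimeMl coprime_prod_partn //= coprime_sym.
    elim: t {ts ut} nts pt pnt => [|p' t iht]; first by rewrite big_nil coprime1n.
    rewrite has_sym /= negb_or => /andP[pn1 nts] /andP[pp' pt]; rewrite inE negb_or => /andP[_ pnt].
    by rewrite big_cons coprimeMl coprime_prod_partn // iht // has_sym.
  by apply: (ih (rcons t p)); rewrite cat_rcons.
exact: main [::] erefl.
Qed.

Section Global.
Variables (D : finZmodType) (q : D -> rat) (Dform : discriminant_form q).
Variables (N : nat) (Nlevel : is_level q N).
Variables (chi : nat -> int -> int) (eps : nat -> int).
Hypothesis loc : forall p, p \in primes N -> local_structure q N p (chi p) (eps p).

Let N0 := level_gt0 Nlevel.

Lemma card_level : #|D| = N.
Proof.
rewrite -cardsT -(tor_level Dform Nlevel).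
apply: (@hall_ind N (fun m _ => #|tor D m| = m) N0).
  have -> : tor D 1 = [set 0] by apply/setP => x; rewrite !inE mulr1n.
  by rewrite cards1.
by move=> p m s pN _ co _ IH; rewrite card_tor // IH (local_card (loc pN)).
Qed.

(** The scaling by the full N, for every Hall divisor [m], lets one and the same [j] serve at all
    primes, so that the count is multiplicative in [m]. *)
Definition level_count (m : nat) (j : int) : nat :=
  #|[set x in tor D m | (N%:R * q x - j%:~R) / m%:R \is a Num.int]|.

Lemma level_countM m1 m2 k j : coprime m1 m2 -> N = (m1 * m2 * k)%N ->
  coprime (m1 * m2) k ->
  level_count (m1 * m2) j = (level_count m1 j * level_count m2 j)%N.
Proof.
move=> co NE cok.
have sumE m : level_count m j =
    (\sum_(x in tor D m) ((N%:R * q x - j%:~R) / m%:R \is a Num.int))%N.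
  rewrite /level_count -sum1dep_card big_mkcondr; apply: eq_bigr => x _.
  by case: (_ \is a _).
rewrite !sumE (tor_sum_split _ co) big_distrl /=; apply: eq_bigr => y hy.
rewrite big_distrr /=; apply: eq_bigr => z hz; rewrite mulnb; congr nat_of_bool.
have m0 : (0 < m1)%N /\ (0 < m2)%N by move: N0; rewrite NE !muln_gt0 => /andP[/andP[]].
have [m1n m2n] : (m1%:R : rat) != 0 /\ (m2%:R : rat) != 0 by rewrite !pnatr_eq0; lia.
move: cok; rewrite coprimeMl => /andP[co1 co2].
have k1 := hall_kills Dform Nlevel (P := m1) (M := (m2 * k)%N) _ _ hy.
have {k1}/eqQZ0 k1 : eqQZ (m1%:R * q y) 0.
  by apply: k1; rewrite ?mulnA // coprimeMr co co1.
have k2 := hall_kills Dform Nlevel (P := m2) (M := (m1 * k)%N) _ _ hz.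
have {k2}/eqQZ0 k2 : eqQZ (m2%:R * q z) 0.
  by apply: k2; rewrite ?mulnA ?(mulnC m2) // coprimeMr coprime_sym co co2.
have kN w (m m' : nat) : N = (m' * m)%N -> m%:R * q w \is a Num.int ->
    exists2 a : int, N%:R * q w = a%:~R & (m' %| a)%Z.
  move=> Nm /intrP[a ha]; exists (m'%:Z * a); last exact: dvdz_mulr.
  by rewrite Nm natrM -mulrA ha rmorphM.
have [|a ha da] := kN y m1 (m2 * k)%N _ k1; first by rewrite NE; ring.
have [|b hb db] := kN z m2 (m1 * k)%N _ k2; first by rewrite NE; ring.
have bil0 := bil_coprime Dform co hy hz; have /eqQZ0/intrP[c hc] := bil0.
have -> : (N%:R * q (y + z) - j%:~R) / (m1 * m2)%N%:R =
    (a + b + N%:Z * c - j)%:~R / (m1 * m2)%N%:R.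
  by congr (_ / _); rewrite qD hc !mulrDr ha hb rmorphB !rmorphD rmorphM.
rewrite ha hb -!rmorphB /= !divz_int ?muln_gt0 ?(proj1 m0) ?(proj2 m0) //.
have -> : ((m1 * m2)%N %| a + b + N%:Z * c - j)%Z =
    ((m1 %| a + b + N%:Z * c - j)%Z && (m2 %| a + b + N%:Z * c - j)%Z).
  by rewrite !dvdzE /= Gauss_dvd.
have da' : (m2 %| a)%Z by apply: dvdz_trans da; rewrite PoszM dvdz_mulr.
have db' : (m1 %| b)%Z by apply: dvdz_trans db; rewrite PoszM dvdz_mulr.
have dN1 : (m1 %| N)%N by rewrite NE -mulnA dvdn_mulr.
have dN2 : (m2 %| N)%N by rewrite NE mulnAC dvdn_mull.
congr (_ && _).
  have -> : a + b + N%:Z * c - j = (b + N%:Z * c) + (a - j) by ring.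
  by rewrite rpredDl // rpredD // dvdz_mulr // dvdzE.
have -> : a + b + N%:Z * c - j = (a + N%:Z * c) + (b - j) by ring.
by rewrite rpredDl // rpredD // dvdz_mulr // dvdzE.
Qed.

Lemma level_countE j :
  (level_count N j)%:Z = \prod_(p <- primes N) (1 + eps p * chi p j).
Proof.
apply: (@hall_ind N (fun m s => (level_count m j)%:Z = \prod_(p <- s) (1 + eps p * chi p j)) N0).
  rewrite big_nil /level_count; congr Posz.
  have -> : [set x in tor D 1 | (N%:R * q x - j%:~R) / 1%:R \is a Num.int] = [set 0].
    apply/setP => x; rewrite !inE mulr1n; case: eqP => //= ->.
    rewrite divr1 rpredB ?intr_int //; apply/eqQZ0.
    by rewrite -(mulr0 N%:R); apply: eqQZMn; apply: (q0 Dform).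
  by rewrite cards1.
move=> p m s pN _ co [k NE cok] IH.
rewrite (level_countM j co NE cok) big_cons PoszM IH; congr (_ * _).
exact: local_count (loc pN) j.
Qed.

Lemma level_set_count j : level_count N j = #|[set x | q x - j%:~R / N%:R \is a Num.int]|.
Proof.
rewrite /level_count (tor_level Dform Nlevel); apply: eq_card => x; rewrite !inE.
have Nn : (N%:R : rat) != 0 by rewrite pnatr_eq0; lia.
by rewrite mulrBl mulrAC divff // mul1r.
Qed.

(** Components of x and y at coprime orders have q-values with coprime denominators, so equality of
    the sums forces equality at each prime. The local automorphisms fix the other components, and
    their product maps x to y. *)
Lemma level_set_transitive x y : eqQZ (q x) (q y) ->
  exists2 s : {perm D}, form_automorphism q s & s x = y.
Proof.
suff h : forall x y, x \in tor D N -> y \in tor D N -> eqQZ (q x) (q y) ->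
    exists s : {perm D}, [/\ form_automorphism q s, s x = y & forall z, z \in tor D (N %/ N) -> s z = z].
  by move=> xy; have [|| s [h1 h2 _]] := h x y _ _ xy; rewrite ?(tor_level Dform Nlevel) ?inE //; exists s.
apply: (@hall_ind N (fun m _ => forall x y, x \in tor D m -> y \in tor D m ->
  eqQZ (q x) (q y) -> exists s : {perm D},
  [/\ form_automorphism q s, s x = y & forall z, z \in tor D (N %/ m) -> s z = z]) N0).
  move=> {}x {}y; rewrite !inE !mulr1n => /eqP-> /eqP-> _.
  exists 1%g; split=> [||z _]; rewrite ?perm1 //.
  by split=> *; rewrite !perm1 //; apply: eqQZ_refl.
move=> p m s pN _ co [k NE cok] IH {}x {}y hx hy xy.
set P := (N`_p)%N in co NE cok hx hy *.
have [P0 m0] : (0 < P)%N /\ (0 < m)%N by move: N0; rewrite NE !muln_gt0 => /andP[/andP[]].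
move: cok; rewrite coprimeMl => /andP[co1 co2].
have dec w : w \in tor D (P * m) -> exists w1 w2, [/\ w1 \in tor D P, w2 \in tor D m & w = w1 + w2].
  move=> hw; exists (w *+ chinese P m 1 0), (w *+ chinese P m 0 1).
  set n1 := chinese _ _ _ _; set n2 := chinese _ _ _ _.
  have n11 : (n1 = 1 %[mod P])%N by exact: chinese_modl.
  have n12 : (n1 = 0 %[mod m])%N by exact: chinese_modr.
  have n21 : (n2 = 0 %[mod P])%N by exact: chinese_modl.
  have n22 : (n2 = 1 %[mod m])%N by exact: chinese_modr.
  clearbody n1 n2; split.
  - move: n12 => /eqP; rewrite eqn_mod_dvd // subn0 => /dvdnP[l ->].
    have e : (l * m * P = P * m * l)%N by rewrite mulnC (mulnC l) mulnA.
    by apply/torP; rewrite -mulrnA e mulrnA (torP _ _ hw) mul0rn.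
  - move: n21 => /eqP; rewrite eqn_mod_dvd // subn0 => /dvdnP[l ->].
    have e : (l * P * m = P * m * l)%N by rewrite -mulnA mulnC.
    by apply/torP; rewrite -mulrnA e mulrnA (torP _ _ hw) mul0rn.
  rewrite -mulrnDr -[LHS]mulr1n; apply: tor_mod hw _.
  apply/eqP; rewrite chinese_remainder //.
  by rewrite -[((_ + _) %% P)%N]modnDm n11 n21 modnDm eqxx -[((_ + _) %% m)%N]modnDm n12 n22 modnDm eqxx.
have [x1 [x2 [hx1 hx2 xE]]] := dec x hx.
have [y1 [y2 [hy1 hy2 yE]]] := dec y hy.
have qs w1 w2 : w1 \in tor D P -> w2 \in tor D m -> eqQZ (q (w1 + w2)) (q w1 + q w2).
  move=> h1 h2; rewrite qD -[X in eqQZ _ X]addr0; apply: eqQZD (eqQZ_refl _) _.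
  exact: bil_coprime co h1 h2.
have kP w : w \in tor D P -> eqQZ (P%:R * q w) 0.
  by apply: (hall_kills Dform Nlevel (M := (m * k)%N)); rewrite ?mulnA // coprimeMr co co1.
have km w : w \in tor D m -> eqQZ (m%:R * q w) 0.
  by apply: (hall_kills Dform Nlevel (M := (P * k)%N)); rewrite ?mulnA ?(mulnC m) // coprimeMr coprime_sym co co2.
have e : eqQZ (q x1 + q x2) (q y1 + q y2).
  rewrite xE yE in xy; exact: eqQZ_trans (eqQZ_sym (qs _ _ hx1 hx2)) (eqQZ_trans xy (qs _ _ hy1 hy2)).
have e1 : eqQZ (q x1) (q y1).
  suff /eqQZ0 : eqQZ (q x1 - q y1) 0 by [].
  apply: (eqQZ_coprime co).
    by rewrite mulrBr -[0]subr0; apply: eqQZB; apply: kP.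
  have : eqQZ (q x1 - q y1) (q y2 - q x2).
    by rewrite /eqQZ; move: e; rewrite /eqQZ; congr (_ \is a _); ring.
  move=> /(eqQZMn m) h; apply: eqQZ_trans h _.
  by rewrite mulrBr -[0]subr0; apply: eqQZB; apply: km.
have e2 : eqQZ (q x2) (q y2).
  by have := eqQZB e e1; rewrite /eqQZ; congr (_ \is a _); ring.
have [s1 [[s1D s1q] s1x s1f]] := local_transitive (loc pN) hx1 hy1 e1.
have [s2 [[s2D s2q] s2x s2f]] := IH _ _ hx2 hy2 e2.
have NP : (N %/ P = m * k)%N by rewrite NE -mulnA mulKn.
have Nm : (N %/ m = P * k)%N by rewrite NE mulnAC mulnK.
have NPm : (N %/ (P * m) = k)%N by rewrite NE mulKn // muln_gt0 P0.
exists (s1 * s2)%g; split.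
- split=> [u v|u]; rewrite !permM; first by rewrite s1D s2D.
  exact: eqQZ_trans (s2q _) (s1q _).
- rewrite permM xE yE s1D s1x s1f; last by rewrite -/P NP; apply: tor_dvd hx2; rewrite dvdn_mulr.
  by rewrite s2D s2x s2f // Nm; apply: tor_dvd hy1; rewrite dvdn_mulr.
- rewrite NPm => z hz; rewrite permM s1f; last by rewrite -/P NP; apply: tor_dvd hz; rewrite dvdn_mull.
  by rewrite s2f // Nm; apply: tor_dvd hz; rewrite dvdn_mull.
Qed.

Lemma omega_gcd (j : int) :
  omega (gcdn `|j| N) = count (fun p : nat => (p %| j)%Z) (primes N).
Proof.
rewrite /omega -size_filter; apply/perm_size/uniq_perm; rewrite ?filter_uniq ?primes_uniq //.
move=> p; rewrite mem_filter !mem_primes gcdn_gt0 N0 orbT /= dvdn_gcd dvdzE /=.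
by case: (prime p); case: (_ %| `|j|)%N.
Qed.

(** The origin of s(n). In a nonzero product of the factors 1 + eps_p chi_p(j), a factor is 1 if p
    divides j and 2 otherwise, so the missing powers of 2 are counted by the primes dividing gcd(j,
    N). *)
Lemma level_count_s j : level_count N j != 0%N ->
  (level_count N j * s_mult N j = 2 ^ omega N)%N.
Proof.
move=> c0; apply/eqP; rewrite -eqz_nat PoszM level_countE /s_mult omega_gcd.
have {c0} : \prod_(p <- primes N) (1 + eps p * chi p j) != 0 by rewrite -level_countE.
suff main : forall s, {subset s <= primes N} ->
    \prod_(p <- s) (1 + eps p * chi p j) != 0 ->
    (\prod_(p <- s) (1 + eps p * chi p j)) * (2 ^ count (fun p : nat => (p %| j)%Z) s)%N%:Z =
    (2 ^ size s)%N%:Z by move=> h; rewrite main.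
elim=> [|p s ih] sub; first by rewrite big_nil.
rewrite !big_cons mulf_eq0 negb_or => /andP[h1 h2].
have pN : p \in primes N by apply: sub; rewrite inE eqxx.
have IH := ih (fun p' h => sub p' (mem_behead (s := p :: s) h)) h2.
have := local_char (loc pN) => lc.
rewrite /= expnD expnS !PoszM -IH mulrACA; congr (_ * _).
move: h1; have := qchar_eq0 lc j; have := qchar_range lc j; case: (local_sign (loc pN)) => ->;
  by case=> -> <-.
Qed.

(** With its converse below: the sign condition in the definition of A^epsilon says that a(n) = 0
    unless n is modulo N a value of N q. *)
Lemma level_count0 j : level_count N j = 0%N ->
  exists2 p, p \in primes N & chi p j = - eps p.
Proof.
move=> c0; have := level_countE j; rewrite c0 => /esym/eqP.
rewrite prodf_seq_eq0 => /hasP[p pN /= h]; exists p => //.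
have := local_char (loc pN) => lc.
by move: h; have := qchar_range lc j; case: (local_sign (loc pN)) => -> [] ->.
Qed.

Lemma level_count_neq0 j p : level_count N j != 0%N -> p \in primes N -> chi p j != - eps p.
Proof.
move=> c0 pN; have := level_countE j; apply: contra_eq_neq => h.
rewrite (_ : \prod_(_ <- _) _ = 0) ?eqz_nat //; apply/eqP.
rewrite prodf_seq_eq0; apply/hasP; exists p => //=; rewrite h.
by case: (local_sign (loc pN)) => ->.
Qed.

End Global.

(** * The Dirichlet character modulo N *)

Section GlobalCharacter.
Variables (N : nat) (N0 : (0 < N)%N) (d2 : two_part).
Hypothesis (loc : forall p, p \in primes N -> quadratic_char p N`_p (chi_at d2 p)).

Lemma chiD_mod x y : (x = y %[mod N])%Z -> chiD N d2 x = chiD N d2 y.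
Proof.
move=> xy; rewrite /chiD !big_seq; apply: eq_bigr => p pN.
apply: (qchar_mod (loc pN)); apply/eqP; rewrite eqz_mod_dvd.
apply: (dvdz_trans (n := N)); first by rewrite dvdzE /= dvdn_part.
by rewrite -eqz_mod_dvd; apply/eqP.
Qed.

Lemma chiDM x y : chiD N d2 (x * y) = chiD N d2 x * chiD N d2 y.
Proof.
rewrite /chiD -big_split /= !big_seq; apply: eq_bigr => p pN.
exact: qcharM (loc pN) x y.
Qed.

Lemma chiD1 : chiD N d2 1 = 1.
Proof.
rewrite /chiD big_seq big1 // => p pN; apply: (qchar1 _ (loc pN)).
by move: pN; rewrite mem_primes => /andP[].
Qed.

Lemma chiD_inv x y : (x * y = 1 %[mod N])%Z -> chiD N d2 x = chiD N d2 y /\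
  chiD N d2 x ^+ 2 = 1.
Proof.
move=> xy; have := chiD_mod xy; rewrite chiDM chiD1 => h.
have : chiD N d2 x = 1 \/ chiD N d2 x = -1.
  move: h => /(congr1 absz)/eqP; rewrite abszM muln_eq1 => /andP[/eqP h _]; lia.
case=> hx; move: h; rewrite hx ?mul1r ?mulN1r; first by move=> ->.
by move=> /eqP; rewrite eqr_oppLR => /eqP ->.
Qed.

Lemma chiD_primitive p : p \in primes N -> exists x : int,
  ((N %/ N`_p)%N %| x)%Z /\ chiD N d2 (1 + (N %/ p)%N%:Z * x) = -1.
Proof.
move=> pN; have pp : prime p by move: pN; rewrite mem_primes => /andP[].
have [t ht] := qchar_primitive (loc pN).
pose P := (N`_p)%N; pose M := (N %/ P)%N.
have NE : N = (P * M)%N by rewrite /M mulnC divnK // dvdn_part.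
have pP : (p %| P)%N.
  by rewrite /P p_part -{1}(expn1 p) dvdn_exp2l // logn_gt0.
have co : coprimez (M%:Z ^+ 2) P.
  rewrite coprimezXl // coprimezE /= coprime_sym.
  have -> : M = (N`_p^')%N.
    by apply/eqP; rewrite -(eqn_pmul2l (part_gt0 p N)) -NE partnC.
  exact: coprime_partC.
have [[u v] /= uv] := coprimezP _ _ co.
(* Here u M^2 = 1 modulo P, so N/p times this number is (P/p) t modulo P, where chi_p takes the
   value -1; at the other primes it is 0, since M divides it. *)
exists (M%:Z * (u * t)); split; first exact: dvdz_mulr.
have NpE : (N %/ p = P %/ p * M)%N by rewrite {1}NE divn_mulAC.
rewrite /chiD (bigD1_seq p) ?primes_uniq //= big1_seq.
  rewrite mulr1 -ht; apply: (qchar_mod (loc pN)); apply/eqP; rewrite eqz_mod_dvd -/P NpE PoszM.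
  have -> : 1 + (P %/ p)%N%:Z * M%:Z * (M%:Z * (u * t)) - (1 + (P %/ p)%N%:Z * t) =
    (P %/ p)%N%:Z * t * (u * M%:Z ^+ 2 - 1) by ring.
  by rewrite -uv opprD addNKr mulrN dvdzE abszN -dvdzE mulrA dvdz_mull.
move=> p' /andP[ne pN'].
have pp' : prime p' by move: pN'; rewrite mem_primes => /andP[].
rewrite -[RHS](qchar1 pp' (loc pN')); apply: (qchar_mod (loc pN')); apply/eqP.
rewrite eqz_mod_dvd addrC addKr NpE; apply: dvdz_mulr; rewrite PoszM; apply: dvdz_mull.
rewrite dvdzE /= -(@Gauss_dvdr _ P) ?coprime_partn //.
by rewrite -NE dvdn_part.
Qed.
End GlobalCharacter.

From mathcomp Require Import finmap.
From mathcomp Require Import all_classical all_reals all_analysis.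
From mathcomp Require Import complex.
Import Order.TTheory GRing.Theory Num.Theory.

(** * Exponentials and Gauss sums *)

Section Exponential.
Variable R : realType.
Implicit Types z w : R[i].

Lemma e2piD z w : e2pi (z + w) = e2pi z * e2pi w.
Proof.
case: z w => [x y] [x' y']; rewrite /e2pi /= !mulrDr opprD expRD cosD sinD.
by rewrite rmorphM /= mulrACA; congr (_ * _); apply/eqP; rewrite eq_complex /= eqxx addrC eqxx.
Qed.

Lemma e2pi0 : e2pi 0 = 1 :> R[i].
Proof.
rewrite /e2pi /= !mulr0 oppr0 expR0 cos0 sin0 mul1r.
by apply/eqP; rewrite eq_complex /= !eqxx.
Qed.

Lemma e2pi_neq0 z : e2pi z != 0.
Proof.
apply/eqP => h; have := e2piD z (- z); rewrite subrr e2pi0 h mul0r => /eqP.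
by rewrite oner_eq0.
Qed.

Lemma e2piN z : e2pi (- z) = (e2pi z)^-1.
Proof.
apply: (mulfI (e2pi_neq0 z)); rewrite -e2piD subrr e2pi0 divff //.
exact: e2pi_neq0.
Qed.

Lemma e2piMn z n : e2pi (z *+ n) = e2pi z ^+ n.
Proof. by elim: n => [|n ih]; rewrite ?mulr0n ?expr0 ?e2pi0 // mulrS e2piD ih exprS. Qed.

Lemma e2pi_nat n : e2pi n%:R = 1 :> R[i].
Proof.
rewrite e2piMn (_ : e2pi 1 = 1) ?expr1n //.
rewrite /e2pi /= mulr0 oppr0 expR0 mulr1 mul1r mulr_natl cos2pi sin2pi.
by apply/eqP; rewrite eq_complex /= !eqxx.
Qed.

Lemma e2pi_int (n : int) : e2pi n%:~R = 1 :> R[i].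
Proof.
case: n => n; first exact: e2pi_nat.
by rewrite NegzE mulrNz e2piN -pmulrn e2pi_nat invr1.
Qed.

Fact ee_key : unit. Proof. exact: tt. Qed.

(** Locked so that conversion does not unfold the real exponential; the rewriting lemmas below are
    the interface. *)
Definition ee (x : rat) : R[i] := locked_with ee_key (e2pi (ratr x)).

Lemma eeE x : ee x = e2pi (ratr x). Proof. by rewrite /ee unlock. Qed.
Lemma eeD x y : ee (x + y) = ee x * ee y.
Proof. by rewrite !eeE rmorphD e2piD. Qed.
Lemma ee0 : ee 0 = 1. Proof. by rewrite eeE rmorph0 e2pi0. Qed.
Lemma eeN x : ee (- x) = (ee x)^-1. Proof. by rewrite !eeE rmorphN e2piN. Qed.
Lemma ee_neq0 x : ee x != 0. Proof. by rewrite eeE e2pi_neq0. Qed.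
Lemma ee_int x : x \is a Num.int -> ee x = 1.
Proof. by move=> /intrP[n ->]; rewrite eeE rmorph_int e2pi_int. Qed.
Lemma ee_eq x y : eqQZ x y -> ee x = ee y.
Proof. by move=> h; rewrite -(subrK y x) eeD (ee_int h) mul1r. Qed.

Lemma ee_eq1 x : ee x = 1 -> x \is a Num.int.
Proof.
wlog x01 : x / 0 <= x < 1.
  move=> hw e1; rewrite -(subrK (Num.floor x)%:~R x) rpredD ?intr_int //.
  apply: hw; last by rewrite eeD e1 mul1r eeN (ee_int (intr_int _ _)) invr1.
  by rewrite subr_ge0 floor_le_tmp ltrBlDr addrC -[X in _ < _ + X]/(1%:~R) -intrD floorD1_gt.
move=> /eqP; rewrite eeE /e2pi.
have -> : ratr x = (ratr x)%:C%C :> R[i].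
  by rewrite -(fmorph_rat (real_complex R)).
rewrite /= mulr0 oppr0 expR0 mul1r eq_complex /= => /andP[/eqP hc _].
have [->|x0] := eqVneq x 0; first exact: rpred0.
set y : R := ratr x in hc *.
have y01 : 0 < y < 1.
  have : ratr 0 < y < ratr 1 by rewrite !ltr_rat lt_neqAle eq_sym x0.
  by rewrite rmorph0 rmorph1.
(* For 0 < y < 1 a value cos(2 pi y) = 1 would force sin(pi y) = 0, but the sine is positive on the
   open interval from 0 to pi. *)
have : cos (2 * pi * y) = 1 - sin (pi * y) ^+ 2 *+ 2.
  have -> : 2 * pi * y = (pi * y) *+ 2 by ring.
  rewrite cos_mulr2n; have := cos2Dsin2 (pi * y); lra.
rewrite hc => h.
have : sin (pi * y) ^+ 2 = 0 by lra.
move=> /eqP; rewrite sqrf_eq0 => /eqP s0.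
have : 0 < sin (pi * y).
  case/andP: y01 => y0 y1; have p0 := pi_gt0 R; apply: sin_gt0_pi.
  by rewrite mulr_gt0 //= gtr_pMr.
by rewrite s0 ltxx.
Qed.

Lemma sum_ee (N : nat) (j : int) : (0 < N)%N ->
  \sum_(i < N) ee (i%:R * (j%:~R / N%:R)) = if (N %| j)%Z then N%:R else 0.
Proof.
move=> N0; have eX i : ee (i%:R * (j%:~R / N%:R)) = ee (j%:~R / N%:R) ^+ i.
  by elim: i => [|i ih]; rewrite ?mul0r ?ee0 ?expr0 // -addn1 natrD mulrDl mul1r eeD ih exprD expr1.
under eq_bigr => i _ do rewrite eX.
case: ifP => h.
  under eq_bigr => i _ do rewrite ee_int ?divz_int // expr1n.
  by rewrite sumr_const card_ord.
have e1 : ee (j%:~R / N%:R) != 1.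
  by apply/eqP => /ee_eq1; rewrite divz_int // h.
have := subrX1 (ee (j%:~R / N%:R)) N; rewrite -eX mulrC divfK ?pnatr_eq0 -?lt0n //.
rewrite ee_int ?intr_int // subrr => /esym/eqP.
by rewrite mulf_eq0 subr_eq0 (negPf e1) /= => /eqP.
Qed.

End Exponential.

Lemma tor_proj (D : finZmodType) (m1 m2 : nat) : coprime m1 m2 ->
  exists p1 p2 : D -> D,
    (forall w, w \in tor D (m1 * m2) ->
       [/\ p1 w \in tor D m1, p2 w \in tor D m2 & w = p1 w + p2 w]) /\
    (forall y z, y \in tor D m1 -> z \in tor D m2 -> p1 (y + z) = y /\ p2 (y + z) = z).
Proof.
move=> co; exists (fun w => w *+ chinese m1 m2 1 0), (fun w => w *+ chinese m1 m2 0 1).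
set n1 := chinese _ _ _ _; set n2 := chinese _ _ _ _.
have n11 : (n1 = 1 %[mod m1])%N by exact: chinese_modl.
have n12 : (n1 = 0 %[mod m2])%N by exact: chinese_modr.
have n21 : (n2 = 0 %[mod m1])%N by exact: chinese_modl.
have n22 : (n2 = 1 %[mod m2])%N by exact: chinese_modr.
clearbody n1 n2; split=> [w hw|y z hy hz]; last first.
  rewrite !mulrnDl (tor_mod hy n11) (tor_mod hz n12) (tor_mod hy n21) (tor_mod hz n22).
  by rewrite !mulr1n !mulr0n add0r addr0.
split.
- move: n12 => /eqP; rewrite eqn_mod_dvd // subn0 => /dvdnP[k ->].
  have e : (k * m2 * m1 = m1 * m2 * k)%N by rewrite mulnC (mulnC k) mulnA.
  by apply/torP; rewrite -mulrnA e mulrnA (torP _ _ hw) mul0rn.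
- move: n21 => /eqP; rewrite eqn_mod_dvd // subn0 => /dvdnP[k ->].
  have e : (k * m1 * m2 = m1 * m2 * k)%N by rewrite -mulnA mulnC.
  by apply/torP; rewrite -mulrnA e mulrnA (torP _ _ hw) mul0rn.
rewrite -mulrnDr -[LHS]mulr1n; apply: tor_mod hw _.
apply/eqP; rewrite chinese_remainder //.
by rewrite -[((_ + _) %% m1)%N]modnDm n11 n21 modnDm eqxx -[((_ + _) %% m2)%N]modnDm n12 n22 modnDm eqxx.
Qed.

Lemma sum_mod_mul (V : nmodType) (g : int -> V) (n : nat) (x : int) :
  (0 < n)%N -> coprimez x n ->
  (forall i j, (i = j %[mod n])%Z -> g i = g j) ->
  \sum_(j < n) g (x * (j : nat)) = \sum_(j < n) g (j : nat).
Proof.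
move=> n0 co gP.
have nn : (n : int) != 0 by lia.
have lt (j : 'I_n) : (`|(x * (j : nat) %% n)%Z| < n)%N.
  by rewrite -ltz_nat gez0_abs ?modz_ge0 // ltz_pmod // ltz_nat.
pose h (j : 'I_n) : 'I_n := Ordinal (lt j).
have hE j : (h j : int) = (x * (j : nat) %% n)%Z.
  by rewrite /= gez0_abs // modz_ge0.
have inj : injective h.
  move=> i j /(congr1 (fun k : 'I_n => (k : nat) : int)); rewrite !hE => /eqP.
  rewrite eqz_mod_dvd -mulrBr Gauss_dvdzr; last by rewrite coprimez_sym.
  by rewrite -eqz_mod_dvd !modz_nat !modn_small // => /eqP[] /val_inj.
rewrite [RHS](reindex_inj inj); apply: eq_bigr => j _; apply: gP.
by rewrite hE modz_mod.
Qed.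

Section Weil.
Variables (R : realType) (D : finZmodType) (q : D -> rat) (Dform : discriminant_form q).
Variables (N : nat) (Nlevel : is_level q N).
Local Notation C := R[i].
Local Notation ee := (@ee R).

Section Local.
Variables (p : nat) (pN : p \in primes N) (chi : int -> int) (eps : int).
Hypothesis (loc : local_structure q N p chi eps).
Let n := (N`_p)%N.
Let H := tor D n.
Let lc : quadratic_char p n chi := local_char loc.

Let pp : prime p. Proof. exact: prime_of_mem pN. Qed.
Let n0 : (0 < n)%N. Proof. exact: part_gt0. Qed.

Lemma coprime_pfactor c : coprimez c n = ~~ (p %| c)%Z.
Proof.
have : (0 < logn p N)%N by rewrite logn_gt0.
rewrite /n p_part coprimezE => h; rewrite coprime_sym /= coprime_pexpl // prime_coprime //.
Qed.

Lemma loc_kills x : x \in H -> eqQZ (n%:R * q x) 0.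
Proof. by apply: hall_kills (pfactor_level N p) (pfactor_level_coprime Nlevel p). Qed.

Lemma ee_mod (a b : int) x : x \in H -> (a = b %[mod n])%Z ->
  ee (a%:~R * q x) = ee (b%:~R * q x).
Proof.
move=> /loc_kills /eqQZ0 hx /eqP; rewrite eqz_mod_dvd => /dvdzP[k hk]; apply: ee_eq.
rewrite /eqQZ -mulrBl -rmorphB /= hk rmorphM /= -mulrA.
by apply: rpredM; rewrite ?intr_int.
Qed.

Definition gauss (x : int) : C := \sum_(y in H) ee (x%:~R * q y).

(** Collect the terms by j = N q(z) modulo n, with w the inverse of N/n. Each j occurs 1 + eps
    chi(j) times; the part without chi is a full sum of roots of unity and vanishes. What remains is
    a Gauss sum of the character chi, for which the substitution j -> x j extracts chi(x). *)
Lemma gauss_twist x : ~~ (p %| x)%Z -> gauss x = (chi x)%:~R * gauss 1.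
Proof.
rewrite -coprime_pfactor => cox.
have n1 : (1 < n)%N.
  by apply: leq_trans (prime_gt1 pp) (dvdn_leq n0 (dvd_pfactor_level Nlevel pN)).
pose M := (N %/ n)%N; have NE : N = (n * M)%N by exact: pfactor_level.
have coM : coprimez M n by rewrite coprimezE coprime_sym; exact: (pfactor_level_coprime Nlevel p).
have [[w u] /= wM] := coprimezP _ _ coM.
have cow : coprimez w n by apply/coprimezP; exists (M%:Z, u); rewrite /= mulrC.
pose c (j : nat) := #|[set x in H | (N%:R * q x - (j%:Z)%:~R) / n%:R \is a Num.int]|.
have cE j : ((c j)%:Z)%:~R = 1 + eps%:~R * (chi j)%:~R :> C.
  by rewrite (local_count loc) rmorphD rmorphM.
have key y : ~~ (p %| y)%Z -> gauss y = eps%:~R * \sum_(j < n) (chi j)%:~R * ee ((y * w * j)%:~R / n%:R).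
  rewrite -coprime_pfactor => coy.
  transitivity (\sum_(j < n) (c j)%:R * ee ((y * w * j)%:~R / n%:R)).
    have -> : gauss y = \sum_(z in H) \sum_(j < n)
        ((N%:R * q z - (j%:Z)%:~R) / n%:R \is a Num.int)%:R * ee ((y * w * j)%:~R / n%:R).
      apply: eq_bigr => z hz; have /eqQZ0/intrP[m hm] := loc_kills hz.
      have [j jn mj] := @modz_lt (M%:Z * m) n n0.
      have qz : q z = m%:~R / n%:R by rewrite -hm mulrC mulKf // pnatr_eq0; lia.
      have cond (i : nat) : ((N%:R * q z - (i%:Z)%:~R) / n%:R \is a Num.int) = (M%:Z * m == i %[mod n])%Z.
        by apply: (count_cond pN); rewrite qz; apply: eqQZ_refl.
      rewrite (bigD1 (Ordinal jn)) //= cond mj eqxx mul1r big1 ?addr0.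
        apply: ee_eq; rewrite qz mulrA -rmorphM /eqQZ -mulrBl -rmorphB /= divz_int //.
        rewrite -mulrA -mulrBr dvdz_mull // -eqz_mod_dvd.
        have -> : (w * j = w * (M%:Z * m) %[mod n])%Z by rewrite -modzMmr -mj modzMmr.
        rewrite eqz_mod_dvd -[X in X - _]mul1r -wM; apply/dvdzP; exists (u * m); ring.
      move=> i ij; rewrite cond mj eqz_mod_dvd -eqz_mod_dvd !modz_nat !modn_small //.
      case: eqP => [[ji]|_]; last by rewrite mul0r.
      by move: ij; rewrite -val_eqE /= ji eqxx.
    rewrite exchange_big /=; apply: eq_bigr => j _; rewrite -mulr_suml; congr (_ * _).
    rewrite /c -sum1dep_card big_mkcondr natr_sum; apply: eq_bigr => z _.
    by case: (_ \is a _).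
  have sum0 : \sum_(j < n) ee ((y * w * j)%:~R / n%:R) = 0.
    have := @sum_ee R n (y * w) n0; rewrite ifF.
      by move=> h0; rewrite -[RHS]h0; apply: eq_bigr => j _; rewrite rmorphM /= -mulrA mulrC mulrA mulrAC.
    apply/negP => h; have : coprimez (y * w) n by rewrite coprimezMl coy.
    by rewrite coprimezE => /(coprime_dvdl h); rewrite /coprime gcdnn => /eqP /= e; move: n1; rewrite e.
  under eq_bigr => j _ do rewrite -[(c j)%:R]/((c j)%:Z%:~R) cE mulrDl mul1r -[eps%:~R * _ * _]mulrA.
  by rewrite big_split /= sum0 add0r mulr_sumr.
have p1 : ~~ (p %| 1)%Z by rewrite -coprime_pfactor coprimezE coprime1n.
rewrite key -?coprime_pfactor // key // mulrCA; congr (_ * _).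
pose g (j : int) : C := (chi j)%:~R * ee ((w * j)%:~R / n%:R).
have e1 : \sum_(j < n) (chi j)%:~R * ee ((1 * w * j)%:~R / n%:R) = \sum_(j < n) g (j : nat).
  by apply: eq_bigr => j _; rewrite mul1r.
have gmod i j : (i = j %[mod n])%Z -> g i = g j.
  move=> ij; rewrite /g (qchar_mod lc ij); congr (_ * _); apply: ee_eq.
  rewrite /eqQZ -mulrBl -rmorphB /= divz_int // -mulrBr dvdz_mull //.
  by rewrite -eqz_mod_dvd ij.
rewrite e1 -(sum_mod_mul n0 cox gmod) mulr_sumr; apply: eq_bigr => j _.
have x2 : (chi x)%:~R * (chi x)%:~R = 1 :> C.
  rewrite -rmorphM /=; have := qchar_eq0 lc x; rewrite -[(p %| x)%Z]negbK -coprime_pfactor cox.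
  by case: (qchar_range lc x) => ->.
rewrite /g (qcharM lc) (rmorphM _ (chi x)) /= [RHS]mulrA [X in _ = X * _]mulrA x2 mul1r.
by have -> : w * (x * (j : nat)) = x * w * (j : nat) by rewrite mulrCA mulrA.
Qed.
End Local.
End Weil.

Lemma modz_opp (x y : int) (d : int) : (x = y %[mod d])%Z -> (- x = - y %[mod d])%Z.
Proof. by move=> h; rewrite -modzNm h modzNm. Qed.

(* The family [v a c] behaves like [rho M (e_0)] for [M] in SL_2(Z) with first
   column [(a, c)], restricted to the component [tor D m]; [g] normalises the
   Fourier transform. *)
Definition weil_vector (R : realType) (D : finZmodType) (q : D -> rat) (m : nat)
    (chi : int -> int) : Prop :=
  exists (v : int -> int -> D -> R[i]) (g : R[i]),
  [/\ forall b, b \in tor D m -> v 1 0 b = (b == 0)%:R,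
      forall a c b, coprimez a c -> b \in tor D m ->
        v (a + c) c b = ee R (q b) * v a c b,
      forall a c b, coprimez a c -> b \in tor D m ->
        v (- c) a b = g * \sum_(x in tor D m) ee R (- bil q x b) * v a c x
    & forall a c b, coprimez a c -> (m %| c)%Z -> b \in tor D m ->
        v a c b = (chi a)%:~R * (b == 0)%:R].

(** * The orbit of e_0 on one primary component *)

Section Weil.
Variables (R : realType) (D : finZmodType) (q : D -> rat) (Dform : discriminant_form q).
Variables (N : nat) (Nlevel : is_level q N).
Local Notation C := R[i].
Local Notation ee := (@ee R).

Section Local.
Variables (p : nat) (pN : p \in primes N) (chi : int -> int) (eps : int).
Hypothesis (loc : local_structure q N p chi eps).
Let n := (N`_p)%N.
Let H := tor D n.
Let lc : quadratic_char p n chi := local_char loc.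
Let pp : prime p. Proof. exact: prime_of_mem pN. Qed.
Let n0 : (0 < n)%N. Proof. exact: part_gt0. Qed.
Local Notation gauss := (@gauss R D q N p).

Let eem (a b : int) x : x \in H -> (a = b %[mod n])%Z ->
  ee (a%:~R * q x) = ee (b%:~R * q x).
Proof. exact: ee_mod. Qed.

Lemma bil_kills x y : x \in H -> eqQZ (n%:R * bil q x y) 0.
Proof. exact: bil_tor. Qed.

Lemma eeb_mod (a b : int) x y : x \in H -> (a = b %[mod n])%Z ->
  ee (a%:~R * bil q x y) = ee (b%:~R * bil q x y).
Proof.
move=> /(@bil_kills _ y) /eqQZ0 hx /eqP; rewrite eqz_mod_dvd => /dvdzP[k hk]; apply: ee_eq.
rewrite /eqQZ -mulrBl -rmorphB /= hk rmorphM /= -mulrA.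
by apply: rpredM; rewrite ?intr_int.
Qed.

Lemma unit_inv c : ~~ (p %| c)%Z -> exists u : int, (u * c = 1 %[mod n])%Z.
Proof.
rewrite -(@coprime_pfactor N p pN) => /coprimezP[[u v] /= h]; exists u.
by apply/eqP; rewrite eqz_mod_dvd -h opprD addNKr dvdzE abszN -dvdzE dvdz_mull.
Qed.

Definition invn (c : int) : int := xget 0 [set u : int | (u * c = 1 %[mod n])%Z]%classic.

Lemma invnP c : ~~ (p %| c)%Z -> (invn c * c = 1 %[mod n])%Z.
Proof. by move=> /unit_inv[u hu]; rewrite /invn; case: xgetP => [x _ //|/(_ u)]. Qed.

Lemma unit_cancel u x y : ~~ (p %| u)%Z -> (u * x = u * y %[mod n])%Z -> (x = y %[mod n])%Z.
Proof.
move=> hu /eqP; rewrite eqz_mod_dvd -mulrBr Gauss_dvdzr.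
  by rewrite -eqz_mod_dvd => /eqP.
by rewrite coprimez_sym (@coprime_pfactor N p pN).
Qed.

Lemma p_mod x y : (x = y %[mod n])%Z -> (p %| x)%Z = (p %| y)%Z.
Proof. by move=> h; rewrite -!(qchar_eq0 lc) (qchar_mod lc h). Qed.

Lemma pM x y : (p %| x * y)%Z = (p %| x)%Z || (p %| y)%Z.
Proof. by rewrite !dvdzE abszM Euclid_dvdM. Qed.

Lemma p_1 : ~~ (p %| 1)%Z.
Proof. by rewrite -(qchar_eq0 lc) (qchar1 pp lc). Qed.

Lemma invn_unit c : ~~ (p %| c)%Z -> ~~ (p %| invn c)%Z.
Proof.
move=> hc; have := p_mod (invnP hc); rewrite pM (negPf hc) orbF => ->; exact: p_1.
Qed.

(** Up to a scalar, the b-coordinate of S T^w S^-1 e_0. It cannot be reduced to [gauss] when p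
    divides w, which is the case needed for lower left entries divisible by p. *)
Definition ghat (w : int) (b : D) : C := \sum_(x in H) ee (w%:~R * q x + bil q x b).

Lemma eqQZ_bilMz z x b : eqQZ (bil q x (b *~ z)) (z%:~R * bil q x b).
Proof.
case: z => z; first exact: bilMnr.
rewrite NegzE !mulrNz mulNr; apply: eqQZ_trans (bilNr Dform _ _) _.
by apply: eqQZN; apply: bilMnr.
Qed.

Lemma shift_sum (F : D -> C) b : b \in H ->
  \sum_(x in H) F x = \sum_(x in H) F (x + b).
Proof.
move=> hb; rewrite (reindex_inj (addIr b)) /=; apply: eq_bigl => x.
apply/idP/idP => h; last exact: torD.
by rewrite -[x](addrK b); apply: torB.
Qed.

Lemma opp_sum (F : D -> C) : \sum_(x in H) F x = \sum_(x in H) F (- x).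
Proof. by rewrite (reindex_inj oppr_inj) /=; apply: eq_bigl => x; rewrite torN. Qed.

(** Completing the square with the translation by -b/y. *)
Lemma ghat_unit y b : ~~ (p %| y)%Z -> b \in H ->
  ghat y b = gauss y * ee ((- invn y)%:~R * q b).
Proof.
move=> hy hb; pose z := - invn y.
have hbz : b *~ z \in H by exact: torMz.
have zy : (z * y = -1 %[mod n])%Z.
  by rewrite /z mulNr; apply/modz_opp/invnP.
rewrite /ghat (shift_sum _ hbz) /gauss mulr_suml; apply: eq_bigr => x hx.
have e1 : ee (y%:~R * q (x + b *~ z) + bil q (x + b *~ z) b) =
  ee (y%:~R * q x) * ee ((z * y)%:~R * bil q x b) * ee ((y * z ^+ 2)%:~R * q b)
    * ee (bil q x b) * ee ((2 * z)%:~R * q b).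
  rewrite -!eeD; apply: ee_eq.
  apply: (@eqQZ_trans (y%:~R * (q x + z%:~R ^+ 2 * q b + z%:~R * bil q x b) +
     (bil q x b + z%:~R * bil q b b))).
    apply: eqQZD.
      apply: eqQZZ; rewrite qD; apply: eqQZD; last exact: eqQZ_bilMz.
      by apply: eqQZD; [exact: eqQZ_refl|exact: qZ].
    apply: eqQZ_trans (bilDl Dform _ _ _) _; apply: eqQZD; first exact: eqQZ_refl.
    by rewrite bilC; apply: eqQZ_bilMz.
  have bb : eqQZ (bil q b b) (2%:R * q b).
    rewrite /bil -[X in q X]/(b *+ 2); have := qZ Dform 2 b => h.
    have {h} := eqQZB (eqQZB h (eqQZ_refl (q b))) (eqQZ_refl (q b)).
    by rewrite -[b *~ 2]/(b *+ 2); congr eqQZ; ring.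
  have := eqQZD (eqQZ_refl (y%:~R * (q x + z%:~R ^+ 2 * q b + z%:~R * bil q x b)))
    (eqQZD (eqQZ_refl (bil q x b)) (eqQZZ z bb)).
  by congr eqQZ; ring.
rewrite e1 (eeb_mod b hx zy).
have -> : ee ((-1)%:~R * bil q x b) = (ee (bil q x b))^-1 by rewrite rmorphN1 mulN1r eeN.
have h2 : (y * z ^+ 2 = - z %[mod n])%Z.
  have -> : y * z ^+ 2 = z * y * z by ring.
  by rewrite -modzMml zy modzMml mulN1r.
rewrite (eem hb h2).
have -> : ee ((2 * z)%:~R * q b) = ee (z%:~R * q b) * ee (z%:~R * q b).
  by rewrite -eeD; congr ee; ring.
rewrite rmorphN mulNr eeN -/z; field.
by rewrite !ee_neq0.
Qed.

Lemma sum_bil b : b \in H -> \sum_(x in H) ee (bil q x b) = #|H|%:R * (b == 0)%:R.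
Proof.
move=> hb; case: eqP => [->|bn0].
  rewrite mulr1 -sumr_const; apply: eq_bigr => x _; apply: ee_int.
  by apply/eqQZ0; apply: bil0r.
rewrite mulr0; have [y hy yb] : exists2 y, y \in H & ~ eqQZ (bil q y b) 0.
  apply: contrapT => h; apply: bn0.
  apply: (hall_nondeg Dform Nlevel (pfactor_level N p) (pfactor_level_coprime Nlevel p) hb) => y hy.
  by apply: contrapT => h'; apply: h; exists y.
have e : \sum_(x in H) ee (bil q x b) = ee (bil q y b) * \sum_(x in H) ee (bil q x b).
  rewrite {1}(shift_sum _ hy) mulr_sumr; apply: eq_bigr => x _; rewrite -eeD.
  by apply: ee_eq; rewrite addrC; apply: bilDl.
have : (1 - ee (bil q y b)) * \sum_(x in H) ee (bil q x b) = 0 by rewrite mulrBl mul1r -e subrr.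
move/eqP; rewrite mulf_eq0 subr_eq0 => /orP[/eqP/esym/ee_eq1/eqQZ0 //|/eqP //].
Qed.

Lemma card_H_neq0 : #|H|%:R != 0 :> C.
Proof. by rewrite pnatr_eq0 -lt0n; apply/card_gt0P; exists 0; apply: tor0. Qed.

Lemma gauss_norm : gauss 1 * gauss (-1) = #|H|%:R.
Proof.
rewrite /gauss mulr_sumr.
transitivity (\sum_(y in H) \sum_(x in H) ee (q x + bil q x y)).
  apply: eq_bigr => y hy; rewrite [in LHS](shift_sum _ hy) mulr_suml; apply: eq_bigr => x hx.
  by rewrite -eeD; congr ee; rewrite rmorph1 rmorphN1 mul1r mulN1r qD; ring.
rewrite exchange_big /= (bigD1 0) ?tor0 //= [X in _ + X]big1 ?addr0.
  transitivity (\sum_(y in H) (1 : C)); last by rewrite sumr_const.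
  apply: eq_bigr => y _; apply: ee_int; apply/eqQZ0.
  by rewrite -[X in eqQZ _ X]addr0; apply: eqQZD; [apply: q0|apply: bil0l].
move=> x /andP[hx xn0]; under eq_bigr => y _ do rewrite eeD bilC.
by rewrite -mulr_sumr sum_bil // (negPf xn0) mulr0 mulr0.
Qed.

Lemma gauss1_neq0 : gauss 1 != 0.
Proof. by apply/eqP => h; have := card_H_neq0; rewrite -gauss_norm h mul0r eqxx. Qed.

Lemma chi_unit x : ~~ (p %| x)%Z -> (chi x)%:~R * (chi x)%:~R = 1 :> C.
Proof.
rewrite -(qchar_eq0 lc) -rmorphM /=.
by case: (qchar_range lc x) => ->.
Qed.

Lemma ghat_mod w w' b : (w = w' %[mod n])%Z -> ghat w b = ghat w' b.
Proof. by move=> h; apply: eq_bigr => x hx; rewrite !eeD (eem hx h). Qed.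

Lemma ghatN w b : ghat w (- b) = ghat w b.
Proof.
rewrite /ghat opp_sum; apply: eq_bigr => x hx; apply: ee_eq; apply: eqQZD.
  by apply: eqQZZ; apply: qN.
apply: eqQZ_trans (bilNl Dform _ _) _; rewrite -[X in eqQZ _ X]opprK; apply: eqQZN.
exact: bilNr.
Qed.

Lemma ghat0 b : b \in H -> ghat 0 b = #|H|%:R * (b == 0)%:R.
Proof. by move=> hb; rewrite -sum_bil //; apply: eq_bigr => x _; rewrite mul0r add0r. Qed.

(* Completing the square with an auxiliary Gauss sum of parameter -1. *)
Lemma ghat_T w w' b : b \in H -> ~~ (p %| 1 - w)%Z -> ((1 - w) * w' = w %[mod n])%Z ->
  ee (q b) * ghat w b = (chi (1 - w))%:~R * ghat w' b.
Proof.
move=> hb hw ww'.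
have pN1 : ~~ (p %| -1)%Z by have := p_1; rewrite !dvdzE.
have hw1 : ~~ (p %| w - 1)%Z by rewrite -opprB dvdzE abszN -dvdzE.
have GN : gauss (-1) != 0.
  by apply/eqP => h; have := card_H_neq0; rewrite -gauss_norm h mulr0 eqxx.
apply: (mulfI GN).
have e1 : gauss (-1) * ee (q b) = ghat (-1) b.
  rewrite ghat_unit //; congr (_ * _); rewrite -[q b in LHS]mul1r -[1 in LHS]/(1%:~R).
  apply: eem => //; have := invnP pN1; rewrite mulrN1 => h; by rewrite h.
have e2 : gauss (w - 1) = (chi (1 - w))%:~R * gauss (-1).
  rewrite (gauss_twist R Dform Nlevel pN loc hw1) (gauss_twist R Dform Nlevel pN loc pN1).
  rewrite mulrA -rmorphM /= -(qcharM lc).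
  by congr ((chi _)%:~R * _); ring.
rewrite mulrA e1 [RHS]mulrCA mulrA -e2.
rewrite /ghat mulr_suml.
(* [k] is the sum of the two summation variables. For fixed [k] the sum over [x] has parameter w -
   1, a unit, so that [ghat_unit] applies although w itself may be divisible by p. The exponent of
   q(k) becomes -1/(w - 1) - 1 = w/(1 - w) = w'. *)
transitivity (\sum_(x in H) \sum_(k in H) ee ((-1)%:~R * q (k - x) + bil q (k - x) b) * ee (w%:~R * q x + bil q x b)).
  rewrite exchange_big /=.
  under eq_bigr => x _ do rewrite mulr_sumr.
  rewrite exchange_big /= [RHS]exchange_big /=; apply: eq_bigr => x hx.
  rewrite (shift_sum _ (_ : - x \in H)) ?torN //.
rewrite exchange_big /= mulr_sumr; apply: eq_bigr => k hk.
transitivity (ee (bil q k b - q k) * ghat (w - 1) k).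
  rewrite /ghat mulr_sumr; apply: eq_bigr => x hx; rewrite -!eeD; apply: ee_eq.
  have h1 := bilDl Dform (k - x) x b; rewrite subrK in h1.
  have h2 : eqQZ (q (k - x)) (q k + q x - bil q k x).
    rewrite qD; apply: eqQZD; last exact: bilNr.
    by apply: eqQZD; [exact: eqQZ_refl|exact: qN].
  have := eqQZD (eqQZD (eqQZN h2) (eqQZ_sym h1)) (eqQZ_refl (w%:~R * q x)).
  by rewrite (bilC q k x); congr eqQZ; ring.
rewrite ghat_unit // mulrCA; congr (_ * _); rewrite -!eeD; apply: ee_eq.
have h : (- invn (w - 1) - 1 = w' %[mod n])%Z.
  apply: (unit_cancel hw); rewrite ww'.
  have -> : (1 - w) * (- invn (w - 1) - 1) = invn (w - 1) * (w - 1) + (w - 1) by ring.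
  by rewrite -modzDml (invnP hw1) modzDml addrC subrK.
have /eqQZ0 hn := loc_kills Dform Nlevel hk.
move/eqP: h; rewrite eqz_mod_dvd => /dvdzP[l hl].
have -> : bil q k b - q k + (- invn (w - 1))%:~R * q k =
   ((- invn (w - 1) - 1) - w')%:~R * q k + (w'%:~R * q k + bil q k b) by rewrite !rmorphB /=; ring.
rewrite hl -[X in eqQZ _ X]add0r; apply: eqQZD (eqQZ_refl _); apply/eqQZ0.
by rewrite rmorphM /= -mulrA rpredM ?intr_int.
Qed.

(** The two formulas for [v] come from factoring M modulo n. If c is a unit, M is T^(a/c) S times a
    diagonal matrix with first entry c. If p divides c, then a is a unit and M is the lower
    unipotent S T^(-c/a) S^-1 times a diagonal matrix with first entry a. Diagonal matrices act on
    e_0 through chi. The constant [g] is forced by v(0, 1) = S e_0. *)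
Lemma local_weil_vector : weil_vector R q n chi.
Proof.
pose g := (gauss 1)^-1; have G1 := gauss1_neq0; have cH := card_H_neq0.
pose v (a c : int) b : C := if (p %| c)%Z then (chi a)%:~R / #|H|%:R * ghat (- c * invn a) b
  else g * (chi c)%:~R * ee ((a * invn c)%:~R * q b).
have pn x : (n %| x)%Z -> (p %| x)%Z.
  by apply: dvdz_trans; rewrite dvdzE; apply: (dvd_pfactor_level Nlevel pN).
have cop a c : coprimez a c -> (p %| c)%Z -> ~~ (p %| a)%Z.
  move=> co hc; apply/negP => ha; have : (p %| gcdz a c)%Z by rewrite dvdz_gcd ha.
  by move/eqP: co => ->; apply/negP; exact: p_1.
have chiN1 : (chi (-1))%:~R * gauss 1 = gauss (-1).
  by rewrite (gauss_twist R Dform Nlevel pN loc (x := -1)) //; have := p_1; rewrite !dvdzE.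
have v4 a c b : (n %| c)%Z -> b \in H -> v a c b = (chi a)%:~R * (b == 0)%:R.
  move=> hc hb; rewrite /v pn //.
  rewrite (@ghat_mod _ 0) ?ghat0 ?mulrA ?divfK //.
  apply/eqP; rewrite eqz_mod_dvd subr0 dvdz_mulr // dvdzE abszN -dvdzE //.
exists v, g; split=> //.
- by move=> b hb; rewrite v4 ?dvdz0 // (qchar1 pp lc) mul1r.
- move=> a c b co hb; rewrite /v; case: ifP => hc.
    have pa := cop _ _ co hc.
    have ac : (a * (1 - - c * invn a) = a + c %[mod n])%Z.
      have -> : a * (1 - - c * invn a) = a + c * (invn a * a) by ring.
      by rewrite -modzDmr -[((c * _) %% n)%Z]modzMmr (invnP pa) modzMmr modzDmr mulr1.
    have h1 : ~~ (p %| 1 - - c * invn a)%Z.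
      rewrite mulNr opprK rpredDr ?p_1 // dvdz_mulr //.
    have pac : ~~ (p %| a + c)%Z by rewrite rpredDr.
    rewrite [RHS]mulrCA (@ghat_T _ (- c * invn (a + c))) //; last first.
      apply: (unit_cancel pa); rewrite (mulrA a) -modzMml ac modzMml.
      have -> : (a + c) * (- c * invn (a + c)) = - c * (invn (a + c) * (a + c)) by ring.
      have -> : a * (- c * invn a) = - c * (invn a * a) by ring.
      by rewrite -modzMmr (invnP pac) modzMmr -[RHS]modzMmr (invnP pa) modzMmr.
    rewrite mulrA; congr (_ * _); rewrite mulrAC -rmorphM /= -(qcharM lc); congr (_%:~R / _).
    by apply/esym/(qchar_mod lc).
  rewrite [RHS]mulrCA -eeD; congr (_ * _).
  have -> : q b + (a * invn c)%:~R * q b = (1 + a * invn c)%:~R * q b by rewrite rmorphD /=; ring.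
  apply: eem => //; rewrite mulrDl [c * _]mulrC -modzDmr (invnP (negbT hc)) modzDmr.
  by rewrite addrC.
- move=> a c b co hb; have [hc|hc] := boolP (p %| c)%Z.
    have pa := cop _ _ co hc.
    have vE x : v a c x = (chi a)%:~R / #|H|%:R * ghat (- c * invn a) x by rewrite /v hc.
    have -> : v (- c) a b = g * (chi a)%:~R * ee ((- c * invn a)%:~R * q b) by rewrite /v (negPf pa).
    rewrite -mulrA; congr (_ * _).
    under eq_bigr => x _ do rewrite vE mulrCA -[_ / _ * _]mulrA.
    rewrite -mulr_sumr; congr (_ * _).
    (* Fourier inversion, read backwards: by nondegeneracy only y = b survives the sum over x. *)
    transitivity (#|H|%:R^-1 * \sum_(y in H) ee ((- c * invn a)%:~R * q y) * \sum_(x in H) ee (bil q x (y - b))).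
      rewrite (bigD1 b) //= [X in _ * (_ + X)]big1 ?addr0 => [|y /andP[hy yb]].
        by rewrite sum_bil ?torB // subrr eqxx mulr1 mulrCA mulVf ?mulr1.
      by rewrite sum_bil ?torB // subr_eq0 (negPf yb) !mulr0.
    rewrite [LHS]mulr_sumr.
    under [in RHS]eq_bigr => x _ do rewrite /ghat mulrCA mulr_sumr mulr_sumr.
    rewrite exchange_big /=; apply: eq_bigr => y hy; rewrite mulr_sumr mulr_sumr.
    apply: eq_bigr => x hx; rewrite [RHS]mulrCA; congr (_ * _); rewrite -!eeD; apply: ee_eq.
    have := eqQZD (bilDr Dform x y (- b)) (eqQZ_refl ((- c * invn a)%:~R * q y)).
    have h := bilNr Dform x b.
    move=> h1; rewrite addrC; apply: eqQZ_trans h1 _.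
    have := eqQZD (eqQZD (eqQZ_refl (bil q x y)) h) (eqQZ_refl ((- c * invn a)%:~R * q y)).
    by rewrite (bilC q x y); congr eqQZ; ring.
  have vE x : v a c x = g * (chi c)%:~R * ee ((a * invn c)%:~R * q x) by rewrite /v (negPf hc).
  under eq_bigr => x _ do rewrite vE.
  have -> : \sum_(x in H) ee (- bil q x b) * (g * (chi c)%:~R * ee ((a * invn c)%:~R * q x)) =
      g * (chi c)%:~R * ghat (a * invn c) b.
    rewrite -ghatN /ghat mulr_sumr; apply: eq_bigr => x hx; rewrite mulrCA -eeD; congr (_ * _).
    apply: ee_eq; rewrite addrC; apply: eqQZD; first exact: eqQZ_refl.
    exact/eqQZ_sym/bilNr.
  rewrite /v; case: ifP => ha.
    rewrite (@ghat_mod _ (a * invn c)); last first.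
      apply: (unit_cancel hc).
      have pNc : ~~ (p %| - c)%Z by rewrite dvdzE abszN -dvdzE.
      have -> : c * (- a * invn (- c)) = a * (invn (- c) * - c) by ring.
      have -> : c * (a * invn c) = a * (invn c * c) by ring.
      by rewrite -modzMmr (invnP pNc) modzMmr -[RHS]modzMmr (invnP hc) modzMmr.
    rewrite mulrA; congr (_ * _).
    have chiNc : (chi (- c))%:~R = (chi (-1))%:~R * (chi c)%:~R :> C.
      by rewrite -rmorphM /= -(qcharM lc); congr (chi _)%:~R; rewrite mulN1r.
    have c1 : (chi (-1))%:~R * (chi (-1))%:~R = 1 :> C.
      by apply: chi_unit; have := p_1; rewrite !dvdzE.
    rewrite chiNc -gauss_norm -chiN1 /g; move: c1 G1.
    move: (chi (-1))%:~R (chi c)%:~R (gauss 1) => x y z x2 z0.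
    have x0 : x != 0 by apply/eqP => x0; move: x2; rewrite x0 mul0r => /eqP; rewrite eq_sym oner_eq0.
    by field; rewrite x0 z0.
  have {}ha := negbT ha.
  have pac : ~~ (p %| a * invn c)%Z by rewrite pM negb_or ha invn_unit.
  rewrite ghat_unit // (gauss_twist R Dform Nlevel pN loc) // (qcharM lc) (rmorphM _ (chi a)) /=.
  have ee1 : ee ((- c * invn a)%:~R * q b) = ee ((- invn (a * invn c))%:~R * q b).
    apply: eem => //; apply: (unit_cancel pac).
    have -> : a * invn c * (- c * invn a) = - ((invn a * a) * (invn c * c)) by ring.
    have -> : a * invn c * (- invn (a * invn c)) = - (invn (a * invn c) * (a * invn c)) by ring.
    apply: modz_opp.
    by rewrite (invnP pac) -modzMml -[X in (_ * X %% _)%Z]mulr1 (invnP ha) modzMml mul1r mulr1 (invnP hc).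
  rewrite ee1 !mulrA; congr (_ * _).
  have cc : (chi c)%:~R * (chi (invn c))%:~R = 1 :> C.
    by rewrite -rmorphM /= -(qcharM lc) mulrC (qchar_mod lc (invnP hc)) (qchar1 pp lc).
  transitivity (g * (chi a)%:~R * ((chi c)%:~R * (chi (invn c))%:~R) * (g * gauss 1)).
    by rewrite cc /g mulVf // !mulr1.
  ring.
- by move=> a c b _; apply: v4.
Qed.
End Local.
End Weil.

Section WeilProduct.
Variables (R : realType) (D : finZmodType) (q : D -> rat) (Dform : discriminant_form q).

Lemma weil_vector1 : weil_vector R q 1 (fun=> 1).
Proof.
have t1 b : b \in tor D 1 -> b = 0 by move/torP; rewrite mulr1n.
exists (fun _ _ b => (b == 0)%:R), 1; split=> //.
- by move=> a c b _ /t1 ->; rewrite (ee_eq R (q0 Dform)) ee0 mul1r.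
- move=> a c b _ /t1 ->; rewrite mul1r (big_pred1 0) => [|x].
    by rewrite eqxx mulr1 (ee_eq R (eqQZN (bil0l Dform 0))) oppr0 ee0.
  by rewrite !inE mulr1n.
- by move=> a c b _ _ _; rewrite mul1r.
Qed.

(** Components of coprime order are orthogonal, so both e(q) and the Fourier kernel factor; the
    product of two families satisfies the rules with the product of the constants. *)
Lemma weil_vectorM m1 m2 chi1 chi2 : coprime m1 m2 ->
  weil_vector R q m1 chi1 -> weil_vector R q m2 chi2 ->
  weil_vector R q (m1 * m2) (fun x => chi1 x * chi2 x).
Proof.
move=> co [v [g [v1 v2 v3 v4]]] [w [h [w1 w2 w3 w4]]].
have [p1 [p2 [pP pK]]] := @tor_proj D _ _ co.
have p0 b : b \in tor D (m1 * m2) -> (b == 0) = (p1 b == 0) && (p2 b == 0).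
  move=> hb; have [_ _ bE] := pP b hb; apply/eqP/andP => [b0|[/eqP h1 /eqP h2]].
    have [h1 h2] := pK 0 0 (tor0 _ _) (tor0 _ _); rewrite addr0 in h1 h2.
    by rewrite b0 h1 h2.
  by rewrite bE h1 h2 addr0.
have orth y z : y \in tor D m1 -> z \in tor D m2 -> eqQZ (bil q y z) 0.
  exact: bil_coprime.
exists (fun a c b => v a c (p1 b) * w a c (p2 b)), (g * h); split.
- move=> b hb; have [h1 h2 _] := pP b hb; rewrite v1 // w1 // (p0 b) //.
  by case: (p1 b == 0); rewrite /= ?mul1r ?mul0r.
- move=> a c b ac hb; have [h1 h2 bE] := pP b hb.
  have -> : ee R (q b) = ee R (q (p1 b)) * ee R (q (p2 b)).
    rewrite -eeD; apply: ee_eq; rewrite {1}bE qD -[X in eqQZ _ X]addr0.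
    by apply: eqQZD; [exact: eqQZ_refl|exact: orth].
  by rewrite v2 // w2 // mulrACA.
- move=> a c b ac hb; have [h1 h2 bE] := pP b hb.
  rewrite v3 // w3 // mulrACA; congr (_ * _).
  rewrite (tor_sum_split _ co) /= big_distrl /=; apply: eq_bigr => y hy.
  rewrite big_distrr /=; apply: eq_bigr => z hz.
  have [-> ->] := pK y z hy hz; rewrite mulrACA; congr (_ * _).
  rewrite -eeD; apply: ee_eq; rewrite -opprD; apply: eqQZN; apply: eqQZ_sym.
  rewrite {1}bE; apply: eqQZ_trans (bilDl Dform _ _ _) _.
  apply: eqQZ_trans (eqQZD (bilDr Dform _ _ _) (bilDr Dform _ _ _)) _.
  apply: (@eqQZ_trans ((bil q y (p1 b) + 0) + (0 + bil q z (p2 b)))).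
    apply: eqQZD; apply: eqQZD; rewrite ?(bilC q z); try exact: eqQZ_refl; exact: orth.
  by rewrite addr0 add0r; apply: eqQZ_refl.
- move=> a c b ac mc hb; have [h1 h2 bE] := pP b hb.
  rewrite v4 ?w4 ?rmorphM ?(p0 b) //=.
  + by case: (p1 b == 0); rewrite /= ?mul0r ?mulr0 ?mul0r ?mulr1 ?mulrA.
  + by apply: dvdz_trans mc; rewrite PoszM dvdz_mull.
  + by apply: dvdz_trans mc; rewrite PoszM dvdz_mulr.
Qed.

Lemma weil_vector_ext m chi chi' : (forall x, chi x = chi' x) ->
  weil_vector R q m chi -> weil_vector R q m chi'.
Proof.
move=> e [v [g [v1 v2 v3 v4]]]; exists v, g; split=> // a c b ac mc hb.
by rewrite -e v4.
Qed.

Lemma weil_vector_level N delta d2 : is_level q N -> special_shape q delta d2 ->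
  weil_vector R q N (chiD N d2).
Proof.
move=> Nlevel sh; apply: (@hall_ind N (fun m s =>
  weil_vector R q m (fun x => \prod_(p <- s) chi_at d2 p x)) (level_gt0 Nlevel)).
  by apply: weil_vector_ext weil_vector1 => x; rewrite big_nil.
move=> p m s pN _ co _ IH.
apply: (@weil_vector_ext _ (fun x => chi_at d2 p x * \prod_(p' <- s) chi_at d2 p' x)).
  by move=> x; rewrite big_cons.
apply: weil_vectorM co _ IH.
exact: (local_weil_vector R Dform Nlevel pN (local_structure_of_shape Dform sh Nlevel pN)).
Qed.
End WeilProduct.

(** * The Weil representation *)

Section Mat2.
Lemma mat2E (A : Type) (a b c d : A) : [/\ mat2 a b c d 0 0 = a, mat2 a b c d 0 1 = b,
  mat2 a b c d 1 0 = c & mat2 a b c d 1 1 = d].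
Proof. by rewrite /mat2 !mxE. Qed.

Lemma mat2_eta (A : Type) (M : 'M[A]_2) : M = mat2 (M 0 0) (M 0 1) (M 1 0) (M 1 1).
Proof.
apply/matrixP => i j; rewrite mxE.
have ord2 (k : 'I_2) : k = 0 \/ k = 1 by case: k => [[|[]]] //= ?; [left|right]; apply: val_inj.
by case: (ord2 i) => ->; case: (ord2 j) => ->.
Qed.

Lemma mat2_mul (K : comNzRingType) (a b c d a' b' c' d' : K) :
  mat2 a b c d *m mat2 a' b' c' d' =
  mat2 (a * a' + b * c') (a * b' + b * d') (c * a' + d * c') (c * b' + d * d').
Proof.
by rewrite [LHS]mat2_eta !mxE !big_ord_recl !big_ord0 !addr0 !mxE /=.
Qed.

Lemma mat2_det (K : comNzRingType) (a b c d : K) : \det (mat2 a b c d) = a * d - b * c.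
Proof.
rewrite (expand_det_row _ 0) !big_ord_recl big_ord0 /cofactor !det_mx11 !mxE /=.
by rewrite expr0 expr1 mul1r mulN1r mulrN addr0.
Qed.

Lemma mat2_1 (K : comNzRingType) : 1%:M = mat2 1 0 0 1 :> 'M[K]_2.
Proof. by rewrite [LHS]mat2_eta !mxE. Qed.

End Mat2.

Lemma SL2ZE a b c d : SL2Z (mat2 a b c d) <-> a * d - b * c = 1.
Proof. by rewrite /SL2Z mat2_det. Qed.

Lemma SL2Z_mul M M' : SL2Z M -> SL2Z M' -> SL2Z (M *m M').
Proof. by rewrite /SL2Z det_mulmx => -> ->. Qed.

Lemma SL2Z_1 : SL2Z 1%:M. Proof. by rewrite /SL2Z det1. Qed.

Lemma SL2Z_T : SL2Z matT. Proof. by rewrite /matT SL2ZE. Qed.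
Lemma SL2Z_S : SL2Z matS. Proof. by rewrite /matS SL2ZE. Qed.

Definition upT (n : int) : 'M[int]_2 := mat2 1 n 0 1.
Definition loT (n : int) : 'M[int]_2 := mat2 1 0 n 1.
Arguments upT n%_ring_scope.
Arguments loT n%_ring_scope.
Lemma SL2Z_upT n : SL2Z (upT n). Proof. by rewrite /upT SL2ZE; ring. Qed.
Lemma SL2Z_loT n : SL2Z (loT n). Proof. by rewrite /loT SL2ZE; ring. Qed.
#[global] Hint Resolve SL2Z_1 SL2Z_T SL2Z_S SL2Z_upT SL2Z_loT SL2Z_mul : core.
Lemma upTD m n : upT (m + n) = upT m *m upT n.
Proof. by rewrite /upT mat2_mul; congr mat2; ring. Qed.
Lemma upT0 : upT 0 = 1%:M. Proof. by rewrite mat2_1. Qed.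
Lemma upT1 : upT 1 = matT. Proof. by []. Qed.

Lemma SL2Z_inv M : SL2Z M ->
  invmx M = mat2 (M 1 1) (- M 0 1) (- M 1 0) (M 0 0) /\ SL2Z (invmx M).
Proof.
move=> hM; set M' := mat2 _ _ _ _.
have MM' : M *m M' = 1%:M.
  move: hM; rewrite /SL2Z {1}(mat2_eta M) mat2_det => hM.
  rewrite [X in X *m _](mat2_eta M) /M' mat2_mul mat2_1; congr mat2; rewrite -?hM; ring.
have uM : M \in unitmx by rewrite unitmxE hM unitr1.
have -> : invmx M = M' by rewrite -[LHS]mulmx1 -MM' mulKmx.
split=> //; move: hM; rewrite /SL2Z {1}(mat2_eta M) /M' !mat2_det => <-; ring.
Qed.

Lemma SL2Z_unit M : SL2Z M -> M \in unitmx.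
Proof. by move=> hM; rewrite unitmxE hM unitr1. Qed.

(** Generation by S and T, proved by the Euclidean algorithm on the first column. T^-1 needs a
    clause of its own, as [P] is not assumed to be stable under inverses. *)
Lemma SL2Z_ind (P : 'M[int]_2 -> Prop) : P 1%:M ->
  (forall M, SL2Z M -> P M -> P (matT *m M)) ->
  (forall M, SL2Z M -> P M -> P (upT (-1) *m M)) ->
  (forall M, SL2Z M -> P M -> P (matS *m M)) -> forall M, SL2Z M -> P M.
Proof.
move=> P1 PT PT' PS.
have PTn (n : int) M : SL2Z M -> P M -> P (upT n *m M).
  move=> hM pM; elim/int_rec: n => [|n ih|n ih].
  - by rewrite upT0 mul1mx.
  - have -> : n.+1%:Z = 1 + n%:Z by lia.
    rewrite upTD -mulmxA; apply: PT => //.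
    by apply: SL2Z_mul => //; apply: SL2Z_upT.
  - have -> : - n.+1%:Z = -1 + - n%:Z by lia.
    rewrite upTD -mulmxA; apply: PT' => //.
    by apply: SL2Z_mul => //; apply: SL2Z_upT.
move=> M; have [n] := ubnP `|M 1%R 0%R|%N; elim: n M => // n ih M hn hM.
have hd := hM; rewrite (mat2_eta M) SL2ZE in hd.
have [c0|c0] := eqVneq (M 1 0) 0.
  rewrite c0 mulr0 subr0 in hd.
  have ad : (M 0 0 = 1 /\ M 1 1 = 1) \/ (M 0 0 = -1 /\ M 1 1 = -1).
    have /(congr1 absz)/eqP := hd; rewrite abszM muln_eq1 => /andP[/eqP h1 /eqP h2]; lia.
  (* S^2 = -1 accounts for the upper triangular matrices with diagonal -1. *)
  have SS : SL2Z (matS *m (matS *m 1%:M)).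
    exact: (SL2Z_mul SL2Z_S (SL2Z_mul SL2Z_S SL2Z_1)).
  case: ad => -[h1 h2].
    have -> : M = upT (M 0 1) *m 1%:M by rewrite mulmx1 [LHS]mat2_eta h1 h2 c0.
    exact: (PTn _ _ SL2Z_1 P1).
  have -> : M = upT (- M 0 1) *m (matS *m (matS *m 1%:M)).
    by rewrite [LHS]mat2_eta h1 h2 c0 mulmx1 /upT /matS !mat2_mul; congr mat2; ring.
  exact: (PTn _ _ SS (PS _ (SL2Z_mul SL2Z_S SL2Z_1) (PS _ SL2Z_1 P1))).
(* One division step: T^-k replaces a by the remainder r, and S moves r into the lower left corner,
   up to sign. *)
pose k := (M 0%R 0%R %/ M 1%R 0%R)%Z; pose r := (M 0%R 0%R %% M 1%R 0%R)%Z.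
have ak : M 0 0 = k * M 1 0 + r by rewrite /k /r -divz_eq.
have r0 : 0 <= r by rewrite modz_ge0.
have rc : r < `|M 1%R 0%R|%N by rewrite ltz_mod.
pose M'' := mat2 (M 1 0) (M 1 1) (- r) (- (M 0 1 - k * M 1 1)).
have ME : M = upT k *m (matS *m M'').
  by rewrite [LHS]mat2_eta /upT /matS !mat2_mul ak; congr mat2; ring.
have hM'' : SL2Z M'' by rewrite SL2ZE -hd ak; ring.
rewrite ME; apply: PTn; first exact: SL2Z_mul SL2Z_S hM''.
apply: PS => //; apply: ih => //; have [_ _ -> _] := mat2E (M 1 0) (M 1 1) (- r) (- (M 0 1 - k * M 1 1)).
by move: rc hn r0; clear; lia.
Qed.

Lemma SL2Z_coprime M : SL2Z M -> coprimez (M 0 0) (M 1 0).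
Proof.
rewrite (mat2_eta M) SL2ZE => h; have [-> _ -> _] := mat2E (M 0 0) (M 0 1) (M 1 0) (M 1 1).
by apply/coprimezP; exists (M 1 1, - M 0 1); rewrite /= -h; ring.
Qed.

Lemma NqE (D : finZmodType) (q : D -> rat) (N : nat) g : is_level q N ->
  (Nq q N g)%:~R = N%:R * q g.
Proof. by move=> h; rewrite /Nq floorK //; apply/eqQZ0/level_q. Qed.

Section Rho.
Variables (R : realType) (D : finZmodType) (q : D -> rat) (Dform : discriminant_form q).
Variables (delta : nat -> int) (d2 : two_part) (N : nat) (r : int).
Variable rho : 'M[int]_2 -> {linear group_space R D -> group_space R D}.
Hypotheses (Dshape : special_shape q delta d2) (Nlevel : is_level q N).
Hypothesis (rhoWeil : weil_rep q r rho).

Local Notation C := R[i].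
Local Notation ee := (@ee R).
Local Notation e0 := (basis_vec R (0 : D)).

Let N0 := level_gt0 Nlevel.
Let loc p (pN : p \in primes N) := local_structure_of_shape Dform Dshape Nlevel pN.
Let locc p (pN : p \in primes N) := local_char (loc pN).

Definition weil_const : C := 'i%C ^ (- (r %/ 2)%Z) / (Num.sqrt #|D|%:R)%:C%C.

Lemma group_spaceE (x : group_space R D) : x = \sum_g x g *: basis_vec R g.
Proof.
apply/ffunP => b; rewrite sum_ffunE (bigD1 b) //= big1 => [|g gb]; rewrite !ffunE.
  by rewrite eqxx addr0 /GRing.scale /= mulr1.
by rewrite eq_sym (negPf gb) /GRing.scale /= mulr0.
Qed.

Lemma rho1 x : rho 1%:M x = x. Proof. by case: rhoWeil. Qed.
Lemma rhoM M M' x : SL2Z M -> SL2Z M' -> rho (M *m M') x = rho M (rho M' x).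
Proof. by case: rhoWeil => _ h _ _; apply: h. Qed.

Lemma rho_T x b : rho matT x b = ee (q b) * x b.
Proof.
case: rhoWeil => _ _ h _; rewrite {1}(group_spaceE x) linear_sum sum_ffunE (bigD1 b) //= big1.
  by rewrite linearZ /= h !ffunE eqxx addr0 /GRing.scale /= mulr1 mulrC eeE.
move=> g gb; rewrite linearZ /= h !ffunE eq_sym (negPf gb) /GRing.scale /=.
by rewrite !mulr0.
Qed.

Lemma rho_S x b : rho matS x b = weil_const * \sum_g ee (- bil q b g) * x g.
Proof.
case: rhoWeil => _ _ _ h; rewrite {1}(group_spaceE x) linear_sum sum_ffunE mulr_sumr.
apply: eq_bigr => g _; rewrite linearZ /= h !ffunE /GRing.scale /=.
rewrite sum_ffunE (bigD1 b) //= big1 => [|b' bb']; rewrite !ffunE /GRing.scale /=.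
  by rewrite eqxx addr0 mulr1 -eeE mulrCA [x g * _]mulrC.
by rewrite eq_sym (negPf bb') mulr0.
Qed.

Lemma rho_upT n x b : rho (upT n) x b = ee (n%:~R * q b) * x b.
Proof.
elim/int_rec: n x => [|n ih|n ih] x.
- by rewrite upT0 rho1 mul0r ee0 mul1r.
- have -> : n.+1%:Z = 1 + n%:Z by lia.
  rewrite upTD rhoM // upT1 rho_T ih mulrA -eeD; congr (ee _ * _).
  by rewrite rmorphD /= mulrDl mul1r.
- pose y : group_space R D := [ffun g => (ee (q g))^-1 * x g].
  have hy : rho matT y = x.
    by apply/ffunP => g; rewrite rho_T ffunE mulrA divff ?mul1r // ee_neq0.
  have -> : rho (upT (- n.+1%:Z)) x = rho (upT (- n%:Z)) y.
    by rewrite -{1}hy -upT1 -rhoM // -upTD; congr (rho (upT _) y); lia.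
  rewrite ih ffunE mulrA -eeN -eeD; congr (ee _ * _).
  have -> : - n.+1%:Z = - n%:Z - 1 by lia.
  by rewrite rmorphB /= mulrBl mul1r.
Qed.

Lemma card_D : #|D| = N.
Proof. exact: (card_level Dform Nlevel (chi := chi_at d2) (eps := epsilon_at N delta d2) loc). Qed.

Lemma weil_const_neq0 : weil_const != 0.
Proof.
rewrite /weil_const mulf_neq0 //.
  rewrite expfz_neq0 // -normr_eq0; apply/eqP => h.
  have : `|'i%C : C| ^+ 2 = 0 by rewrite h expr0n.
  by rewrite -normrX sqr_i normrN1 => /eqP; rewrite oner_eq0.
by rewrite invr_eq0 eq_complex /= eqxx andbT sqrtr_eq0 -ltNge card_D ltr0n.
Qed.

Lemma e0E b : e0 b = (b == 0)%:R. Proof. by rewrite ffunE. Qed.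

Lemma rho_S_e0 b : rho matS e0 b = weil_const.
Proof.
rewrite rho_S (bigD1 0) //= big1 => [|g gb]; last by rewrite e0E (negPf gb) mulr0.
rewrite e0E eqxx mulr1 addr0 (ee_eq R (eqQZN (bil0r Dform b))) oppr0 ee0 mulr1 //.
Qed.

(** The coordinate at 0 of the relation T S T S = S T^-1 applied to e_0: T fixes both e_0 and the
    value at 0, and one factor [weil_const] cancels. *)
Lemma weil_const_gauss : weil_const * \sum_g ee (q g) = 1.
Proof.
have h : matT *m (matS *m (matT *m matS)) = matS *m upT (-1).
  by rewrite /matT /matS /upT !mat2_mul; congr mat2; ring.
have e b : rho matT (rho matS (rho matT (rho matS e0))) b = rho matS (rho (upT (-1)) e0) b.
  rewrite -(rhoM _ SL2Z_S (SL2Z_upT _)) -h.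
  by rewrite !rhoM //; auto.
have u0 : rho (upT (-1)) e0 = e0.
  apply/ffunP => b; rewrite rho_upT e0E; case: eqP => [->|_]; last by rewrite mulr0.
  by rewrite (ee_eq R (eqQZZ (-1) (q0 Dform))) mulr0 ee0 mul1r.
have := e 0; rewrite u0 rho_S_e0 rho_T (ee_eq R (q0 Dform)) ee0 mul1r rho_S.
under eq_bigr => g _.
  rewrite (ee_eq R (eqQZN (bil0l Dform g))) oppr0 ee0 mul1r rho_T rho_S_e0; over.
rewrite -mulr_suml mulrA -[RHS]mul1r => /(mulIf weil_const_neq0); exact.
Qed.

(** [weil_vector] leaves its constant [g] open. Its rules force g times the global Gauss sum to be
    1, as the same relation does for [weil_const]; so the two constants agree and induction over S
    and T identifies the vectors. *)
Lemma rho_e0_column : exists v : int -> int -> D -> C,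
  (forall M, SL2Z M -> forall b, rho M e0 b = v (M 0 0) (M 1 0) b) /\
  (forall a c b, coprimez a c -> (N %| c)%Z -> v a c b = (chiD N d2 a)%:~R * (b == 0)%:R).
Proof.
have [v [g []]] := weil_vector_level R Dform Nlevel Dshape.
rewrite (tor_level Dform Nlevel) => v1 v2 v3 v4.
have inT (x : D) : x \in [set: D] by rewrite inE.
have {v1} v1 b : v 1 0 b = (b == 0)%:R by exact: v1.
have {v2} v2 a c b : coprimez a c -> v (a + c) c b = ee (q b) * v a c b by move=> h; apply: v2.
have {v3} v3 a c b : coprimez a c -> v (- c) a b = g * \sum_x ee (- bil q x b) * v a c x.
  by move=> h; rewrite v3 //; congr (_ * _); apply: eq_bigl => x; rewrite inE.
exists v; split; last by move=> a c b h1 h2; apply: v4.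
have v01 b : v 0 1 b = g.
  have := v3 1 0 b isT; rewrite oppr0 => ->; rewrite (bigD1 0) //= big1 => [|x xb].
    by rewrite v1 eqxx mulr1 addr0 (ee_eq R (eqQZN (bil0l Dform b))) oppr0 ee0 mulr1.
  by rewrite v1 (negPf xb) mulr0.
(* The columns pass through (0, 1), (1, 1), (-1, 1), (0, 1) under T, S, T. Comparing the values at 0
   and cancelling [g] gives the claim; [g] is nonzero because S leads from (0, -1) back to (1,
   0). *)
have gG : g * \sum_x ee (q x) = 1.
  have g0 : g != 0.
    apply/eqP => g0; have := v3 0 (-1) 0 isT; rewrite opprK g0 mul0r v1 eqxx => /eqP.
    by rewrite oner_eq0.
  have := v2 (-1) 1 0 isT; rewrite addNr v01 (ee_eq R (q0 Dform)) ee0 mul1r.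
  have := v3 1 1 0 isT => ->.
  under eq_bigr => x _.
    rewrite (ee_eq R (eqQZN (bil0r Dform x))) oppr0 ee0 mul1r.
    have := v2 0 1 x isT; rewrite add0r v01 => ->; over.
  rewrite -mulr_suml mulrA -[LHS]mul1r => /esym/(mulIf g0); exact.
have gE : g = weil_const.
  have G0 : \sum_x ee (q x) != 0.
    by apply/eqP => h; move: gG; rewrite h mulr0 => /eqP; rewrite eq_sym oner_eq0.
  by apply: (mulIf G0); rewrite gG weil_const_gauss.
apply: SL2Z_ind => [b|M hM IH b|M hM IH b|M hM IH b].
- by rewrite rho1 e0E !mxE v1.
- rewrite rhoM // rho_T IH -v2 ?SL2Z_coprime // (mat2_eta M) /matT mat2_mul.
  have [-> _ -> _] := mat2E (M 0 0) (M 0 1) (M 1 0) (M 1 1).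
  set X := mat2 _ _ _ _; have [-> _ -> _] := mat2E (1 * M 0 0 + 1 * M 1 0)
    (1 * M 0 1 + 1 * M 1 1) (0 * M 0 0 + 1 * M 1 0) (0 * M 0 1 + 1 * M 1 1).
  by rewrite !mul1r mul0r add0r.
- rewrite rhoM // rho_upT IH.
  have -> : (upT (-1) *m M) 0 0 = M 0 0 - M 1 0.
    by rewrite /upT [in LHS](mat2_eta M) mat2_mul; rewrite !mxE /=; ring.
  have -> : (upT (-1) *m M) 1 0 = M 1 0.
    by rewrite /upT [in LHS](mat2_eta M) mat2_mul; rewrite !mxE /=; ring.
  have co : coprimez (M 0 0 - M 1 0) (M 1 0).
    have /coprimezP[[u w] /= uw] := SL2Z_coprime hM; apply/coprimezP.
    by exists (u, w + u); rewrite /= -uw; ring.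
  have := v2 _ _ b co; rewrite subrK => ->; rewrite rmorphN1 mulN1r eeN mulKf //.
  exact: ee_neq0.
- rewrite rhoM // rho_S.
  have -> : (matS *m M) 0 0 = - M 1 0.
    by rewrite /matS [in LHS](mat2_eta M) mat2_mul; rewrite !mxE /=; ring.
  have -> : (matS *m M) 1 0 = M 0 0.
    by rewrite /matS [in LHS](mat2_eta M) mat2_mul; rewrite !mxE /=; ring.
  rewrite v3 ?SL2Z_coprime // gE; congr (_ * _); apply: eq_bigr => x _.
  by rewrite IH bilC.
Qed.

Lemma rho_Gamma0 M : Gamma0 N M -> rho M e0 = (chiD N d2 (M 0 0))%:~R *: e0.
Proof.
move=> [hM Nc]; have [v [h1 h2]] := rho_e0_column.
apply/ffunP => b; rewrite h1 // h2 ?SL2Z_coprime //.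
by rewrite [RHS]ffunE e0E.
Qed.

(** M^-1 M' lies in Gamma_0(N) with upper left entry 1 modulo N, hence fixes e_0. *)
Lemma rho_level M M' : SL2Z M -> SL2Z M' -> (forall i j, (M i j = M' i j %[mod N])%Z) ->
  rho M' e0 = rho M e0.
Proof.
move=> hM hM' MM'; have [iE hi] := SL2Z_inv hM.
have -> : M' = M *m (invmx M *m M') by rewrite mulKVmx // SL2Z_unit.
have hG : SL2Z (invmx M *m M') by apply: SL2Z_mul.
rewrite rhoM //; congr (rho M _).
have dM := hM; rewrite (mat2_eta M) SL2ZE in dM.
have dv i j : exists k, M' i j = M i j + k * N%:Z.
  have /eqP := MM' i j; rewrite eq_sym eqz_mod_dvd => /dvdzP[k hk].
  by exists k; rewrite -hk addrC subrK.
have [k00 e00] := dv 0 0; have [k10 e10] := dv 1 0.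
have c0 : (N %| (invmx M *m M')%R 1%R 0%R)%Z.
  rewrite iE (mat2_eta M') mat2_mul mxE /=.
  by apply/dvdzP; exists (- M 1 0 * k00 + M 0 0 * k10); rewrite e00 e10; ring.
have a1 : ((invmx M *m M')%R 0%R 0%R = 1 %[mod N])%Z.
  rewrite iE (mat2_eta M') mat2_mul mxE /=.
  apply/eqP; rewrite eqz_mod_dvd; apply/dvdzP; exists (M 1 1 * k00 - M 0 1 * k10).
  by rewrite -dM e00 e10; ring.
rewrite rho_Gamma0; last by split.
by rewrite (chiD_mod locc a1) chiD1 ?scale1r.
Qed.

(** Put x = N/p. As p divides c, T^(x a^2) M and M T^x agree modulo N, and T^x fixes e_0. So e(x a^2
    q(b)) = 1 wherever the coordinate at b is nonzero, and a is prime to p. *)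
Lemma rho_e0_support M b (p : nat) : SL2Z M -> p \in primes N -> (p %| M 1%R 0%R)%Z ->
  rho M e0 b != 0 -> (p %| Nq q N b)%Z.
Proof.
move=> hM pN pc nz; have pp := prime_of_mem pN.
have pdN : (p %| N)%N by move: pN; rewrite mem_primes => /and3P[].
pose x : int := (N %/ p)%N; pose a := M 0 0.
have xp : x * p%:Z = N%:Z by rewrite /x -PoszM divnK.
have dM := hM; rewrite (mat2_eta M) SL2ZE in dM.
have [c' hc] := dvdzP pc.
have h : rho (upT (x * a ^+ 2) *m M) e0 = rho (M *m upT x) e0.
  apply: rho_level; [apply: SL2Z_mul => //; exact: SL2Z_upT|by apply: SL2Z_mul => //; exact: SL2Z_upT|].
  have e1 : M *m upT x = mat2 (M 0 0) (M 0 0 * x + M 0 1) (M 1 0) (M 1 0 * x + M 1 1).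
    by rewrite [in LHS](mat2_eta M) /upT mat2_mul; congr mat2; ring.
  have e2 : upT (x * a ^+ 2) *m M = mat2 (M 0 0 + x * a ^+ 2 * M 1 0) (M 0 1 + x * a ^+ 2 * M 1 1) (M 1 0) (M 1 1).
    by rewrite [in LHS](mat2_eta M) /upT mat2_mul; congr mat2; ring.
  have k1 : (M 0%R 0%R = M 0%R 0%R + x * a ^+ 2 * M 1%R 0%R %[mod N])%Z.
    apply/eqP; rewrite eqz_mod_dvd; apply/dvdzP; exists (- a ^+ 2 * c').
    by rewrite hc -xp; ring.
  have k2 : (M 0%R 0%R * x + M 0%R 1%R = M 0%R 1%R + x * a ^+ 2 * M 1%R 1%R %[mod N])%Z.
    apply/eqP; rewrite eqz_mod_dvd; apply/dvdzP; exists (- a * M 0 1 * c').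
    transitivity (- a * x * (a * M 1 1 - 1)); first by rewrite /a; ring.
    have -> : a * M 1 1 - 1 = M 0 1 * M 1 0 by rewrite -dM /a; ring.
    by rewrite hc -xp; ring.
  have k3 : (M 1%R 0%R * x + M 1%R 1%R = M 1%R 1%R %[mod N])%Z.
    apply/eqP; rewrite eqz_mod_dvd; apply/dvdzP; exists c'.
    by rewrite hc -xp; ring.
  rewrite e1 e2 => i j; rewrite !mxE.
  by case: ifP => _; case: ifP => _.
have := congr1 (fun F : group_space R D => F b) h.
have u0 : rho (upT x) e0 = e0.
  apply/ffunP => g; rewrite rho_upT e0E; case: eqP => [->|_]; last by rewrite mulr0.
  by rewrite (ee_eq R (eqQZZ x (q0 Dform))) mulr0 ee0 mul1r.
rewrite !rhoM // u0 rho_upT -[RHS]mul1r => /(mulIf nz)/ee_eq1/intrP[m hm].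
have pa : ~~ (p %| a)%Z.
  apply/negP => pa; have : (p %| gcdz (M 0%R 0%R) (M 1%R 0%R))%Z by rewrite dvdz_gcd pa pc.
  have /eqP := SL2Z_coprime hM => ->; rewrite dvdz1 /=; have := prime_gt1 pp; lia.
have : (Nq q N b)%:~R * (a ^+ 2)%:~R = (m * p%:Z)%:~R :> rat.
  rewrite (NqE b Nlevel) (rmorphM _ m) /= -hm -[N%:R]/(N%:Z%:~R) -xp.
  by rewrite (rmorphM _ x p%:Z) (rmorphM _ x (a ^+ 2)) /=; ring.
rewrite -rmorphM => /intr_inj e.
have : (p %| Nq q N b * a ^+ 2)%Z by rewrite e dvdz_mull.
rewrite !dvdzE abszM abszX Euclid_dvdM // Euclid_dvdX // andbT.
by rewrite -!dvdzE (negPf pa) orbF.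
Qed.

Lemma rho_e0_aut M (s : {perm D}) b : SL2Z M -> form_automorphism q s ->
  rho M e0 (s b) = rho M e0 b.
Proof.
move=> hM [sD sq]; move: M hM b; have s0 : s 0 = 0.
  by apply: (addrI (s 0)); rewrite -sD !addr0.
have sbil x y : eqQZ (bil q (s x) (s y)) (bil q x y).
  by rewrite /bil -sD; apply: eqQZB => //; apply: eqQZB.
apply: SL2Z_ind => [b|M hM IH b|M hM IH b|M hM IH b].
- rewrite !rho1 !e0E -{1}s0 (inj_eq perm_inj) //.
- by rewrite rhoM // !rho_T IH (ee_eq R (sq b)).
- rewrite rhoM // !rho_upT IH; congr (_ * _); apply: ee_eq.
  exact: eqQZZ.
- rewrite rhoM // !rho_S; congr (_ * _).
  rewrite (reindex_inj (@perm_inj _ s)) /=; apply: eq_bigr => g _.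
  by rewrite IH (ee_eq R (eqQZN (sbil b g))).
Qed.

(* The anti-automorphism [(a, b; c, d) -> (d, b; c, a)] fixes [S] and [T], whose
   matrices are symmetric. *)
Definition flip (M : 'M[int]_2) : 'M[int]_2 := mat2 (M 1 1) (M 0 1) (M 1 0) (M 0 0).

Lemma SL2Z_flip M : SL2Z M -> SL2Z (flip M).
Proof. by rewrite {1}(mat2_eta M) !SL2ZE => <-; ring. Qed.

Lemma flipM M M' : flip (M *m M') = flip M' *m flip M.
Proof.
rewrite /flip mat2_mul; move: (mat2_eta M) (mat2_eta M') => h h'.
rewrite [in LHS]h [in LHS]h' mat2_mul !mxE /=; congr mat2; ring.
Qed.

Lemma rho_flip M (x y : group_space R D) : SL2Z M ->
  \sum_b rho M x b * y b = \sum_b x b * rho (flip M) y b.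
Proof.
move=> hM; move: M hM x y; apply: SL2Z_ind => [x y|M hM IH x y|M hM IH x y|M hM IH x y].
- have -> : flip 1%:M = 1%:M by rewrite /flip mat2_1; congr mat2; rewrite mxE.
  by rewrite !rho1.
- have fT : flip matT = matT by rewrite /flip /matT; congr mat2; rewrite mxE.
  rewrite flipM fT !rhoM //; last exact: SL2Z_flip.
  rewrite -(IH x (rho matT y)); apply: eq_bigr => b _.
  by rewrite !rho_T mulrCA mulrA.
- have fT : flip (upT (-1)) = upT (-1) by rewrite /flip /upT; congr mat2; rewrite mxE.
  rewrite flipM fT !rhoM //; last exact: SL2Z_flip.
  rewrite -(IH x (rho (upT (-1)) y)); apply: eq_bigr => b _.
  by rewrite !rho_upT mulrCA mulrA.
- have fS : flip matS = matS by rewrite /flip /matS; congr mat2; rewrite mxE.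
  rewrite flipM fS !rhoM //; last exact: SL2Z_flip.
  rewrite -(IH x (rho matS y)).
  under eq_bigr => b _ do rewrite rho_S mulrAC mulr_sumr.
  under [RHS]eq_bigr => b _ do rewrite rho_S mulrCA mulrA mulr_sumr.
  rewrite exchange_big /=; apply: eq_bigr => b _; apply: eq_bigr => g _.
  by rewrite bilC; ring.
Qed.

(** The coordinate at 0 is the pairing with e_0. By [rho_flip] the matrix moves to the other side of
    the pairing as [flip M], which lies again in Gamma_0(N) and acts on e_0 by a scalar. *)
Lemma rho_Gamma0_at0 M (x : group_space R D) : Gamma0 N M ->
  rho M x 0 = (chiD N d2 (M 1 1))%:~R * x 0.
Proof.
move=> [hM Nc]; have d0 y : (y : group_space R D) 0 = \sum_b y b * e0 b.
  rewrite (bigD1 0) //= big1 => [|b b0]; first by rewrite e0E eqxx mulr1 addr0.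
  by rewrite e0E (negPf b0) mulr0.
transitivity (\sum_b rho M x b * e0 b); first exact: d0.
rewrite (rho_flip x e0 hM) rho_Gamma0; last first.
  by split; [exact: SL2Z_flip|rewrite /flip mxE].
have -> : flip M 0 0 = M 1 1 by rewrite mxE.
rewrite (d0 x) mulr_sumr; apply: eq_bigr => b _.
by rewrite [in LHS]ffunE /GRing.scale /= mulrCA.
Qed.

End Rho.

(** * Eigenvectors of Gamma^0(N) without components prime to N *)

Definition Gamma_upper0 (N : nat) (M : 'M[int]_2) : Prop := SL2Z M /\ (N %| M 0%R 1%R)%Z.

Definition eqmx_mod (N : int) (M M' : 'M[int]_2) : Prop :=
  forall i j, (M i j = M' i j %[mod N])%Z.

Lemma eqmx_mod_mat2 (N : int) a b c d a' b' c' d' :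
  (N %| a - a')%Z -> (N %| b - b')%Z -> (N %| c - c')%Z -> (N %| d - d')%Z ->
  eqmx_mod N (mat2 a b c d) (mat2 a' b' c' d').
Proof.
move=> h1 h2 h3 h4 i j; apply/eqP; rewrite eqz_mod_dvd !mxE.
by case: ifP => _; case: ifP => _.
Qed.

Section Action.
Variables (R : realType) (X : lmodType R[i]) (act : 'M[int]_2 -> X -> X).
Hypothesis act1 : forall x, act 1%:M x = x.
Hypothesis actM : forall M M' x, SL2Z M -> SL2Z M' -> act (M *m M') x = act M' (act M x).
Hypothesis act_lin : forall M (c : R[i]) x y, SL2Z M -> act M (c *: x + y) = c *: act M x + act M y.

Lemma act0 M : SL2Z M -> act M 0 = 0.
Proof.
move=> hM; have := act_lin 1 0 0 hM; rewrite !scale1r addr0 => /eqP.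
by rewrite -subr_eq subrr eq_sym => /eqP.
Qed.
Lemma actD M x y : SL2Z M -> act M (x + y) = act M x + act M y.
Proof. by move=> hM; have := act_lin 1 x y hM; rewrite !scale1r. Qed.
Lemma actZ M (c : R[i]) x : SL2Z M -> act M (c *: x) = c *: act M x.
Proof. by move=> hM; have := act_lin c x 0 hM; rewrite !addr0 act0 // addr0. Qed.
Lemma actN M x : SL2Z M -> act M (- x) = - act M x.
Proof. by move=> hM; rewrite -scaleN1r actZ // scaleN1r. Qed.
Lemma act_sum M (I : finType) (F : I -> X) : SL2Z M ->
  act M (\sum_i F i) = \sum_i act M (F i).
Proof.
move=> hM; elim/big_rec2: _ => [|i x y _ <-]; first exact: act0.
exact: actD.
Qed.

Variables (N : nat) (N0 : (0 < N)%N) (d2 : two_part).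
Hypothesis (loc : forall p, p \in primes N -> quadratic_char p N`_p (chi_at d2 p)).
Local Notation chi := (chiD N d2).
Local Notation ee := (@ee R).

Definition level_vector (x : X) := forall M M', SL2Z M -> SL2Z M' -> eqmx_mod N M M' ->
  act M x = act M' x.

Lemma level_vectorB x y : level_vector x -> level_vector y -> level_vector (x - y).
Proof. by move=> hx hy M M' h h' e; rewrite !actD // !actN // (hx M M') // (hy M M'). Qed.
Lemma level_vectorZ c x : level_vector x -> level_vector (c *: x).
Proof. by move=> hx M M' h h' e; rewrite !actZ // (hx M M'). Qed.
Lemma level_vector_sum (I : finType) (F : I -> X) :
  (forall i, level_vector (F i)) -> level_vector (\sum_i F i).
Proof.
move=> hF M M' h h' e; rewrite !act_sum //; apply: eq_bigr => i _; exact: hF.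
Qed.

Lemma eqmx_mod_mul K M M' : eqmx_mod N M M' -> eqmx_mod N (K *m M) (K *m M').
Proof.
move=> e i j; apply/eqP; rewrite eqz_mod_dvd !mxE -sumrB; apply: rpred_sum => l _.
by rewrite -mulrBr dvdz_mull // -eqz_mod_dvd; apply/eqP.
Qed.

Lemma level_vector_act K x : SL2Z K -> level_vector x -> level_vector (act K x).
Proof.
move=> hK hx M M' h h' e; rewrite -!actM //; apply: hx; try exact: SL2Z_mul.
exact: eqmx_mod_mul.
Qed.

Variable y : X.
Hypothesis (yG : forall M, Gamma_upper0 N M -> act M y = (chi (M 1%R 1%R))%:~R *: y).

Lemma level_vector_y : level_vector y.
Proof.
move=> M M' hM hM' e; have [iE hi] := SL2Z_inv hM'.
have -> : M = (M *m invmx M') *m M' by rewrite mulmxKV // SL2Z_unit.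
have hG : SL2Z (M *m invmx M') by exact: SL2Z_mul.
have dM := hM'; rewrite (mat2_eta M') SL2ZE in dM.
have dv i j : exists k, M i j = M' i j + k * N%:Z.
  have /eqP := e i j; rewrite eqz_mod_dvd => /dvdzP[k hk].
  by exists k; rewrite -hk addrC subrK.
have [k00 e00] := dv 0 0; have [k01 e01] := dv 0 1.
have [k10 e10] := dv 1 0; have [k11 e11] := dv 1 1.
rewrite actM // yG; last first.
  split=> //; rewrite iE (mat2_eta M) mat2_mul !mxE /=.
  by apply/dvdzP; exists (k01 * M' 0 0 - k00 * M' 0 1); rewrite e00 e01; ring.
have -> : chi ((M *m invmx M') 1%R 1%R) = 1.
  rewrite -(chiD1 loc); apply: (chiD_mod loc); apply/eqP; rewrite eqz_mod_dvd.
  rewrite iE (mat2_eta M) mat2_mul !mxE /=.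
  apply/dvdzP; exists (k11 * M' 0 0 - k10 * M' 0 1).
  by rewrite -dM e10 e11; ring.
by rewrite scale1r.
Qed.

(** The average over the powers of T^(N/p) projects level vectors to the invariants of T^(N/p), that
    is to the exponents divisible by p; the sieve removes them. *)
Definition sieve (p : nat) (x : X) : X :=
  x - p%:R^-1 *: \sum_(i < p) act (upT (i%:Z * (N %/ p)%N%:Z)) x.

(** The invariant of the iteration, after the primes in [ps] have been sieved. The matrices [K]
    generate only the p-part of Gamma^0(N) modulo N; on this part the eigenproperty is not destroyed
    by sieves at other primes. *)
Definition commuting (ps : seq nat) (z : X) := level_vector z /\
  forall p K, p \in primes N -> p \notin ps -> Gamma_upper0 N K ->
    eqmx_mod (N %/ N`_p)%N K 1%:M -> act K z = (chi (K 1%R 1%R))%:~R *: z.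

Lemma pfactor_split p p' : p \in primes N -> p' \in primes N -> p != p' ->
  (N`_p %| N %/ p')%N.
Proof.
move=> pN pN' ne; have pp := prime_of_mem pN; have pp' := prime_of_mem pN'.
have pd : (p' %| N)%N by move: pN'; rewrite mem_primes => /and3P[].
have : (N`_p %| p' * (N %/ p'))%N by rewrite mulnC divnK // dvdn_part.
rewrite Gauss_dvdr // p_part coprimeXl // prime_coprime // dvdn_prime2 //.
Qed.

(** K is 1 modulo N/N_p and the shift N/p' is divisible by N_p, so K and T^(N/p') commute modulo N;
    on a level vector this is enough. *)
Lemma sieve_commuting p' ps z : p' \in primes N -> commuting ps z ->
  commuting (p' :: ps) (sieve p' z).
Proof.
move=> pN' [lz cz]; split.
  apply: level_vectorB => //; apply: level_vectorZ; apply: level_vector_sum => i.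
  exact: level_vector_act.
move=> p K pN; rewrite inE negb_or => /andP[ne pn] hK K1; have [sK _] := hK.
rewrite /sieve actD // actN // actZ // act_sum // (cz p K) // scalerBr; congr (_ - _).
rewrite [RHS]scalerA [X in _ = X *: _]mulrC -[RHS]scalerA; congr (_ *: _); rewrite scaler_sumr; apply: eq_bigr => i _.
rewrite -(actZ _ _ (SL2Z_upT _)) -(cz p K) // -!actM //.
apply: lz; try exact: SL2Z_mul.
set s := i%:Z * _.
have sP : ((N`_p)%N %| s)%Z.
  by rewrite dvdz_mull // dvdzE; exact: pfactor_split.
have NE : N%:Z = (N`_p)%N%:Z * (N %/ N`_p)%N%:Z.
  by rewrite -PoszM mulnC divnK // dvdn_part.
have dK i' j' : ((N %/ N`_p)%N %| K i' j' - (i' == j')%:R)%Z.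
  by rewrite -eqz_mod_dvd; have := K1 i' j'; rewrite !mxE => ->.
have dm u v : ((N`_p)%N %| u)%Z -> ((N %/ N`_p)%N %| v)%Z -> (N %| u * v)%Z.
  by move=> hu hv; rewrite NE dvdz_mul.
have d00 := dK 0 0; have d11 := dK 1 1; have d10 := dK 1 0; rewrite /= in d00 d11 d10.
rewrite subr0 in d10.
rewrite (mat2_eta K) /upT !mat2_mul; apply: eqmx_mod_mat2.
- have -> : 1 * K 0 0 + s * K 1 0 - (K 0 0 * 1 + K 0 1 * 0) = s * K 1 0 by ring.
  exact: dm.
- have -> : 1 * K 0 1 + s * K 1 1 - (K 0 0 * s + K 0 1 * 1) =
    s * ((K 1 1 - 1) - (K 0 0 - 1)) by ring.
  by apply: dm => //; rewrite rpredB.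
- have -> : 0 * K 0 0 + 1 * K 1 0 - (K 1 0 * 1 + K 1 1 * 0) = 0 by ring.
  exact: dvdz0.
- have -> : 0 * K 0 1 + 1 * K 1 1 - (K 1 0 * s + K 1 1 * 1) = - (s * K 1 0) by ring.
  by rewrite rpredN; apply: dm.
Qed.

(* [z] is fixed by T^(N/p) and by lower unipotents; for suitable ones the product
   T^s L^x T^s' lies in Gamma^0(N) and has character -1, because chi is primitive. *)
Lemma sieve_inj p ps z : p \in primes N -> p \notin ps -> commuting ps z ->
  sieve p z = 0 -> z = 0.
Proof.
move=> pN pn [lz cz] sz; have pp := prime_of_mem pN.
have pd : (p %| N)%N by move: pN; rewrite mem_primes => /and3P[].
have [s sE] : exists s : int, s = (N %/ p)%N%:Z by exists (N %/ p)%N%:Z.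
have sp : s * p%:Z = N%:Z by rewrite sE -PoszM divnK.
have p0 : (0 < p)%N by exact: prime_gt0.
have Tmod (m n : int) : (N %| m - n)%Z -> act (upT m) z = act (upT n) z.
  by move=> mn; apply: lz => //; apply: eqmx_mod_mat2; rewrite ?subrr ?dvdz0.
(* A vector killed by the sieve equals its average over a cyclic group of translations. *)
have Ts : act (upT s) z = z.
  have zE : z = p%:R^-1 *: \sum_(i < p) act (upT (i%:Z * s)) z.
    by apply/eqP; rewrite -subr_eq0 sE; apply/eqP.
  rewrite {1}zE actZ // act_sum // [RHS]zE; congr (_ *: _).
  case: p p0 sp {pN pp pd pn sz sE zE} => // p' _ sp.
  rewrite [RHS]big_ord_recl big_ord_recr /= addrC; congr (_ + _).
    rewrite -actM // -upTD; apply: Tmod.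
    have -> : p'%:Z * s + s - 0%:Z * s = s * p'.+1%:Z by rewrite -addn1 PoszD; ring.
    by rewrite sp dvdzz.
  apply: eq_bigr => i _; rewrite -actM // -upTD; apply: Tmod.
  have -> : (bump 0 i)%:Z = i%:Z + 1 by rewrite /bump /=; lia.
  have -> : i%:Z * s + s - (i%:Z + 1) * s = 0 by ring.
  exact: dvdz0.
have Tns (n : nat) : act (upT (n%:Z * s)) z = z.
  elim: n => [|n ih]; first by rewrite mul0r upT0 act1.
  have -> : n.+1%:Z * s = n%:Z * s + s by rewrite -addn1 PoszD; ring.
  by rewrite upTD actM // ih Ts.
have Tzs (n : int) : act (upT (n * s)) z = z.
  have [i _ ni] := modz_lt n p0; rewrite -[RHS](Tns i); apply: Tmod.
  rewrite -mulrBl -sp mulrC dvdz_mul // -eqz_mod_dvd; exact/eqP.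
have [x [dx chx]] := chiD_primitive N0 loc pN.
rewrite -sE in chx.
have NE : N%:Z = (N`_p)%N%:Z * (N %/ N`_p)%N%:Z.
  by rewrite -PoszM mulnC divnK // dvdn_part.
have pa : ~~ (p %| 1 + s * x)%Z.
  apply/negP => pa; move: chx; rewrite /chiD (bigD1_seq p) ?primes_uniq //=.
  have /eqP -> : chi_at d2 p (1 + s * x) == 0 by rewrite (qchar_eq0 (loc pN)).
  by rewrite mul0r.
have /coprimezP[[a' w] /= a'w] : coprimez (1 + s * x) p.
  by rewrite coprimezE coprime_sym /= prime_coprime // -dvdzE.
(* With a' inverse to 1 + s x modulo p, the upper right entry (1 + s x) s' + s is s (1 - a' (1 + s
   x)), a multiple of s p = N. *)
pose s' := (- a') * s; pose K := upT s *m loT x *m upT s'.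
have KE : K = mat2 (1 + s * x) ((1 + s * x) * s' + s) x (x * s' + 1).
  by rewrite /K /upT /loT !mat2_mul; congr mat2; ring.
have N01 : (N %| (1 + s * x) * s' + s)%Z.
  have -> : (1 + s * x) * s' + s = s * (1 - a' * (1 + s * x)) by rewrite /s'; ring.
  have -> : 1 - a' * (1 + s * x) = w * p%:Z by rewrite -[X in X - _ = _]a'w addrAC subrr add0r.
  by rewrite mulrCA sp dvdz_mull.
have sK : SL2Z K by apply: SL2Z_mul => //; apply: SL2Z_mul.
have kE := mat2E (1 + s * x) ((1 + s * x) * s' + s) x (x * s' + 1).
have hK : Gamma_upper0 N K by split=> //; rewrite KE; case: kE => _ -> _ _.
have loz : act (loT x) z = z.
  have gl : Gamma_upper0 N (loT x) by split=> //; rewrite /loT mxE /=; apply: dvdz0.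
  rewrite (cz p (loT x)) //; last first.
    by rewrite mat2_1 /loT; apply: eqmx_mod_mat2; rewrite ?subrr ?dvdz0 ?subr0.
  by rewrite /loT mxE /= (chiD1 loc) scale1r.
have Kz : act K z = z by rewrite /K !actM // ?Ts ?loz ?Tzs //; apply: SL2Z_mul.
have K1 : eqmx_mod (N %/ N`_p)%N K 1%:M.
  rewrite KE mat2_1; apply: eqmx_mod_mat2.
  - by rewrite addrC addKr dvdz_mull.
  - by rewrite subr0; apply: dvdz_trans N01; rewrite NE dvdz_mull.
  - by rewrite subr0.
  - by rewrite addrK dvdz_mulr.
have := cz p K pN pn hK K1; rewrite Kz KE; case: kE => _ _ _ ->.
have -> : chi (x * s' + 1) = -1.
  have ad : ((1 + s * x) * (x * s' + 1) = 1 %[mod N])%Z.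
    have dK := sK; rewrite KE SL2ZE in dK.
    apply/eqP; rewrite eqz_mod_dvd -[X in _ - X]dK opprB addrC subrK.
    by apply: dvdz_mulr.
  by have [<- _] := chiD_inv N0 loc ad.
rewrite rmorphN1 scaleN1r => /eqP; rewrite -subr_eq0 opprK -mulr2n -scaler_nat scaler_eq0.
by rewrite pnatr_eq0 => /eqP.
Qed.

(** The projector to the eigenvalue e(j/N) of T when T^N acts trivially. On Fourier expansions in
    q^(1/N) it keeps the exponents congruent to j, but it makes sense for any action. *)
Definition t_component (j : int) (x : X) : X :=
  N%:R^-1 *: \sum_(i < N) ee (- (i%:R * (j%:~R / N%:R))) *: act (upT i%:Z) x.

Let Nn : N%:R != 0 :> R[i]. Proof. by rewrite pnatr_eq0 -lt0n. Qed.

Lemma t_component_sum x : act (upT N%:Z) x = x -> \sum_(j < N) t_component j%:Z x = x.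
Proof.
move=> xN; rewrite /t_component -scaler_sumr exchange_big /=.
rewrite (bigD1 (Ordinal N0)) //= [X in _ + X]big1 ?addr0.
  under eq_bigr => j _ do rewrite mul0r oppr0 ee0 scale1r upT0 act1.
  by rewrite sumr_const card_ord -[x *+ N]scaler_nat scalerA mulVf // scale1r.
move=> i i0; rewrite -scaler_suml.
have -> : \sum_(j < N) ee (- (i%:R * (j%:Z%:~R / N%:R))) = \sum_(j < N) ee (j%:R * ((- i%:Z)%:~R / N%:R)).
  by apply: eq_bigr => j _; congr ee; rewrite rmorphN /= mulNr mulrN !mulrA [i%:R * _]mulrC.
rewrite (sum_ee _ (- i%:Z) N0) ifF ?scale0r //; apply/negP; rewrite rpredN dvdzE /= => /dvdn_leq.
have i00 : (0 < i)%N by rewrite lt0n; apply: contraNneq i0 => h; apply/eqP/val_inj.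
by move=> /(_ i00); rewrite leqNgt ltn_ord.
Qed.

Lemma act_t_component (s j : int) x : act (upT N%:Z) x = x ->
  act (upT s) (t_component j x) = ee (s%:~R * (j%:~R / N%:R)) *: t_component j x.
Proof.
move=> xN; have xNn (n : nat) : act (upT (n%:Z * N%:Z)) x = x.
  elim: n => [|n ih]; first by rewrite mul0r upT0 act1.
  have -> : n.+1%:Z * N%:Z = n%:Z * N%:Z + N%:Z by rewrite -addn1 PoszD; ring.
  by rewrite upTD actM // ih xN.
have xNz (n : int) : act (upT (n * N%:Z)) x = x.
  case: n => n //; rewrite NegzE -[x in LHS](xNn n.+1) -actM // -upTD.
  by rewrite -mulrDl subrr mul0r upT0 act1.
have xmod (m n : int) : (m = n %[mod N])%Z -> act (upT m) x = act (upT n) x.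
  move=> /eqP; rewrite eqz_mod_dvd => /dvdzP[l hl].
  by rewrite -[m](subrK n) hl upTD actM // xNz.
rewrite /t_component actZ // act_sum // [RHS]scalerA [X in _ = X *: _]mulrC -[RHS]scalerA; congr (_ *: _).
rewrite scaler_sumr.
pose g (i : int) := ee (- (i%:~R * (j%:~R / N%:R))) *: act (upT i) x.
have gmod m n : (m = n %[mod N])%Z -> g m = g n.
  move=> mn; rewrite /g (xmod m n mn); congr (_ *: _); apply: ee_eq; apply: eqQZN.
  rewrite /eqQZ -mulrBl -rmorphB /= mulrA -rmorphM divz_int // dvdz_mulr // -eqz_mod_dvd.
  exact/eqP.
transitivity (\sum_(i < N) ee (s%:~R * (j%:~R / N%:R)) *: g (i%:Z + s)).
  apply: eq_bigr => i _; rewrite actZ // -actM // -upTD scalerA -eeD; congr (ee _ *: _).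
  by rewrite rmorphD /=; ring.
rewrite -!scaler_sumr; congr (_ *: _).
have shift1 (m : int) : \sum_(i < N) g (i%:Z + m + 1) = \sum_(i < N) g (i%:Z + m).
  case: N N0 gmod => // n _ gmod'; rewrite big_ord_recr [RHS]big_ord_recl /= addrC.
  congr (_ + _); first by apply: gmod'; apply/eqP; rewrite eqz_mod_dvd; apply/dvdzP; exists 1; lia.
  by apply: eq_bigr => i _; congr g; rewrite /bump /=; lia.
have shift (m : int) : \sum_(i < N) g (i%:Z + m) = \sum_(i < N) g i%:Z.
  elim/int_rec: m => [|m ih|m ih].
  - by apply: eq_bigr => i _; rewrite addr0.
  - by rewrite -ih -(shift1 m%:Z); apply: eq_bigr => i _; congr g; lia.
  - by rewrite -ih -(shift1 (- m.+1%:Z)); apply: eq_bigr => i _; congr g; lia.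
exact: shift.
Qed.

Lemma sieve_t_component p (j : int) x : p \in primes N -> act (upT N%:Z) x = x ->
  sieve p (t_component j x) = if (p %| j)%Z then 0 else t_component j x.
Proof.
move=> pN xN; have p0 : (0 < p)%N by exact/prime_gt0/(prime_of_mem pN).
have pd : (p %| N)%N by move: pN; rewrite mem_primes => /and3P[].
have pn : p%:R != 0 :> R[i] by rewrite pnatr_eq0 -lt0n.
rewrite /sieve.
under eq_bigr => i _ do rewrite act_t_component //.
rewrite -scaler_suml.
have -> : \sum_(i < p) ee ((i%:Z * (N %/ p)%N%:Z)%:~R * (j%:~R / N%:R)) =
    \sum_(i < p) ee (i%:R * (j%:~R / p%:R)).
  apply: eq_bigr => i _; congr ee; rewrite rmorphM /= -mulrA; congr (_ * _).
  have -> : N%:R = (N %/ p)%N%:R * p%:R :> rat by rewrite -natrM divnK.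
  have h1 : (N %/ p)%N%:R != 0 :> rat by rewrite pnatr_eq0 -lt0n divn_gt0 // dvdn_leq.
  have h2 : p%:R != 0 :> rat by rewrite pnatr_eq0 -lt0n.
  by rewrite -[((N %/ p)%N%:Z)%:~R]/((N %/ p)%N%:R); field; rewrite h1 h2.
rewrite (sum_ee _ j p0) scalerA; case: ifP => _.
  by rewrite mulVf // scale1r subrr.
by rewrite mulr0 scale0r subr0.
Qed.

(** Each component whose index shares a prime with N is killed by the sieve at that prime, and
    sieves act on components by 0 or 1, so the iterated sieve kills y. The injectivity of the sieves
    is then used one prime at a time, on the partially sieved vectors. *)
Theorem eq0_of_coprime_components :
  (forall j : int, coprimez j N -> t_component j y = 0) -> y = 0.
Proof.
move=> hy.
have yN : act (upT N%:Z) y = y.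
  rewrite yG ?mxE /= ?(chiD1 loc) ?scale1r //; split=> //.
  by rewrite /upT mxE /= dvdzz.
suff main : foldr sieve y (primes N) = 0.
  have h ps : {subset ps <= primes N} -> uniq ps -> commuting ps (foldr sieve y ps) /\
      (foldr sieve y ps = 0 -> y = 0).
    elim: ps => [|p ps ih] sub /=.
      by move=> _; split=> //; split=> [|p K _ _ hK _]; [exact: level_vector_y|exact: yG].
    move=> /andP[pn us]; have pN : p \in primes N by apply: sub; rewrite inE eqxx.
    have [c h] := ih (fun p' hp => sub p' (mem_behead (s := p :: ps) hp)) us.
    split; first exact: sieve_commuting.
    by move=> s0; apply: h; apply: sieve_inj pN pn c s0.
  by have [_] := h (primes N) (fun _ => id) (primes_uniq N); apply.
have sieveD p u v : sieve p (u + v) = sieve p u + sieve p v.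
  rewrite /sieve.
  under eq_bigr => i _ do rewrite actD //.
  by rewrite big_split /= scalerDr opprD addrACA.
have sieve0 p : sieve p 0 = 0.
  rewrite /sieve sub0r big1 ?scaler0 ?oppr0 // => i _; exact: act0.
have fD ps u v : foldr sieve (u + v) ps = foldr sieve u ps + foldr sieve v ps.
  by elim: ps => //= p ps ->; rewrite sieveD.
have f0 ps : foldr sieve 0 ps = 0 by elim: ps => //= p ps ->; rewrite sieve0.
have fs ps (F : 'I_N -> X) : foldr sieve (\sum_i F i) ps = \sum_i foldr sieve (F i) ps.
  elim/big_rec2: _ => [|i u v _ <-]; first exact: f0.
  exact: fD.
rewrite -(t_component_sum yN) fs big1 // => j _.
have [co|nco] := boolP (coprimez j%:Z N); first by rewrite hy // f0.
have [p pN pj] : exists2 p, p \in primes N & (p %| j%:Z)%Z.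
  have g1 : (1 < gcdn j N)%N.
    move: nco; rewrite coprimezE /= /coprime.
    have : (0 < gcdn j N)%N by rewrite gcdn_gt0 N0 orbT.
    by case: (gcdn j N) => [|[]].
  exists (pdiv (gcdn j N)).
    rewrite mem_primes pdiv_prime // N0 /=; apply: dvdn_trans (pdiv_dvd _) (dvdn_gcdr _ _).
  by rewrite dvdzE /=; apply: dvdn_trans (pdiv_dvd _) (dvdn_gcdl _ _).
have key ps : {subset ps <= primes N} ->
    (foldr sieve (t_component j%:Z y) ps = 0 \/
     foldr sieve (t_component j%:Z y) ps = t_component j%:Z y) /\
    (p \in ps -> foldr sieve (t_component j%:Z y) ps = 0).
  elim: ps => [|p' ps ih] sub /=; first by split=> //; right.
  have pN' : p' \in primes N by apply: sub; rewrite inE eqxx.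
  have [h1 h2] := ih (fun q hq => sub q (mem_behead (s := p' :: ps) hq)).
  split.
    case: h1 => ->; first by rewrite sieve0; left.
    by rewrite sieve_t_component //; case: ifP => _; [left|right].
  rewrite inE => /predU1P[<-|/h2 ->]; last exact: sieve0.
  by case: h1 => ->; rewrite ?sieve0 // sieve_t_component // pj.
by have [_ h] := key (primes N) (fun _ => id); apply: h.
Qed.

End Action.

(** * The slash operator *)

Section Slash.
Variable R : realType.
Local Notation C := (R[i]^o).
Implicit Types (M : 'M[R]_2) (t : upper R) (f : upper R -> C).

Definition numfactor M t : R[i] := (M 0 0)%:C%C * val t + (M 0 1)%:C%C.

Lemma Im_upper t : 0 < complex.Im (val t). Proof. by case: t. Qed.

Lemma Im_scaleD (a b : R) (z : R[i]) :
  complex.Im (a%:C%C * z + b%:C%C) = a * complex.Im z /\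
  complex.Re (a%:C%C * z + b%:C%C) = a * complex.Re z + b.
Proof. by case: z => x y /=; split; ring. Qed.

Lemma autfactor_ReIm M t : complex.Im (autfactor M t) = M 1 0 * complex.Im (val t) /\
  complex.Re (autfactor M t) = M 1 0 * complex.Re (val t) + M 1 1.
Proof. exact: Im_scaleD. Qed.

Lemma numfactor_ReIm M t : complex.Im (numfactor M t) = M 0 0 * complex.Im (val t) /\
  complex.Re (numfactor M t) = M 0 0 * complex.Re (val t) + M 0 1.
Proof. exact: Im_scaleD. Qed.

Lemma autfactor_neq0 M t : 0 < \det M -> autfactor M t != 0.
Proof.
move=> dM; have := dM; rewrite {1}(mat2_eta M) mat2_det => d0.
have [h1 h2] := autfactor_ReIm M t; have y0 := Im_upper t.
apply/eqP => e.
have e1 : M 1 0 * complex.Re (val t) + M 1 1 = 0 by rewrite -h2 e.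
have : M 1 0 * complex.Im (val t) = 0 by rewrite -h1 e.
move/eqP; rewrite mulf_eq0 (gt_eqF y0) orbF => /eqP c0.
by move: e1 d0; rewrite c0 mul0r add0r => ->; rewrite !mulr0 subrr ltxx.
Qed.

Lemma Im_div (z w : R[i]) : complex.Im (z / w) =
  (complex.Im z * complex.Re w - complex.Re z * complex.Im w) / (complex.Re w ^+ 2 + complex.Im w ^+ 2).
Proof.
case: z w => [x y] [u v] /=.
by ring.
Qed.

Lemma sum_sqr_gt0 (w : R[i]) : w != 0 -> 0 < complex.Re w ^+ 2 + complex.Im w ^+ 2.
Proof.
case: w => [a b]; rewrite eq_complex /= negb_and => /orP[h|h].
  by rewrite ltr_pwDl ?sqr_ge0 // exprn_even_gt0.
by rewrite ltr_wpDl ?sqr_ge0 // exprn_even_gt0.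
Qed.

Lemma val_mobius M t : 0 < \det M -> val (mobius M t) = numfactor M t / autfactor M t.
Proof.
move=> dM; rewrite /mobius -/(numfactor M t) val_insubd ifT // Im_div.
have := dM; rewrite {1}(mat2_eta M) mat2_det => d0.
apply: divr_gt0; last by apply: sum_sqr_gt0; apply: autfactor_neq0.
have [h1 h2] := autfactor_ReIm M t; have [h3 h4] := numfactor_ReIm M t.
rewrite h1 h2 h3 h4; have y0 := Im_upper t.
have -> : M 0 0 * complex.Im (val t) * (M 1 0 * complex.Re (val t) + M 1 1) -
  (M 0 0 * complex.Re (val t) + M 0 1) * (M 1 0 * complex.Im (val t)) =
  (M 0 0 * M 1 1 - M 0 1 * M 1 0) * complex.Im (val t) by ring.
exact: mulr_gt0.
Qed.

Lemma factor_mul M M' t : 0 < \det M' ->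
  autfactor (M *m M') t = autfactor M (mobius M' t) * autfactor M' t /\
  numfactor (M *m M') t = numfactor M (mobius M' t) * autfactor M' t.
Proof.
move=> dM'; have hw : val (mobius M' t) * autfactor M' t = numfactor M' t.
  by rewrite val_mobius // divfK // autfactor_neq0.
have e1 : autfactor M (mobius M' t) * autfactor M' t =
    (M 1 0)%:C%C * numfactor M' t + (M 1 1)%:C%C * autfactor M' t.
  by rewrite -hw {1}/autfactor mulrDl mulrA.
have e2 : numfactor M (mobius M' t) * autfactor M' t =
    (M 0 0)%:C%C * numfactor M' t + (M 0 1)%:C%C * autfactor M' t.
  by rewrite -hw {1}/numfactor mulrDl mulrA.
rewrite e1 e2 [in X in X /\ _](mat2_eta M) [in X in _ /\ X = _](mat2_eta M).
rewrite [in X in X = _ /\ _](mat2_eta M') [in X in _ /\ X = _](mat2_eta M').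
rewrite mat2_mul /numfactor /autfactor !mxE /= !rmorphD !rmorphM /=; split; ring.
Qed.

Lemma mobiusM M M' t : 0 < \det M -> 0 < \det M' ->
  mobius (M *m M') t = mobius M (mobius M' t).
Proof.
move=> dM dM'; apply: val_inj; rewrite !val_mobius ?det_mulmx ?mulr_gt0 //.
have [-> ->] := factor_mul M t dM'.
by rewrite -mulf_div divff ?mulr1 // autfactor_neq0.
Qed.

Variable k : int.

Lemma slashM M M' f : 0 < \det M -> 0 < \det M' ->
  slash k (M *m M') f = slash k M' (slash k M f).
Proof.
move=> dM dM'; apply/funext => t; rewrite /slash mobiusM // det_mulmx.
have [-> _] := factor_mul M t dM'.
have e (A B X Y F : R[i]) : A * B * (X * Y) * F = B * Y * (A * X * F) by ring.
rewrite powRM ?ltW // rmorphM expfzMl; exact: e.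
Qed.

Lemma slash1 f : slash k 1%:M f = f.
Proof.
apply/funext => t; rewrite /slash det1 powR1 mul1r.
have a1 : autfactor 1%:M t = 1 :> R[i].
  by rewrite /autfactor !mxE /= mul0r add0r.
rewrite a1 exp1rz mul1r; congr (f _); apply: val_inj.
by rewrite val_mobius ?det1 // a1 divr1 /numfactor !mxE /= mul1r addr0.
Qed.

Lemma slash_lin M (c : R[i]) f g : slash k M (c *: f + g) = c *: slash k M f + slash k M g.
Proof.
apply/funext => t; rewrite /slash.
change ((\det M `^ (k%:~R / 2))%:C%C * autfactor M t ^ (- k) * (c * f (mobius M t) + g (mobius M t)) =
 c * ((\det M `^ (k%:~R / 2))%:C%C * autfactor M t ^ (- k) * f (mobius M t)) +
 (\det M `^ (k%:~R / 2))%:C%C * autfactor M t ^ (- k) * g (mobius M t)).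
by ring.
Qed.

Lemma realmx_det (M : 'M[int]_2) : \det (Defs.realmx R M) = (\det M)%:~R.
Proof. by rewrite det_map_mx. Qed.

Lemma realmx_mat2 a b c d : Defs.realmx R (mat2 a b c d) = mat2 a%:~R b%:~R c%:~R d%:~R.
Proof. by rewrite [LHS]mat2_eta /Defs.realmx !mxE. Qed.

Definition sl (M : 'M[int]_2) f : upper R -> C := slash k (Defs.realmx R M) f.

Lemma sl_det_gt0 (M : 'M[int]_2) : SL2Z M -> 0 < \det (Defs.realmx R M).
Proof. by rewrite realmx_det => ->. Qed.

Lemma sl1 f : sl 1%:M f = f.
Proof. by rewrite /sl /Defs.realmx map_mx1 slash1. Qed.

Lemma slM (M M' : 'M[int]_2) f : SL2Z M -> SL2Z M' -> sl (M *m M') f = sl M' (sl M f).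
Proof.
by move=> h h'; rewrite /sl /Defs.realmx map_mxM slashM //; apply: sl_det_gt0.
Qed.

Lemma sl_lin (M : 'M[int]_2) (c : R[i]) f g : SL2Z M -> sl M (c *: f + g) = c *: sl M f + sl M g.
Proof. by move=> _; apply: slash_lin. Qed.

Definition translate (h : R) t : upper R := mobius (mat2 1 h 0 1) t.

Lemma val_translate h t : val (translate h t) = val t + h%:C%C.
Proof.
rewrite val_mobius ?mat2_det ?mulr0 ?subr0 ?mulr1 //.
by rewrite /numfactor /autfactor !mxE /= mul1r mul0r add0r divr1.
Qed.

Lemma sl_upT n f t : sl (upT n) f t = f (translate n%:~R t).
Proof.
rewrite /sl /upT realmx_mat2 /slash mat2_det !rmorph1 rmorph0 mulr0 subr0 mulr1 powR1 mul1r.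
have -> : autfactor (mat2 1 n%:~R 0 1) t = 1 :> R[i].
  by rewrite /autfactor !mxE /= mul0r add0r.
by rewrite exp1rz mul1r.
Qed.

(* For [0 < h] the default value in [mobius] is not used. *)
Definition shrink (h : nat) t : upper R := mobius (mat2 1 0 0 h%:R) t.
Definition dilate (h : nat) t : upper R := mobius (mat2 h%:R 0 0 1) t.

Lemma val_shrink h t : (0 < h)%N -> val (shrink h t) = val t / h%:R.
Proof.
move=> h0; rewrite val_mobius ?mat2_det ?mulr0 ?subr0 ?mul1r ?ltr0n //.
by rewrite /numfactor /autfactor !mxE /= mul1r mul0r add0r addr0 rmorph_nat.
Qed.

Lemma val_dilate h t : (0 < h)%N -> val (dilate h t) = h%:R * val t.
Proof.
move=> h0; rewrite val_mobius ?mat2_det ?mulr0 ?subr0 ?mulr1 ?ltr0n //.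
by rewrite /numfactor /autfactor !mxE /= mul0r add0r addr0 rmorph_nat divr1.
Qed.

Lemma shrinkK h t : (0 < h)%N -> dilate h (shrink h t) = t.
Proof.
move=> h0; apply: val_inj; rewrite val_dilate // val_shrink // mulrC divfK //.
by rewrite pnatr_eq0 -lt0n.
Qed.

Lemma dilateK h t : (0 < h)%N -> shrink h (dilate h t) = t.
Proof.
move=> h0; apply: val_inj; rewrite val_shrink // val_dilate // mulrC mulKf //.
by rewrite pnatr_eq0 -lt0n.
Qed.

Lemma slash_shrink h f t : (0 < h)%N ->
  slash k (mat2 1 0 0 h%:R) f t = (h%:R `^ (- (k%:~R / 2)))%:C%C * f (shrink h t).
Proof.
move=> h0; rewrite /slash mat2_det mulr0 subr0 mul1r; congr (_ * _).
have -> : autfactor (mat2 1 0 0 h%:R) t = (h%:R)%:C%C :> R[i].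
  by rewrite /autfactor !mxE /= mul0r add0r.
have hn : (h%:R : R) != 0 by rewrite pnatr_eq0 -lt0n.
rewrite -(fmorphXz (real_complex R)) -rmorphM /=; congr (_%:C%C).
rewrite -powR_intmul ?ler0n //.
rewrite -powRD; last by rewrite hn implybT.
by congr (_ `^ _); rewrite rmorphN /=; field.
Qed.

Lemma slash_dilate h f t : (0 < h)%N ->
  slash k (mat2 h%:R 0 0 1) f t = (h%:R `^ (k%:~R / 2))%:C%C * f (dilate h t).
Proof.
move=> h0; rewrite /slash mat2_det mulr0 subr0 mulr1; congr (_ * _).
have -> : autfactor (mat2 h%:R 0 0 1) t = 1 :> R[i].
  by rewrite /autfactor !mxE /= mul0r add0r.
by rewrite exp1rz mulr1.
Qed.

(** The two factorisations serve the two maps: up to scalars, f | W is f(tau/N) | S in psi, and F_0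
    | W is F_0 | S taken at N tau in phi. *)
Lemma matW_shrink N : matW R N = mat2 1 0 0 N%:R *m Defs.realmx R matS.
Proof. by rewrite /matW /matS realmx_mat2 mat2_mul; congr mat2; rewrite ?rmorphN1 ?rmorph0 ?rmorph1; ring. Qed.

Lemma matW_dilate N : matW R N = Defs.realmx R matS *m mat2 N%:R 0 0 1.
Proof. by rewrite /matW /matS realmx_mat2 mat2_mul; congr mat2; rewrite ?rmorphN1 ?rmorph0 ?rmorph1; ring. Qed.

End Slash.

Import numFieldNormedType.Exports.
Local Open Scope classical_set_scope.
Local Open Scope ring_scope.

(** * Holomorphy and Fourier expansions *)

Section Holomorphic.
Variable R : realType.
Local Notation C := (R[i]^o).
Implicit Types (f g : upper R -> C) (t : upper R) (M : 'M[R]_2).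

Lemma extend0_val f t : extend0 f (val t) = f t.
Proof. by rewrite /extend0 valK. Qed.

Lemma near_upper t : \forall z \near (val t : C), 0 < complex.Im (z : R[i]).
Proof.
have y0 := Im_upper t; pose e : R[i] := (complex.Im (val t))%:C%C.
have e0 : 0 < e by rewrite ltcR.
apply/nbhs_ballP; exists e => //= z; rewrite /ball /= => h.
have : (`|complex.Im (val t) - complex.Im (z : R[i])|)%:C%C < e.
  apply: le_lt_trans h; rewrite normc_def lecR.
  have -> : complex.Im (val t) - complex.Im (z : R[i]) = complex.Im ((val t : R[i]) - z).
    by case: (val t) z => [x y] [x' y'].
  rewrite -sqrtr_sqr ler_sqrt; first by rewrite lerDr sqr_ge0.
  by rewrite addr_ge0 // sqr_ge0.
rewrite ltcR ltr_norml; lra.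
Qed.

(** [extend0] takes the value 0 outside the upper half-plane. This does not affect derivatives,
    because the half-plane is open. *)
Lemma holomorphic_eq f (g : C -> C) :
  (forall t, f t = g (val t)) -> (forall t, derivable g (val t : C) 1) -> holomorphic f.
Proof.
move=> fg dg t; apply: (near_eq_derivable _ (dg t)); near=> z.
have hz : 0 < complex.Im (z : R[i]) by near: z; exact: near_upper.
have -> : z = val (Sub z hz : upper R) by rewrite SubK.
by rewrite extend0_val fg.
Unshelve. all: by end_near. Qed.

Lemma holomorphicD f g : holomorphic f -> holomorphic g -> holomorphic (f + g).
Proof.
move=> hf hg; apply: (@holomorphic_eq _ (extend0 f + extend0 g)) => t.
  by rewrite -[RHS]/(extend0 f (val t) + extend0 g (val t)) !extend0_val.
by apply: derivableD; [exact: hf|exact: hg].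
Qed.

Lemma holomorphicZ (c : R[i]) f : holomorphic f -> holomorphic (c *: f).
Proof.
move=> hf; apply: (@holomorphic_eq _ (c *: extend0 f)) => t.
  by rewrite -[RHS]/(c *: extend0 f (val t)) !extend0_val.
by apply: derivableZ; exact: hf.
Qed.

Lemma holomorphic0 : holomorphic (0 : upper R -> C).
Proof. by apply: (@holomorphic_eq _ (cst 0)) => t //; exact: derivable_cst. Qed.

Lemma holomorphic_sum (I : Type) (s : seq I) (P : pred I) (F : I -> upper R -> C) :
  (forall i, P i -> holomorphic (F i)) -> holomorphic (\sum_(i <- s | P i) F i).
Proof.
move=> hF; elim: s => [|i s ih]; first by rewrite big_nil; exact: holomorphic0.
rewrite big_cons; case: ifP => [/hF hi|_]; [exact: (holomorphicD hi ih)|exact: ih].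
Qed.

Lemma derivable_affine (a b : R[i]) (z : C) : derivable (fun w : C => a * w + b : C) z 1.
Proof.
apply: (@derivableD _ _ _ (fun w : C => a * w : C) (cst b)); last exact: derivable_cst.
by apply: (@derivableZ _ _ _ id a); exact: derivable_id.
Qed.

Lemma derivable_exprz (u : C -> C) (n : int) (z : C) : u z != 0 -> derivable u z 1 ->
  derivable (fun w : C => (u w : R[i]) ^ n : C) z 1.
Proof.
move=> u0 du; have dX m : derivable (fun w : C => (u w : R[i]) ^+ m : C) z 1.
  have := @derivableX _ _ u m z 1 du; congr (derivable _ z 1).
  by apply/funext => w; elim: m => [|m ih]; rewrite ?expr0 // !exprS -ih.
case: n => n; first exact: dX.
apply: (@derivableV _ _ (fun w : C => (u w : R[i]) ^+ n.+1 : C)); last exact: dX.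
by rewrite expf_neq0.
Qed.

Lemma holomorphic_slash (k : int) M f : 0 < \det M -> holomorphic f ->
  holomorphic (slash k M f).
Proof.
move=> dM hf.
pose aut (w : C) : C := (M 1 0)%:C%C * w + (M 1 1)%:C%C.
pose num (w : C) : C := (M 0 0)%:C%C * w + (M 0 1)%:C%C.
have autE t : aut (val t) = autfactor M t by [].
have numE t : num (val t) = numfactor M t by [].
pose mob (w : C) : C := (num w : R[i]) * (aut w : R[i])^-1.
apply: (@holomorphic_eq _ (fun w : C => ((\det M `^ (k%:~R / 2))%:C%C * (aut w : R[i]) ^ (- k) : R[i]) *
    (extend0 f (mob w) : R[i]) : C)) => t.
  rewrite autE /slash; congr (_ * _).
  by rewrite /mob autE numE -val_mobius // extend0_val.
have a0 : aut (val t) != 0 by rewrite autE autfactor_neq0.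
have daut := @derivable_affine (M 1 0)%:C%C (M 1 1)%:C%C (val t).
have dnum := @derivable_affine (M 0 0)%:C%C (M 0 1)%:C%C (val t).
apply: (@derivableM _ _ (fun w : C => (\det M `^ (k%:~R / 2))%:C%C * (aut w : R[i]) ^ (- k) : C)
  (fun w : C => extend0 f (mob w))).
  apply: (@derivableZ _ _ _ (fun w : C => (aut w : R[i]) ^ (- k) : C)).
  exact (@derivable_exprz aut (- k) (val t) a0 daut).
have dmob : derivable mob (val t : C) 1.
  apply: (@derivableM _ _ num (fun w : C => (aut w : R[i])^-1 : C) _ _ dnum).
  exact (@derivableV _ _ aut _ _ a0 daut).
apply/derivable1_diffP; apply: (@differentiable_comp _ _ _ _ mob (extend0 f)).
  exact/derivable1_diffP.
have -> : mob (val t) = val (mobius M t) by rewrite /mob autE numE -val_mobius.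
by apply/derivable1_diffP; exact: hf.
Qed.

End Holomorphic.

Section SparseSeries.
Variable (R : realType).
Local Notation C := (R[i]^o).
Implicit Types u v : nat -> C.

Lemma series_prepend u d : (forall j, (j < d)%N -> u j = 0) ->
  forall n, series u (n + d)%N = series (fun j => u (j + d)%N) n.
Proof.
move=> u0; elim=> [|n ih]; rewrite /series /=.
  rewrite add0n [RHS]big_geq //; apply: big1_seq => j.
  by rewrite mem_index_iota => /andP[_ /u0].
by rewrite addSn !big_nat_recr //=; congr (_ + _).
Qed.

Lemma cvg_series_ext u v (l : C) : (forall j, u j = v j) ->
  series u @ \oo --> l -> series v @ \oo --> l.
Proof. by move=> /funext ->. Qed.

Lemma cvg_prepend u d (l : C) : (forall j, (j < d)%N -> u j = 0) ->
  series (fun j => u (j + d)%N) @ \oo --> l -> series u @ \oo --> l.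
Proof.
move=> u0 h; rewrite -(cvg_shiftn d).
have -> // : [sequence series u (n + d)%N]_n = series (fun j => u (j + d)%N).
by apply/funext => n; exact: series_prepend.
Qed.

Variable m : nat.
Hypothesis m0 : (0 < m)%N.

Definition sparse v : nat -> C := fun j => if (m %| j)%N then v (j %/ m)%N else 0.

(** The index is n/m rounded up, the number of multiples of m among 0, ..., n - 1. *)
Lemma series_sparse v n : series (sparse v) n = series v ((n + m.-1) %/ m)%N.
Proof.
have sS u j : series u j.+1 = series u j + u j by rewrite /series /= big_nat_recr.
elim: n => [|n ih]; first by rewrite /series /= divn_small ?big_geq // add0n prednK.
rewrite sS ih {1}/sparse.
case: ifP => [/dvdnP[i ->]|h].
  have -> : ((i * m).+1 + m.-1 = i.+1 * m)%N by rewrite mulSn; lia.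
  rewrite mulnK // divnMDl // divn_small ?addn0; last by lia.
  by rewrite mulnK // sS.
rewrite addr0; congr (series v _).
have e := divn_eq n m; have nm : (0 < n %% m)%N by rewrite lt0n; move: h; rewrite /dvdn => ->.
have r1 : (n %% m < m)%N by rewrite ltn_mod.
have -> : (n + m.-1 = (n %/ m).+1 * m + (n %% m).-1)%N.
  by rewrite {1}e mulSn; lia.
have -> : (n.+1 + m.-1 = (n %/ m).+1 * m + (n %% m))%N.
  by rewrite {1}e mulSn; lia.
have r2 : ((n %% m).-1 < m)%N by lia.
by rewrite !divnMDl // (divn_small r1) (divn_small r2) !addn0.
Qed.

Lemma cvg_sparse v (l : C) : series (sparse v) @ \oo --> l <-> series v @ \oo --> l.
Proof.
split=> h.
  have -> : series v = series (sparse v) \o (fun n => n * m)%N.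
    apply/funext => n /=; rewrite series_sparse divnMDl // divn_small ?addn0 //; lia.
  apply: cvg_comp h => P [A _ PA]; exists A => // n /= An; apply: PA => /=.
  by apply: leq_trans An _; rewrite leq_pmulr.
have -> : series (sparse v) = series v \o (fun n => (n + m.-1) %/ m)%N.
  by apply/funext => n; exact: series_sparse.
apply: cvg_comp h => P [A _ PA]; exists (A * m)%N => // n /= An; apply: PA => /=.
by rewrite leq_divRL // (leq_trans An) // leq_addr.
Qed.

End SparseSeries.

Section Fourier.
Variable R : realType.
Local Notation C := (R[i]^o).
Implicit Types (f g : upper R -> C) (t : upper R) (a b : int -> C).

Definition fterm (h : nat) a (B : nat) t : nat -> C :=
  fun j => a (j%:Z - B%:Z) * e2pi ((j%:Z - B%:Z)%:~R * val t / h%:R).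

(** [fourier] hides its first exponent. Starting at -B with any large B gives two expansions a
    common start, so that they can be added term by term. *)
Definition fourier_from h f a B :=
  (forall n : int, n < - B%:Z -> a n = 0) /\
  forall t, series (fterm h a B t) @ \oo --> f t.

Lemma fourier_fromP h f a : fourier h f a ->
  exists B0, forall B, (B0 <= B)%N -> fourier_from h f a B.
Proof.
move=> [n0 [a0 ha]]; exists `|n0|%N => B hB; split=> [n hn|t].
  by apply: a0; lia.
have [d dE] : exists d : nat, n0 + B%:Z = d%:Z by exists `|(n0 + B%:Z)%R|%N; lia.
apply: (@cvg_prepend _ _ d) => [j jd|].
  by rewrite /fterm a0 ?mul0r //; lia.
suff -> : (fun j : nat => fterm h a B t (j + d)%N) =
   (fun j : nat => a (n0 + j%:Z) * e2pi ((n0 + j%:Z)%:~R * val t / h%:R) : C) by exact: ha.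
apply/funext => j; rewrite /fterm.
by have -> : (j + d)%N%:Z - B%:Z = n0 + j%:Z by lia.
Qed.

Lemma fourier_fromW h f a B : fourier_from h f a B -> fourier h f a.
Proof.
move=> [a0 ha]; exists (- B%:Z); split=> [n /a0 //|t].
apply: cvg_series_ext (ha t) => j; rewrite /fterm.
by rewrite [j%:Z - _]addrC.
Qed.

Lemma fourierD h f g a b : fourier h f a -> fourier h g b ->
  fourier h (f + g) (fun n => a n + b n).
Proof.
move=> /fourier_fromP[B1 h1] /fourier_fromP[B2 h2].
have [a0 ha] := h1 (B1 + B2)%N (leq_addr _ _); have [b0 hb] := h2 (B1 + B2)%N (leq_addl _ _).
apply: (@fourier_fromW _ _ _ (B1 + B2)) ; split=> [n hn|t].
  by rewrite a0 // b0 // addr0.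
have -> : series (fterm h (fun n => a n + b n) (B1 + B2) t) =
    series (fterm h a (B1 + B2) t) + series (fterm h b (B1 + B2) t).
  apply/funext => n.
  transitivity (\sum_(0 <= j < n) (fterm h a (B1 + B2) t j + fterm h b (B1 + B2) t j)).
    by apply: eq_bigr => j _; rewrite /fterm mulrDl.
  exact: big_split.
exact: cvgD (ha t) (hb t).
Qed.

Lemma fourierZ h (c : R[i]) f a : fourier h f a -> fourier h (c *: f) (fun n => c * a n).
Proof.
move=> /fourier_fromP[B h1]; have [a0 ha] := h1 B (leqnn _).
apply: (@fourier_fromW _ _ _ B); split=> [n hn|t]; first by rewrite a0 // mulr0.
have -> : series (fterm h (fun n => c * a n) B t) = c *: series (fterm h a B t).
  apply/funext => n; rewrite /series.
  transitivity (c * \sum_(0 <= j < n) fterm h a B t j); last by [].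
  rewrite mulr_sumr; apply: eq_bigr => j _; rewrite /fterm.
  exact: (esym (mulrA _ _ _)).
exact: cvgZr (ha t).
Qed.

Lemma fourier0 h : fourier h (0 : upper R -> C) (fun=> 0).
Proof.
exists 0; split=> // t.
have -> : series (fun j : nat => 0 * e2pi ((0 + j%:Z)%:~R * val t / h%:R) : C) = cst 0.
  by apply/funext => n; rewrite /series /= big1 // => j _; rewrite mul0r.
exact: cvg_cst.
Qed.

Lemma fourier_sum h (I : Type) (s : seq I) (P : pred I) (F : I -> upper R -> C) (A : I -> int -> C) :
  (forall i, fourier h (F i) (A i)) ->
  fourier h (\sum_(i <- s | P i) F i) (fun n => \sum_(i <- s | P i) A i n).
Proof.
move=> hF; elim: s => [|i s ih].
  have -> : (fun n => \sum_(i <- [::] | P i) A i n) = (fun=> 0) by apply/funext => n; rewrite big_nil.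
  by rewrite big_nil; exact: fourier0.
have -> : (fun n => \sum_(i <- i :: s | P i) A i n) =
    (fun n => (if P i then A i n else 0) + \sum_(i <- s | P i) A i n).
  by apply/funext => n; rewrite big_cons; case: (P i); rewrite ?add0r.
have -> : \sum_(i <- i :: s | P i) F i = (if P i then F i else 0) + \sum_(i <- s | P i) F i.
  by rewrite big_cons; case: (P i); rewrite ?add0r.
apply: fourierD ih; case: (P i) => //; exact: fourier0.
Qed.

Lemma fourier_unique_zero h f a : fourier h f a -> (forall n, a n = 0) -> f = 0.
Proof.
move=> [n0 [_ ha]] a0; apply/funext => t.
have := ha t; have -> : series (fun j : nat => a (n0 + j%:Z) * e2pi ((n0 + j%:Z)%:~R * val t / h%:R) : C) = cst 0.
  by apply/funext => n; rewrite /series /= big1 // => j _; rewrite a0 mul0r.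
by move=> hl; apply: (cvg_unique _ hl (cvg_cst _)).
Qed.

Definition spread (m : nat) a : int -> C :=
  fun n => if (m %| n)%Z then a (n %/ m)%Z else 0.

Lemma fterm_spread h m a B t : (0 < m)%N ->
  fterm h (spread m a) (B * m) t =
  sparse m (fun j => a (j%:Z - B%:Z) * e2pi (((j%:Z - B%:Z) * m%:Z)%:~R * val t / h%:R)).
Proof.
move=> m0; apply/funext => j; rewrite /fterm /spread /sparse PoszM.
have -> : (m%:Z %| j%:Z - B%:Z * m%:Z)%Z = (m %| j)%N.
  by rewrite rpredBr // dvdz_mull.
case: ifP => [/dvdnP[i ->]|_]; last by rewrite mul0r.
by rewrite mulnK // PoszM -mulrBl mulzK // eqz_nat -lt0n.
Qed.

(* The factor [m] in the hypothesis makes this the change of variable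
   [n |-> m n] in the exponents. *)
Lemma fourier_spread h m f g a : (0 < m)%N -> fourier h f a ->
  forall H, (forall t, exists t', g t = f t' /\
      val t' / h%:R = m%:R * val t / H%:R :> R[i]) ->
  fourier H g (spread m a).
Proof.
move=> m0 /fourier_fromP[B /(_ B (leqnn _))[a0 ha]] H hg.
apply: (@fourier_fromW _ _ _ (B * m)); split=> [n hn|t].
  rewrite /spread; case: ifP => // /dvdzP[i ni]; move: hn; rewrite ni mulzK; last by lia.
  by rewrite PoszM -mulNr ltr_pM2r //; exact: a0.
rewrite fterm_spread //; apply/cvg_sparse => //.
have [t' [-> e]] := hg t; apply: cvg_series_ext (ha t') => j.
rewrite /fterm -!mulrA e intrM -!mulrA.
by rewrite -pmulrn.
Qed.

Lemma fourier_deflate h m f g a : (0 < m)%N -> fourier h f a ->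
  (forall n, ~~ (m %| n)%Z -> a n = 0) ->
  forall H, (forall t, exists t', g t = f t' /\
      m%:R * val t' / h%:R = val t / H%:R :> R[i]) ->
  fourier H g (fun n => a (n * m%:Z)).
Proof.
move=> m0 /fourier_fromP[B hB] am H hg.
have [a0 ha] : fourier_from h f a (B * m) by apply: hB; rewrite leq_pmulr.
apply: (@fourier_fromW _ _ _ B); split=> [n hn|t].
  by apply: a0; rewrite PoszM -mulNr ltr_pM2r.
have aE : a = spread m (fun n => a (n * m%:Z)).
  apply/funext => n; rewrite /spread; case: ifP => [h1|/negbT/am //].
  by rewrite divzK.
have [t' [-> e]] := hg t; have := ha t'; rewrite {1}aE fterm_spread //.
move/cvg_sparse => /(_ m0); apply: cvg_series_ext => j.
rewrite /fterm -!mulrA -e intrM -!mulrA.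
by rewrite -pmulrn.
Qed.

End Fourier.

(** Needed for the cusps of f(tau/N) and f(N tau): an integral matrix is a cusp of f followed by an
    upper triangular matrix, which only rescales and translates expansions. The first column of A is
    that of P divided by its gcd, and Bezout coefficients complete it. *)
Lemma hermite_mat2 (P : 'M[int]_2) : 0 < \det P -> exists (A : 'M[int]_2) (x y z : int),
  [/\ SL2Z A, 0 < x, 0 < z & P = A *m mat2 x y 0 z].
Proof.
rewrite (mat2_eta P); set x := P 0 0; set y := P 0 1; set z := P 1 0; set w := P 1 1.
rewrite mat2_det => dP.
have [u [v uv]] := Bezoutz x z.
set g : int := gcdz x z in uv.
have g0 : 0 < g.
  rewrite lt_neqAle (_ : 0 <= g) ?andbT //.
  apply/eqP => g0; move/eqP: (esym g0); rewrite gcdz_eq0 => /andP[/eqP x0 /eqP z0].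
  by move: dP; rewrite x0 z0 mul0r mulr0 subrr ltxx.
have [x' xE] := dvdzP (dvdz_gcdl x z); have [z' zE] := dvdzP (dvdz_gcdr x z).
rewrite -/g in xE zE.
have uv1 : u * x' + v * z' = 1.
  by apply: (mulIf (lt0r_neq0 g0)); rewrite mul1r -[RHS]uv [in RHS]xE [in RHS]zE; ring.
have dE : x * w - y * z = g * (x' * w - z' * y) by rewrite xE zE; ring.
exists (mat2 x' (- v) z' u), g, (u * y + v * w), (x' * w - z' * y); split.
- by rewrite SL2ZE -uv1; ring.
- exact: g0.
- by move: dP; rewrite dE pmulr_rgt0.
rewrite mat2_mul; congr mat2; rewrite ?mulr0 ?addr0 //.
- transitivity ((u * x' + v * z') * y); [by rewrite uv1 mul1r|ring].
- transitivity ((u * x' + v * z') * w); [by rewrite uv1 mul1r|ring].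
Qed.

(** * Fourier expansions under integral matrices *)

Section FourierAction.
Variables (R : realType) (k : int).
Local Notation C := (R[i]^o).
Local Notation sl := (@sl R k).
Implicit Types (f g : upper R -> C) (t : upper R) (a b : int -> C).

Lemma fourier_translate h f a (s : int) : (0 < h)%N -> fourier h f a ->
  fourier h (sl (upT s) f) (fun n => ee R (s%:~R * (n%:~R / h%:R)) * a n).
Proof.
move=> h0 /fourier_fromP[B /(_ B (leqnn _))[a0 ha]].
apply: (@fourier_fromW _ _ _ _ B); split=> [n hn|t]; first by rewrite a0 // mulr0.
rewrite sl_upT; apply: cvg_series_ext (ha (translate s%:~R t)) => j.
rewrite /fterm val_translate; set n := j%:Z - B%:Z.
have -> : n%:~R * (val t + (s%:~R : R)%:C%C) / h%:R =
    n%:~R * val t / h%:R + ratr (s%:~R * (n%:~R / h%:R)) :> R[i].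
  have -> : ratr (s%:~R * (n%:~R / h%:R)) = s%:~R * (n%:~R / h%:R) :> R[i].
    by rewrite !rmorphM fmorphV !rmorph_int rmorph_nat.
  by rewrite rmorph_int; ring.
have e (u v w : R[i]) : u * (v * w) = w * u * v by ring.
rewrite e2piD eeE; exact: e.
Qed.

Lemma fourier_t_component h f a (j : int) : (0 < h)%N -> fourier h f a ->
  fourier h (t_component sl h j f) (fun n => if (n == j %[mod h])%Z then a n else 0).
Proof.
move=> h0 ha; have hn : h%:R != 0 :> R[i] by rewrite pnatr_eq0 -lt0n.
have := fourierZ (h%:R^-1) (fourier_sum (index_enum 'I_h) predT (fun i : 'I_h =>
  fourierZ (ee R (- (i%:R * (j%:~R / h%:R)))) (fourier_translate i%:Z h0 ha))).
congr (fourier _ _ _); apply/funext => n.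
under eq_bigr => i _ do rewrite mulrA -eeD.
rewrite -mulr_suml.
have -> : \sum_(i < h) ee R (- (i%:R * (j%:~R / h%:R)) + i%:Z%:~R * (n%:~R / h%:R)) =
    \sum_(i < h) ee R (i%:R * ((n - j)%:~R / h%:R)).
  apply: eq_bigr => i _; congr ee; rewrite rmorphB /= mulrBl mulrBr addrC.
  by [].
rewrite sum_ee // eqz_mod_dvd; case: ifP => _; last by rewrite mul0r mulr0.
by rewrite mulrA mulVf // mul1r.
Qed.

Lemma fourier_inflate h m f a : (0 < m)%N -> fourier h f a -> fourier (h * m) f (spread m a).
Proof.
move=> m0 ha; apply: (fourier_spread m0 ha) => t; exists t; split=> //.
have mn : m%:R != 0 :> R[i] by rewrite pnatr_eq0 -lt0n.
have e (x y u v : R[i]) : x * u * (y * v) = x * y * (v * u) by ring.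
rewrite natrM invfM -[LHS]mul1r -[X in X * _](divff mn); exact: e.
Qed.

Lemma meromorphicD f g : meromorphic_infty f -> meromorphic_infty g -> meromorphic_infty (f + g).
Proof.
move=> [h [a [h0 ha]]] [h' [b [h0' hb]]].
exists (h * h')%N, (fun n => spread h' a n + spread h b n); split; first by rewrite muln_gt0 h0.
by apply: fourierD; [|rewrite mulnC]; apply: fourier_inflate.
Qed.

Lemma meromorphicZ (c : R[i]) f : meromorphic_infty f -> meromorphic_infty (c *: f).
Proof. by move=> [h [a [h0 ha]]]; exists h, (fun n => c * a n); split; [exact: h0|exact: (fourierZ c ha)]. Qed.

Lemma meromorphic_sum (I : Type) (s : seq I) (P : pred I) (F : I -> upper R -> C) :
  (forall i, P i -> meromorphic_infty (F i)) -> meromorphic_infty (\sum_(i <- s | P i) F i).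
Proof.
move=> hF; elim: s => [|i s ih].
  by rewrite big_nil; exists 1%N, (fun=> 0); split; [by []|exact: fourier0].
rewrite big_cons; case: ifP => [/hF hi|_]; [exact: (meromorphicD hi ih)|exact: ih].
Qed.

Lemma fourier_shrink h f a N : (0 < N)%N -> fourier h f a ->
  fourier (h * N) (fun t => f (shrink N t)) a.
Proof.
move=> N0 [n0 [a0 ha]]; exists n0; split; [exact: a0|move=> t].
apply: cvg_series_ext (ha (shrink N t)) => j; rewrite val_shrink // natrM invfM.
by rewrite !mulrA [_ / N%:R / _]mulrAC.
Qed.

Lemma fourier_dilate h f a N : (0 < N)%N -> fourier (h * N) f a ->
  fourier h (fun t => f (dilate N t)) a.
Proof.
move=> N0 [n0 [a0 ha]]; exists n0; split; [exact: a0|move=> t].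
apply: cvg_series_ext (ha (dilate N t)) => j; rewrite val_dilate // natrM invfM.
have Nn : N%:R != 0 :> R[i] by rewrite pnatr_eq0 -lt0n.
have e (x y u v w : R[i]) : x * (u * y) * (v * w) = u * w * (x * y * v) by ring.
by rewrite e divff // mul1r.
Qed.

Lemma meromorphic_slash_shrink f (z : nat) : (0 < z)%N -> meromorphic_infty f ->
  meromorphic_infty (slash k (mat2 1 0 0 z%:R) f).
Proof.
move=> z0 [h [a [h0 ha]]].
have -> : slash k (mat2 1 0 0 z%:R) f = (z%:R `^ (- (k%:~R / 2)))%:C%C *: (fun t => f (shrink z t)).
  by apply/funext => t; rewrite slash_shrink.
apply: meromorphicZ; exists (h * z)%N, a; split; first by rewrite muln_gt0 h0.
exact: fourier_shrink.
Qed.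

Lemma meromorphic_slash_dilate f (x : nat) : (0 < x)%N -> meromorphic_infty f ->
  meromorphic_infty (slash k (mat2 x%:R 0 0 1) f).
Proof.
move=> x0 [h [a [h0 ha]]].
have -> : slash k (mat2 x%:R 0 0 1) f = (x%:R `^ (k%:~R / 2))%:C%C *: (fun t => f (dilate x t)).
  by apply/funext => t; rewrite slash_dilate.
apply: meromorphicZ; exists h, (spread x a); split; first exact: h0.
apply: (fourier_spread x0 ha) => t; exists (dilate x t); split; first by [].
by rewrite val_dilate.
Qed.

Lemma meromorphic_upT f (y : int) : meromorphic_infty f -> meromorphic_infty (sl (upT y) f).
Proof.
move=> [h [a [h0 ha]]]; exists h, (fun n => ee R (y%:~R * (n%:~R / h%:R)) * a n).
by split; [exact: h0|exact: fourier_translate].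
Qed.

Lemma meromorphic_slash_triangular (x y z : int) f : 0 < x -> 0 < z ->
  meromorphic_infty f -> meromorphic_infty (slash k (Defs.realmx R (mat2 x y 0 z)) f).
Proof.
move=> x0 z0 mf; have [m [xE m0]] : exists m : nat, x = m%:Z /\ (0 < m)%N by exists `|x|%N; lia.
have [n [zE n0]] : exists n : nat, z = n%:Z /\ (0 < n)%N by exists `|z|%N; lia.
have -> : Defs.realmx R (mat2 x y 0 z) =
    mat2 1 0 0 n%:R *m Defs.realmx R (upT y) *m mat2 m%:R 0 0 1.
  by rewrite /upT !realmx_mat2 !mat2_mul xE zE; congr mat2; rewrite ?rmorph0 ?rmorph1; ring.
have d1 : 0 < \det (mat2 1 0 0 n%:R : 'M[R]_2) by rewrite mat2_det mulr0 subr0 mul1r ltr0n.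
have d2 := sl_det_gt0 R (SL2Z_upT y).
have d3 : 0 < \det (mat2 m%:R 0 0 1 : 'M[R]_2) by rewrite mat2_det mulr0 subr0 mulr1 ltr0n.
have d12 : 0 < \det (mat2 1 0 0 n%:R *m Defs.realmx R (upT y)).
  by rewrite det_mulmx; apply: mulr_gt0.
rewrite (slashM k f d12 d3) (slashM k f d1 d2).
exact: (meromorphic_slash_dilate m0 (meromorphic_upT y (meromorphic_slash_shrink n0 mf))).
Qed.

Lemma meromorphic_slash_integral f (P : 'M[int]_2) :
  (forall M, SL2Z M -> meromorphic_infty (sl M f)) -> 0 < \det P ->
  meromorphic_infty (slash k (Defs.realmx R P) f).
Proof.
move=> mf dP; have [A [x [y [z [hA x0 z0 ->]]]]] := hermite_mat2 dP.
have dA := sl_det_gt0 R hA.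
have dB : 0 < \det (Defs.realmx R (mat2 x y 0 z)).
  by rewrite realmx_det mat2_det mulr0 subr0 ltr0z mulr_gt0.
rewrite [Defs.realmx R _]map_mxM (slashM k f dA dB).
exact: (meromorphic_slash_triangular y x0 z0 (mf A hA)).
Qed.

(** The given expansion has an unknown width h. Spread it to width h N and apply the projector with
    index j h, which fixes f by quasiperiodicity. Only exponents congruent to j h modulo h N remain;
    they are multiples of h, and dividing by h gives width N. *)
Lemma fourier_quasiperiodic f N (j : int) : (0 < N)%N -> meromorphic_infty f ->
  (forall t, f (translate 1 t) = ee R (j%:~R / N%:R) * f t) ->
  exists2 b : int -> C, fourier N f b & forall n, b n != 0 -> (n = j %[mod N])%Z.
Proof.
move=> N0 [h [a [h0 ha]]] fT.
have hN0 : (0 < h * N)%N by rewrite muln_gt0 h0.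
have fTn (n : nat) t : sl (upT n%:Z) f t = ee R (n%:R * (j%:~R / N%:R)) * f t.
  elim: n t => [|n ih] t; first by rewrite upT0 sl1 mul0r ee0 mul1r.
  have -> : n.+1%:Z = n%:Z + 1 by lia.
  rewrite upTD slM // sl_upT rmorph1 ih fT mulrA -eeD; congr (ee R _ * _).
  by rewrite -natr1 mulrDl mul1r.
have hn : h%:R != 0 :> rat by rewrite pnatr_eq0 -lt0n.
have hN : N%:R != 0 :> rat by rewrite pnatr_eq0 -lt0n.
have fE : t_component sl (h * N) (j * h%:Z) f = f.
  rewrite /t_component; have Hn : (h * N)%:R != 0 :> R[i] by rewrite pnatr_eq0 -lt0n.
  suff -> : \sum_(i < h * N) ee R (- (i%:R * ((j * h%:Z)%:~R / (h * N)%:R))) *: sl (upT i%:Z) f = (h * N)%:R *: f.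
    by rewrite scalerA mulVf // scale1r.
  transitivity (\sum_(i < h * N) f); last by rewrite sumr_const card_ord scaler_nat.
  apply: eq_bigr => i _; apply/funext => t.
  rewrite -[LHS]/(ee R _ * sl (upT i%:Z) f t) fTn mulrA -eeD.
  have -> : - (i%:R * ((j * h%:Z)%:~R / (h * N)%:R)) + i%:R * (j%:~R / N%:R) = 0 :> rat.
    by rewrite intrM natrM /=; field; rewrite hn hN.
  by rewrite ee0 mul1r.
have ha' := fourier_t_component (j * h%:Z) hN0 (fourier_inflate N0 ha).
rewrite fE in ha'; set a' := (fun _ => _) in ha'.
exists (fun n => a' (n * h%:Z)).
  apply: (fourier_deflate h0 ha').
    move=> n hn'; rewrite /a' ifF //; apply/negP => /eqP e; case/negP: hn'.
    have : (h * N %| n - j * h%:Z)%Z by rewrite -eqz_mod_dvd e.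
    rewrite PoszM => /(dvdz_trans (dvdz_mulr N%:Z (dvdzz h%:Z))).
    by rewrite rpredBr // dvdz_mull.
  move=> t; exists t; split; first by [].
  have hc : h%:R != 0 :> R[i] by rewrite pnatr_eq0 -lt0n.
  have Nc : N%:R != 0 :> R[i] by rewrite pnatr_eq0 -lt0n.
  by rewrite natrM; field; rewrite hc Nc.
move=> n; rewrite /a'; case: ifP => [|_]; last by rewrite eqxx.
rewrite eqz_mod_dvd PoszM -mulrBl [h%:Z * _]mulrC dvdz_mul2r; last by lia.
by move=> /= h1 _; apply/eqP; rewrite eqz_mod_dvd.
Qed.

End FourierAction.

(** * Sums over cosets *)

Section Cosets.
Variables (N : nat) (N0 : (0 < N)%N).
Implicit Types M g : 'M[int]_2.

(** The number is the lower left entry of M M'^-1, so membership of the quotient in Gamma_0(N) is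
    expressed by bottom rows alone. *)
Definition same_coset M M' : Prop :=
  (N %| M 1%R 0%R * M' 1%R 1%R - M 1%R 1%R * M' 1%R 0%R)%Z.

Lemma same_cosetP M M' : SL2Z M -> SL2Z M' ->
  same_coset M M' <-> exists2 g, Gamma0 N g & M = g *m M'.
Proof.
move=> hM hM'; have [iE hi] := SL2Z_inv hM'.
have e : (M *m invmx M') 1 0 = M 1 0 * M' 1 1 - M 1 1 * M' 1 0.
  by rewrite iE {1}(mat2_eta M) mat2_mul mxE /=; ring.
split=> [h|[g [hg gN] ->]].
  exists (M *m invmx M'); last by rewrite mulmxKV // SL2Z_unit.
  by split; [exact: SL2Z_mul|rewrite e].
rewrite /same_coset; suff -> : (g *m M') 1 0 * M' 1 1 - (g *m M') 1 1 * M' 1 0 = g 1 0 * \det M'.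
  exact: dvdz_mulr.
rewrite {1 2}(mat2_eta g) {1 3 5}(mat2_eta M') mat2_mul !mxE /= mat2_det; ring.
Qed.

Lemma same_coset_sym M M' : same_coset M M' -> same_coset M' M.
Proof.
rewrite /same_coset -rpredN => h; apply: etrans h; congr (_ %| _)%Z; ring.
Qed.

Lemma Gamma0_mul g g' : Gamma0 N g -> Gamma0 N g' -> Gamma0 N (g *m g').
Proof.
move=> [h1 d1] [h2 d2]; split; first exact: SL2Z_mul.
rewrite {1}(mat2_eta g) (mat2_eta g') mat2_mul mxE /=.
by apply: rpredD; [exact: dvdz_mulr|exact: dvdz_mull].
Qed.

Lemma same_coset_trans M1 M2 M3 : SL2Z M1 -> SL2Z M2 -> SL2Z M3 ->
  same_coset M1 M2 -> same_coset M2 M3 -> same_coset M1 M3.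
Proof.
move=> h1 h2 h3 /(same_cosetP h1 h2)[g hg ->] /(same_cosetP h2 h3)[g' hg' ->].
rewrite mulmxA; apply/same_cosetP => //; first by case: (Gamma0_mul hg hg') => ? _; exact: SL2Z_mul.
by exists (g *m g') => //; exact: Gamma0_mul.
Qed.

Lemma same_coset_mulr M M' K : SL2Z M -> SL2Z M' -> SL2Z K ->
  same_coset (M *m K) (M' *m K) <-> same_coset M M'.
Proof.
move=> h1 h2 h3; split.
  move=> /(same_cosetP (SL2Z_mul h1 h3) (SL2Z_mul h2 h3))[g hg e].
  apply/same_cosetP => //; exists g => //.
  by apply: (can_inj (mulmxK (SL2Z_unit h3))); rewrite e mulmxA.
move=> /(same_cosetP h1 h2)[g hg ->].
apply/(same_cosetP (SL2Z_mul (SL2Z_mul hg.1 h2) h3) (SL2Z_mul h2 h3)).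
by exists g => //; rewrite mulmxA.
Qed.

Variables (E : set 'M[int]_2) (Ereps : coset_reps N E).

Lemma coset_reps_inj M M' : E M -> E M' -> same_coset M M' -> M = M'.
Proof.
case: Ereps => ES Ex eM eM' /(same_cosetP (ES _ eM) (ES _ eM')) h.
have [M0 [_ u]] := Ex M (ES _ eM).
rewrite -(u M' (conj eM' h)); apply/esym/u; split=> //.
exists 1%:M; last by rewrite mul1mx.
by split; [exact: SL2Z_1|rewrite mxE dvdz0].
Qed.

(** Bottom rows modulo N separate the cosets. Finiteness turns the sum over the set [E] into a sum
    over a list; over infinitely many nonzero terms it would only have a default value. *)
Lemma coset_reps_finite : finite_set E.
Proof.
have res (x : int) : exists i : 'I_N, (x = i%:Z %[mod N])%Z.
  by have [i iN e] := modz_lt x N0; exists (Ordinal iN).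
pose f M : 'I_N * 'I_N := (projT1 (cid (res (M 1%R 0%R))), projT1 (cid (res (M 1%R 1%R)))).
have fE M : (M 1%R 0%R = (f M).1%:Z %[mod N])%Z /\ (M 1%R 1%R = (f M).2%:Z %[mod N])%Z.
  by split; [exact: (projT2 (cid (res (M 1%R 0%R))))|exact: (projT2 (cid (res (M 1%R 1%R))))].
have finj : {in E &, injective f}.
  move=> M M'; rewrite !inE => eM eM' e; apply: coset_reps_inj => //.
  rewrite /same_coset -eqz_mod_dvd; have [h1 h2] := fE M; have [h3 h4] := fE M'.
  rewrite -modzMm h1 h4 -[X in (_ == X)%Z]modzMm h2 h3 !modzMm e mulrC //.
rewrite -(eq_finite_set (inj_card_eq finj)).
exact: finite_finset.
Qed.

(** Change of representatives. The family [m] has to reach only the cosets where [h] is nonzero;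
    this allows the N cosets of S^-1 T^i to replace the whole of [E] below. *)
Lemma coset_sum (V : nmodType) (I : choiceType) (A : set I) (m : I -> 'M[int]_2) (h : 'M[int]_2 -> V) :
  (forall i, A i -> SL2Z (m i)) ->
  (forall i j, A i -> A j -> same_coset (m i) (m j) -> i = j) ->
  (forall M M', SL2Z M -> SL2Z M' -> same_coset M M' -> h M = h M') ->
  (forall M, SL2Z M -> h M <> 0 -> exists2 i, A i & same_coset M (m i)) ->
  \sum_(M \in E) h M = \sum_(i \in A) h (m i).
Proof.
move=> mS minj hinv cov; case: (Ereps) => ES Ex.
have /boolp.choice[rep repP] : forall M, exists M', SL2Z M -> E M' /\ same_coset M M'.
  move=> M.
  have [hM|hM] := pselect (SL2Z M); last by exists M => /hM.
  have [M' [[eM' h'] _]] := Ex M hM; exists M' => _; split=> //.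
  by apply/same_cosetP => //; exact: ES.
have repS i : A i -> SL2Z (rep (m i)) by move=> /mS/repP[/ES].
have -> : \sum_(i \in A) h (m i) = \sum_(i \in A) h (rep (m i)).
  apply: eq_fsbigr => i; rewrite inE => Ai; apply: hinv; [exact: mS|exact: repS|].
  by case: (repP _ (mS _ Ai)).
have rinj : set_inj A (rep \o m).
  move=> i j; rewrite !inE => Ai Aj /= e; apply: (minj _ _ Ai Aj).
  have [_ h1] := repP _ (mS _ Ai); have [_ h2] := repP _ (mS _ Aj).
  apply: (same_coset_trans (mS _ Ai) (repS _ Ai) (mS _ Aj) h1).
  by rewrite e; exact: same_coset_sym.
rewrite -(fsbig_image A (rep \o m) h rinj); apply/esym/fsbig_widen.
  by move=> _ [i Ai <-]; case: (repP _ (mS _ Ai)).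
move=> M [eM nM] /=; apply: contrapT => h0; apply: nM.
have [i Ai s] := cov M (ES _ eM) h0; exists i => //.
have [h1 h2] := repP _ (mS _ Ai).
apply/esym/coset_reps_inj => //.
exact: (same_coset_trans (ES _ eM) (mS _ Ai) (repS _ Ai)).
Qed.

Lemma coset_sum_mulr (V : nmodType) (h : 'M[int]_2 -> V) K : SL2Z K ->
  (forall M M', SL2Z M -> SL2Z M' -> same_coset M M' -> h M = h M') ->
  \sum_(M \in E) h M = \sum_(M \in E) h (M *m K).
Proof.
move=> hK hinv; case: (Ereps) => ES Ex; have [_ hi] := SL2Z_inv hK.
apply: coset_sum => //.
- by move=> M /ES hM; exact: SL2Z_mul.
- move=> M M' eM eM'; rewrite same_coset_mulr //; [exact: coset_reps_inj|exact: ES|exact: ES].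
move=> M hM _; have [M' [[eM' h'] _]] := Ex (M *m invmx K) (SL2Z_mul hM hi).
exists M' => //; rewrite -(mulmxKV (SL2Z_unit hK) M).
apply/same_coset_mulr => //; [exact: SL2Z_mul|exact: ES|].
by apply/same_cosetP => //; [exact: SL2Z_mul|exact: ES].
Qed.

End Cosets.

(** * The two maps *)

Section Eigen.
Variables (R : realType) (k : int).
Local Notation C := (R[i]^o).
Local Notation sl := (@sl R k).
Implicit Types (f g : upper R -> C) (t : upper R).

Lemma slashZ (M : 'M[R]_2) (c : R[i]) f : slash k M (c *: f) = c *: slash k M f.
Proof. by apply/funext => t; exact: mulrCA. Qed.

Lemma slash0 (M : 'M[R]_2) : slash k M (0 : upper R -> C) = 0.
Proof. by apply/funext => t; exact: mulr0. Qed.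

Lemma slashD (M : 'M[R]_2) f g : slash k M (f + g) = slash k M f + slash k M g.
Proof. by rewrite -[f in LHS]scale1r slash_lin scale1r. Qed.

Lemma slash_sum (M : 'M[R]_2) (I : Type) (s : seq I) (P : pred I) (F : I -> upper R -> C) :
  slash k M (\sum_(i <- s | P i) F i) = \sum_(i <- s | P i) slash k M (F i).
Proof. exact: (big_morph _ (slashD M) (slash0 M)). Qed.

Variables (N : nat) (N0 : (0 < N)%N) (d2 : two_part).
Hypothesis (loc : forall p, p \in primes N -> quadratic_char p N`_p (chi_at d2 p)).
Local Notation chi x := ((chiD N d2 x)%:~R : R[i]).

Definition eigen (G : 'M[int]_2 -> Prop) f :=
  forall M, G M -> sl M f = chi (M 1%R 1%R) *: f.

Lemma eigenB G f g : eigen G f -> eigen G g -> eigen G (f - g).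
Proof.
move=> hf hg M hM; rewrite -[- g]scaleN1r addrC.
rewrite [LHS]slash_lin -/(sl M f) -/(sl M g) (hf M hM) (hg M hM).
by rewrite scalerDr !scalerA [-1 * _]mulrC.
Qed.

Lemma eigenZ G (c : R[i]) f : eigen G f -> eigen G (c *: f).
Proof. by move=> hf M hM; rewrite /sl slashZ -/(sl M f) hf // !scalerA mulrC. Qed.

(** Here a d = 1 modulo N and chi is real, so chi(a) = chi(d). Conjugation by S exchanges a and d,
    hence does not change the character. *)
Lemma chi_diag M : SL2Z M -> (N %| M 0%R 1%R * M 1%R 0%R)%Z ->
  chiD N d2 (M 0%R 0%R) = chiD N d2 (M 1%R 1%R).
Proof.
rewrite {1}(mat2_eta M) SL2ZE => h hN.
suff /(chiD_inv N0 loc)[] : (M 0%R 0%R * M 1%R 1%R = 1 %[mod N])%Z by [].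
apply/eqP; rewrite eqz_mod_dvd -h (_ : _ - _ = M 0%R 1%R * M 1%R 0%R) //; ring.
Qed.

Lemma matS_conj (M : 'M[int]_2) :
  matS *m M = mat2 (M 1 1) (- M 1 0) (- M 0 1) (M 0 0) *m matS.
Proof. by rewrite {1}(mat2_eta M) !mat2_mul; congr mat2; ring. Qed.

Lemma eigen_S_upper0 f : eigen (Gamma0 N) f -> eigen (Gamma_upper0 N) (sl matS f).
Proof.
move=> hf M [hM hN]; have hc : SL2Z (mat2 (M 1 1) (- M 1 0) (- M 0 1) (M 0 0)).
  by move: hM; rewrite {1}(mat2_eta M) !SL2ZE => <-; ring.
rewrite -(slM k f SL2Z_S hM) matS_conj (slM k f hc SL2Z_S).
rewrite hf; last by split=> //; rewrite mxE /= rpredN.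
rewrite /sl slashZ mxE /= chi_diag //; exact: dvdz_mulr.
Qed.

Lemma eigen_S_Gamma0 f : eigen (Gamma_upper0 N) f -> eigen (Gamma0 N) (sl matS f).
Proof.
move=> hf M [hM hN]; have hc : SL2Z (mat2 (M 1 1) (- M 1 0) (- M 0 1) (M 0 0)).
  by move: hM; rewrite {1}(mat2_eta M) !SL2ZE => <-; ring.
rewrite -(slM k f SL2Z_S hM) matS_conj (slM k f hc SL2Z_S).
rewrite hf; last by split=> //; rewrite mxE /= rpredN.
rewrite /sl slashZ mxE /= chi_diag //; exact: dvdz_mull.
Qed.

Definition shrunk f : upper R -> C := fun t => f (shrink N t).
Definition dilated f : upper R -> C := fun t => f (dilate N t).

Lemma shrunkK f : dilated (shrunk f) = f.
Proof. by apply/funext => t; rewrite /dilated /shrunk dilateK. Qed.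

Lemma dilatedK f : shrunk (dilated f) = f.
Proof. by apply/funext => t; rewrite /dilated /shrunk shrinkK. Qed.

Lemma powR_unit (x : R) : (N%:R `^ x)%:C%C != 0 :> R[i].
Proof. by rewrite (fmorph_eq0 (real_complex R)) gt_eqF // powR_gt0 // ltr0n. Qed.

Lemma shrunkE f : shrunk f = ((N%:R `^ (- (k%:~R / 2)))%:C%C)^-1 *: slash k (mat2 1 0 0 N%:R) f.
Proof.
apply/funext => t; rewrite -[RHS]/(_ * slash k (mat2 1 0 0 N%:R) f t) slash_shrink //.
by rewrite mulKf // powR_unit.
Qed.

Lemma dilatedE f : dilated f = ((N%:R `^ (k%:~R / 2))%:C%C)^-1 *: slash k (mat2 N%:R 0 0 1) f.
Proof.
apply/funext => t; rewrite -[RHS]/(_ * slash k (mat2 N%:R 0 0 1) f t) slash_dilate //.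
by rewrite mulKf // powR_unit.
Qed.

Lemma det_shrink : 0 < \det (mat2 1 0 0 N%:R : 'M[R]_2).
Proof. by rewrite mat2_det mulr0 subr0 mul1r ltr0n. Qed.

Lemma det_dilate : 0 < \det (mat2 N%:R 0 0 1 : 'M[R]_2).
Proof. by rewrite mat2_det mulr0 subr0 mulr1 ltr0n. Qed.

Lemma eigen_shrunk f : eigen (Gamma0 N) f -> eigen (Gamma_upper0 N) (shrunk f).
Proof.
move=> hf; rewrite shrunkE; apply: eigenZ => M [hM /dvdzP[b bE]].
have hM' : SL2Z (mat2 (M 0 0) b (M 1 0 * N%:Z) (M 1 1)).
  by move: hM; rewrite {1}(mat2_eta M) !SL2ZE bE => <-; ring.
have e : mat2 1 0 0 N%:R *m Defs.realmx R M =
    Defs.realmx R (mat2 (M 0 0) b (M 1 0 * N%:Z) (M 1 1)) *m mat2 1 0 0 N%:R.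
  rewrite {1}(mat2_eta M) !realmx_mat2 !mat2_mul bE !intrM; congr mat2; ring.
rewrite /sl -(slashM k f det_shrink (sl_det_gt0 R hM)) e.
rewrite (slashM k f (sl_det_gt0 R hM') det_shrink) -/(sl _ f) hf; last first.
  by split=> //; rewrite mxE /= dvdz_mull.
by rewrite slashZ mxE.
Qed.

Lemma eigen_dilated f : eigen (Gamma_upper0 N) f -> eigen (Gamma0 N) (dilated f).
Proof.
move=> hf; rewrite dilatedE; apply: eigenZ => M [hM /dvdzP[c cE]].
have hM' : SL2Z (mat2 (M 0 0) (M 0 1 * N%:Z) c (M 1 1)).
  by move: hM; rewrite {1}(mat2_eta M) !SL2ZE cE => <-; ring.
have e : mat2 N%:R 0 0 1 *m Defs.realmx R M =
    Defs.realmx R (mat2 (M 0 0) (M 0 1 * N%:Z) c (M 1 1)) *m mat2 N%:R 0 0 1.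
  rewrite {1}(mat2_eta M) !realmx_mat2 !mat2_mul cE !intrM; congr mat2; ring.
rewrite /sl -(slashM k f det_dilate (sl_det_gt0 R hM)) e.
rewrite (slashM k f (sl_det_gt0 R hM') det_dilate) -/(sl _ f) hf; last first.
  by split=> //; rewrite mxE /= dvdz_mull.
by rewrite slashZ mxE.
Qed.

Lemma slash_W_shrunk f : slash k (matW R N) f = (N%:R `^ (- (k%:~R / 2)))%:C%C *: sl matS (shrunk f).
Proof.
rewrite matW_shrink (slashM k f det_shrink (sl_det_gt0 R SL2Z_S)) shrunkE /sl slashZ scalerA.
by rewrite mulfV ?powR_unit // scale1r.
Qed.

Lemma slash_W_dilated f : slash k (matW R N) f = (N%:R `^ (k%:~R / 2))%:C%C *: dilated (sl matS f).
Proof.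
rewrite matW_dilate (slashM k f (sl_det_gt0 R SL2Z_S) det_dilate) dilatedE scalerA.
by rewrite mulfV ?powR_unit // scale1r.
Qed.

Lemma sqrt_const : (N%:R `^ ((k - 1)%:~R / 2)) * (N%:R `^ (- (k%:~R / 2))) = (Num.sqrt N%:R)^-1 :> R.
Proof.
have Nn : (N%:R : R) != 0 by rewrite pnatr_eq0 -lt0n.
rewrite -powRD; last by rewrite Nn implybT.
have -> : (k - 1)%:~R / 2 + - (k%:~R / 2) = - 2^-1 :> R by rewrite rmorphB /=; field.
by rewrite powRN powR12_sqrt ?ler0n.
Qed.

Lemma sqrt_const' : (N%:R `^ (- ((k - 1)%:~R / 2))) * (N%:R `^ (k%:~R / 2)) = Num.sqrt N%:R :> R.
Proof.
have Nn : (N%:R : R) != 0 by rewrite pnatr_eq0 -lt0n.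
rewrite -powRD; last by rewrite Nn implybT.
have -> : - ((k - 1)%:~R / 2) + k%:~R / 2 = 2^-1 :> R by rewrite rmorphB /=; field.
by rewrite powR12_sqrt ?ler0n.
Qed.

End Eigen.

(** * Vector-valued forms and the map phi *)

Section VectorForms.
Variables (R : realType) (D : finZmodType) (q : D -> rat) (delta : nat -> int).
Variables (d2 : two_part) (N : nat) (r k : int).
Variable rho : 'M[int]_2 -> {linear group_space R D -> group_space R D}.
Hypotheses (Dform : discriminant_form q) (Dshape : special_shape q delta d2).
Hypotheses (Nlevel : is_level q N) (rhoWeil : weil_rep q r rho).
Local Notation C := (R[i]^o).
Local Notation sl := (@sl R k).
Local Notation w := (weil_const R D r).
Local Notation eigen := (@eigen R k N d2).
Local Notation tcomp := (t_component sl N).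
Implicit Types (F : upper R -> group_space R D) (f : upper R -> C).

Let N0 := level_gt0 Nlevel.
Let loc p (pN : p \in primes N) := local_structure_of_shape Dform Dshape Nlevel pN.
Let locc p (pN : p \in primes N) := local_char (loc pN).
Let Nn : N%:R != 0 :> rat. Proof. by rewrite pnatr_eq0 -lt0n. Qed.
Let Nc : N%:R != 0 :> R[i]. Proof. by rewrite pnatr_eq0 -lt0n. Qed.

Lemma sum_basis_vec (x : D -> C) b : (\sum_g x g *: basis_vec R g) b = x b.
Proof.
rewrite sum_ffunE (bigD1 b) //= big1 => [|g gb]; rewrite !ffunE /GRing.scale /=.
  by rewrite eqxx addr0 mulr1.
by rewrite eq_sym (negPf gb) mulr0.
Qed.

Lemma vector_slash F M g : vector_forms rho k F -> SL2Z M ->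
  sl M (component F g) = fun t => rho M (F t) g.
Proof.
by move=> [hF _] hM; apply/funext => t; rewrite -hF // sum_basis_vec.
Qed.

Lemma vector_upT F (n : int) g : vector_forms rho k F ->
  sl (upT n) (component F g) = ee R (n%:~R * q g) *: component F g.
Proof.
move=> hF; rewrite (vector_slash g hF (SL2Z_upT n)); apply/funext => t.
by rewrite (rho_upT Nlevel rhoWeil).
Qed.

Definition component_sum F : upper R -> C := \sum_g component F g.

Lemma totalE F t : component_sum F t = \sum_g F t g.
Proof. by rewrite /component_sum fct_sumE. Qed.

Lemma vector_S F : vector_forms rho k F -> sl matS (component F 0) = w *: component_sum F.
Proof.
move=> hF; rewrite (vector_slash 0 hF SL2Z_S); apply/funext => t.
rewrite (rho_S rhoWeil) -[RHS]/(w * component_sum F t) totalE; congr (_ * _).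
apply: eq_bigr => g _.
by rewrite (ee_eq R (eqQZN (bil0l Dform g))) oppr0 ee0 mul1r.
Qed.

Lemma vector_Gamma0 F : vector_forms rho k F -> eigen (Gamma0 N) (component F 0).
Proof.
move=> hF M hM; rewrite (vector_slash 0 hF hM.1); apply/funext => t.
by rewrite (rho_Gamma0_at0 Dform Dshape Nlevel rhoWeil).
Qed.

Let w0 : w != 0. Proof. exact: (weil_const_neq0 R Dform r Dshape Nlevel). Qed.

Lemma total_eigen F : vector_forms rho k F -> eigen (Gamma_upper0 N) (component_sum F).
Proof.
move=> hF; rewrite -[component_sum F]scale1r -(mulVf w0) -scalerA -vector_S //.
exact/eigenZ/(eigen_S_upper0 N0 locc)/vector_Gamma0.
Qed.

(** The constants of phi are inverse to those of S: N^(-(k-1)/2) N^(k/2) is the square root of N,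
    and with i^(r/2) it cancels [weil_const]. Thus phi only depends on the sum of the components. *)
Lemma phiE F : vector_forms rho k F -> phi N r k F = 2 ^- omega N *: dilated N (component_sum F).
Proof.
move=> hF; apply/funext => t; rewrite /phi (slash_W_dilated k N0) vector_S //.
rewrite -[RHS]/(2 ^- omega N * component_sum F (dilate N t)).
rewrite -[X in _ * X = _]/((N%:R `^ (k%:~R / 2))%:C%C * (w * component_sum F (dilate N t))).
have i0 : 'i%C != 0 :> R[i].
  by apply/eqP => h; have := sqr_i R; rewrite h expr0n => /esym/eqP; rewrite oppr_eq0 oner_eq0.
have := sqrt_const' R k N0 => /(congr1 (real_complex R)); rewrite rmorphM /=.
set A := (N%:R `^ _)%:C%C; set B := (N%:R `^ _)%:C%C => AB.
have wE : 'i%C ^ (r %/ 2)%Z * (A * B) * w = 1.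
  have s0 : (Num.sqrt N%:R)%:C%C != 0 :> R[i].
    by rewrite (fmorph_eq0 (real_complex R)) sqrtr_eq0 -ltNge ltr0n.
  rewrite AB /weil_const (card_D Dform Dshape Nlevel) -invr_expz.
  have I0 : 'i%C ^ (r %/ 2)%Z != 0 :> R[i] by exact: expfz_neq0.
  by rewrite mulrACA (divff I0) (divff s0) mulr1.
have e (I T a b v x : R[i]) : I * T * a * (b * (v * x)) = (I * (a * b) * v) * (T * x) by ring.
by rewrite e wE mul1r.
Qed.

Lemma level_condE b j : (Nq q N b == j %[mod N])%Z = (q b - j%:~R / N%:R \is a Num.int).
Proof.
rewrite eqz_mod_dvd -(divz_int _ N0) rmorphB /= (NqE _ Nlevel); congr (_ \is a _).
by rewrite mulrBl mulrC mulKf.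
Qed.

Lemma tcompD j f g : tcomp j (f + g) = tcomp j f + tcomp j g.
Proof.
rewrite /t_component -scalerDr -big_split; congr (_ *: _); apply: eq_bigr => i _.
by rewrite /sl slashD scalerDr.
Qed.

Lemma tcompZ j (c : R[i]) f : tcomp j (c *: f) = c *: tcomp j f.
Proof.
rewrite /t_component [RHS]scalerA [c * _]mulrC -[RHS]scalerA; congr (_ *: _).
rewrite scaler_sumr; apply: eq_bigr => i _.
by rewrite /sl slashZ !scalerA [c * _]mulrC.
Qed.

Lemma tcomp0 j : tcomp j 0 = 0.
Proof. by have := tcompZ j 0 0; rewrite !scale0r. Qed.

Lemma tcomp_mod j j' f : (j = j' %[mod N])%Z -> tcomp j f = tcomp j' f.
Proof.
move=> /eqP; rewrite eqz_mod_dvd -(divz_int _ N0) rmorphB /= mulrBl => h.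
rewrite /t_component; apply: (congr1 (GRing.scale _)); apply: eq_bigr => i _.
apply: (congr1 (fun c : R[i] => c *: _)); apply: ee_eq; apply: eqQZN; exact: (eqQZZ i%:Z h).
Qed.

Lemma tcomp_component F j g : vector_forms rho k F ->
  tcomp j (component F g) = if (Nq q N g == j %[mod N])%Z then component F g else 0.
Proof.
move=> hF; rewrite /t_component.
under eq_bigr => i _ do rewrite vector_upT // scalerA -eeD.
rewrite -scaler_suml.
have -> : \sum_(i < N) ee R (- (i%:R * (j%:~R / N%:R)) + i%:Z%:~R * q g) =
    \sum_(i < N) ee R (i%:R * ((Nq q N g - j)%:~R / N%:R)).
  apply: eq_bigr => i _; congr ee; rewrite rmorphB /= (NqE _ Nlevel).
  by rewrite -[i%:Z%:~R]/(i%:R : rat); field.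
rewrite sum_ee // eqz_mod_dvd scalerA; case: ifP => _.
  by rewrite mulVf // scale1r.
by rewrite mulr0 scale0r.
Qed.

Lemma tcomp_total F j : vector_forms rho k F ->
  tcomp j (component_sum F) = \sum_(g | (Nq q N g == j %[mod N])%Z) component F g.
Proof.
move=> hF; rewrite [LHS](big_morph _ (tcompD j) (tcomp0 j)).
rewrite [RHS]big_mkcond; apply: eq_bigr => g _; exact: tcomp_component.
Qed.

Lemma component_aut F g b : vector_forms_inv q rho k F ->
  (Nq q N g = Nq q N b %[mod N])%Z -> component F g = component F b.
Proof.
move=> [hF hs] /eqP; rewrite level_condE (NqE _ Nlevel) mulrC mulKf // => h.
have [s sa sg] := level_set_transitive Dform Nlevel loc h.
by apply/funext => t; rewrite -sg /component hs.
Qed.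

Lemma tcomp_total_inv F g : vector_forms_inv q rho k F ->
  tcomp (Nq q N g) (component_sum F) = (level_count q N N (Nq q N g))%:R *: component F g.
Proof.
move=> hF; rewrite tcomp_total; last by case: hF.
rewrite (level_set_count Dform Nlevel).
under eq_bigr => b /eqP hb do rewrite (component_aut hF hb).
rewrite sumr_const scaler_nat; congr (_ *+ _); apply: eq_card => b.
by rewrite [RHS]inE; exact: level_condE.
Qed.

Lemma level_count_Nq g : level_count q N N (Nq q N g) != 0%N.
Proof.
rewrite (level_set_count Dform Nlevel) -lt0n; apply/card_gt0P; exists g.
by rewrite inE -level_condE.
Qed.

(** The projector isolates [level_count] equal components; dividing 2^omega(N) by this count leaves
    s. *)
Lemma component_of_total F f g : vector_forms_inv q rho k F ->
  component_sum F = 2 ^+ omega N *: f ->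
  component F g = (s_mult N (Nq q N g))%:R *: tcomp (Nq q N g) f.
Proof.
move=> hF h; have := tcomp_total_inv g hF; rewrite h tcompZ.
have c0 : (level_count q N N (Nq q N g))%:R != 0 :> R[i] by rewrite pnatr_eq0 level_count_Nq.
rewrite -natrX -(level_count_s Dform Nlevel loc (level_count_Nq g)) natrM -scalerA.
by move=> /(scalerI c0).
Qed.

Lemma inv_of_total F G : vector_forms_inv q rho k F -> vector_forms_inv q rho k G ->
  component_sum F = component_sum G -> F = G.
Proof.
move=> hF hG e; apply/funext => t; apply/ffunP => g.
have c0 : (level_count q N N (Nq q N g))%:R != 0 :> R[i] by rewrite pnatr_eq0 level_count_Nq.
have := tcomp_total_inv g hF; rewrite e (tcomp_total_inv g hG) => /(scalerI c0) h.
by rewrite -[LHS]/(component F g t) -h.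
Qed.

(** Reduces the behaviour at every cusp to that of the components at infinity. *)
Lemma slash_component F M g : vector_forms rho k F -> SL2Z M ->
  sl M (component F g) = \sum_b rho M (basis_vec R b) g *: component F b.
Proof.
move=> hF hM; rewrite (vector_slash g hF hM); apply/funext => t.
rewrite fct_sumE {1}(group_spaceE (F t)) linear_sum sum_ffunE; apply: eq_bigr => b _.
rewrite linearZ ffunE; exact: mulrC.
Qed.

Lemma holomorphic_dilated f : holomorphic f -> holomorphic (dilated N f).
Proof.
by move=> hf; rewrite (dilatedE k N0); apply/holomorphicZ/holomorphic_slash => //; exact: det_dilate.
Qed.

Lemma holomorphic_shrunk f : holomorphic f -> holomorphic (shrunk N f).
Proof.
by move=> hf; rewrite (shrunkE k N0); apply/holomorphicZ/holomorphic_slash => //; exact: det_shrink.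
Qed.

Lemma meromorphic_dilated f M : (forall K, SL2Z K -> meromorphic_infty (sl K f)) -> SL2Z M ->
  meromorphic_infty (sl M (dilated N f)).
Proof.
move=> mf hM; rewrite (dilatedE k N0) /sl slashZ; apply: meromorphicZ.
rewrite -(slashM k f (det_dilate R N0) (sl_det_gt0 R hM)).
have -> : mat2 N%:R 0 0 1 *m Defs.realmx R M = Defs.realmx R (mat2 N%:Z 0 0 1 *m M).
  by rewrite [RHS]map_mxM -[map_mx _ _]/(Defs.realmx R _) realmx_mat2 rmorph0 rmorph1.
apply: (meromorphic_slash_integral mf).
by rewrite det_mulmx mat2_det hM mulr0 subr0 !mulr1 ltz_nat.
Qed.

Lemma meromorphic_shrunk f M : (forall K, SL2Z K -> meromorphic_infty (sl K f)) -> SL2Z M ->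
  meromorphic_infty (sl M (shrunk N f)).
Proof.
move=> mf hM; rewrite (shrunkE k N0) /sl slashZ; apply: meromorphicZ.
rewrite -(slashM k f (det_shrink R N0) (sl_det_gt0 R hM)).
have -> : mat2 1 0 0 N%:R *m Defs.realmx R M = Defs.realmx R (mat2 1 0 0 N%:Z *m M).
  by rewrite [RHS]map_mxM -[map_mx _ _]/(Defs.realmx R _) realmx_mat2 rmorph0 rmorph1.
apply: (meromorphic_slash_integral mf).
by rewrite det_mulmx mat2_det hM mulr0 subr0 !mulr1 mul1r ltz_nat.
Qed.

Lemma phi_scalar_forms F : vector_forms_inv q rho k F ->
  scalar_forms_eps N k delta d2 (phi N r k F).
Proof.
move=> [hF hs]; have [hF1 hF2] := hF; rewrite phiE //; split; first split.
- apply/holomorphicZ/holomorphic_dilated/holomorphic_sum => g _.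
  by case: (hF2 g).
- move=> M hM; rewrite slashZ; apply/meromorphicZ/meromorphic_dilated => // K hK.
  rewrite /sl slash_sum; apply: meromorphic_sum => g _; rewrite -/(sl K _) slash_component //.
  apply: meromorphic_sum => b _; apply: meromorphicZ; by case: (hF2 b).
- move=> M hM t; have := eigenZ (2 ^- omega N) (eigen_dilated N0 (total_eigen hF)) hM.
  by move=> /(congr1 (@^~ t)).
have /boolp.choice[b hb] : forall g, exists b : int -> C, fourier N (component F g) b /\
    forall n, b n != 0 -> (n = Nq q N g %[mod N])%Z.
  move=> g; have [b b1 b2] : exists2 b : int -> C, fourier N (component F g) b &
      forall n, b n != 0 -> (n = Nq q N g %[mod N])%Z; last by exists b.
    apply: fourier_quasiperiodic => //; first by case: (hF2 g).
    move=> t; have := congr1 (@^~ t) (vector_upT 1 g hF).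
    rewrite sl_upT rmorph1 mul1r (NqE _ Nlevel) mulrAC divff // mul1r; exact.
exists (fun n => 2 ^- omega N * \sum_g b g n); split.
  apply: fourierZ; apply: (fourier_dilate N0); rewrite mul1n.
  by apply: fourier_sum => g; case: (hb g).
(* A nonzero coefficient of F_g sits at an exponent congruent to N q(g). This class is represented
   by q, so every factor 1 + eps_p chi_p(n) is nonzero. *)
move=> n p pN e; rewrite big1 ?mulr0 // => g _; apply/eqP; apply: contraT => bn.
have [_ /(_ n bn) ng] := hb g.
suff c0 : level_count q N N n != 0%N by have := level_count_neq0 Dform Nlevel loc c0 pN; rewrite e eqxx.
rewrite (level_set_count Dform Nlevel) -lt0n; apply/card_gt0P; exists g.
by rewrite inE -level_condE ng.
Qed.

End VectorForms.

Lemma SL2Z_invM M M' : SL2Z M -> SL2Z M' -> invmx (M *m M') = invmx M' *m invmx M.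
Proof.
move=> h h'; have u := SL2Z_unit (SL2Z_mul h h').
apply: (can_inj (mulKmx u)); rewrite (mulmxV u) -mulmxA (mulmxA M').
by rewrite (mulmxV (SL2Z_unit h')) mul1mx mulmxV // SL2Z_unit.
Qed.

(** * The map psi as a sum over cosets *)

Section Psi.
Variables (R : realType) (D : finZmodType) (q : D -> rat) (delta : nat -> int).
Variables (d2 : two_part) (N : nat) (r k : int).
Variable rho : 'M[int]_2 -> {linear group_space R D -> group_space R D}.
Variable E : set 'M[int]_2.
Hypotheses (Dform : discriminant_form q) (Dshape : special_shape q delta d2).
Hypotheses (Nlevel : is_level q N) (rhoWeil : weil_rep q r rho).
Hypothesis Ereps : coset_reps N E.
Local Notation C := (R[i]^o).
Local Notation sl := (@sl R k).
Local Notation w := (weil_const R D r).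
Local Notation eigen := (@eigen R k N d2).
Local Notation tcomp := (t_component sl N).
Local Notation e0 := (basis_vec R (0 : D)).
Local Notation psi := (psi rho N r k E).
Implicit Types (f : upper R -> C) (t : upper R).

Let N0 := level_gt0 Nlevel.
Let loc p (pN : p \in primes N) := local_structure_of_shape Dform Dshape Nlevel pN.
Let locc p (pN : p \in primes N) := local_char (loc pN).
Let Nn : N%:R != 0 :> rat. Proof. by rewrite pnatr_eq0 -lt0n. Qed.
Let Nc : N%:R != 0 :> R[i]. Proof. by rewrite pnatr_eq0 -lt0n. Qed.
Let Efin : finite_set E. Proof. exact: (coset_reps_finite N0 Ereps). Qed.
Let ES M : E M -> SL2Z M. Proof. by case: Ereps => h _; exact: h. Qed.

Definition psi_const : R[i] := 'i%C ^ (r %/ 2)%Z * (Num.sqrt N%:R)%:C%C^-1.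

(** Together, the constant of psi and the one of S give the factor 1/N of the projector
    [t_component]. *)
Lemma psi_const_weil : psi_const * w = N%:R^-1.
Proof.
have i0 : 'i%C != 0 :> R[i].
  by apply/eqP => h; have := sqr_i R; rewrite h expr0n => /esym/eqP; rewrite oppr_eq0 oner_eq0.
have I0 : 'i%C ^ (r %/ 2)%Z != 0 :> R[i] by exact: expfz_neq0.
rewrite /psi_const /weil_const (card_D Dform Dshape Nlevel) -invr_expz mulrACA (divff I0) mul1r.
rewrite -invfM -rmorphM /= -expr2 sqr_sqrtr ?ler0n // rmorph_nat //.
Qed.

Definition reps : seq 'M[int]_2 := finmap.enum_fset (fset_set E).

Lemma sum_reps (V : nmodType) (h : 'M[int]_2 -> V) :
  \sum_(M \in E) h M = \sum_(M <- reps) h M.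
Proof. exact: fsbig_finite. Qed.

Lemma repsS M : M \in reps -> SL2Z M.
Proof. by rewrite -[_ \in _]/(M \in fset_set E) in_fset_set // => /set_mem/ES. Qed.

Definition start f : upper R -> C := sl matS (shrunk N f).

Lemma psiE f t : psi f t =
  psi_const *: \sum_(M <- reps) (sl M (start f) t *: rho (invmx M) e0).
Proof.
rewrite /Defs.psi sum_reps.
have kE : 'i%C ^ (r %/ 2)%Z * (N%:R `^ ((k - 1)%:~R / 2))%:C%C * (N%:R `^ (- (k%:~R / 2)))%:C%C = psi_const.
  by rewrite -mulrA -rmorphM (sqrt_const R k N0) fmorphV.
rewrite -kE -[RHS]scalerA; apply: (congr1 (GRing.scale _)).
rewrite scaler_sumr; apply: eq_bigr => M _.
rewrite scalerA; apply: (congr1 (fun c : R[i] => c *: _)).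
by rewrite (slash_W_shrunk k N0) slashZ.
Qed.

Lemma psi_component f g : component (psi f) g =
  \sum_(M <- reps) (psi_const * rho (invmx M) e0 g) *: sl M (start f).
Proof.
apply/funext => t; rewrite /component psiE fct_sumE ffunE sum_ffunE [LHS]mulr_sumr.
apply: eq_bigr => M _; rewrite ffunE.
have e (a b c : R[i]) : a * (b * c) = a * c * b by ring.
exact: e.
Qed.

Section OneForm.
Variable f : upper R -> C.
Hypothesis f_eigen : eigen (Gamma0 N) f.

Lemma start_eigen : eigen (Gamma0 N) (start f).
Proof. exact/(eigen_S_Gamma0 N0 locc)/eigen_shrunk. Qed.

Let H t M : group_space R D := sl M (start f) t *: rho (invmx M) e0.

(** Changing M by g in Gamma_0(N) multiplies the form by chi(d) and the vector, through g^-1 e_0,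
    again by chi(d); the square is 1. *)
Lemma start_coset t M M' : SL2Z M -> SL2Z M' -> same_coset N M M' -> H t M = H t M'.
Proof.
move=> hM hM' /(same_cosetP N hM hM')[g hg ->]; have [hgS hgN] := hg.
have [iE iS] := SL2Z_inv hgS; have [_ iS'] := SL2Z_inv hM'.
have igN : Gamma0 N (invmx g) by split=> //; rewrite iE mxE /= rpredN.
have e1 : sl (g *m M') (start f) t = (chiD N d2 (g 1 1))%:~R * sl M' (start f) t.
  by rewrite (slM k _ hgS hM') (start_eigen hg) /sl slashZ.
have e2 : rho (invmx (g *m M')) e0 = (chiD N d2 (g 1 1))%:~R *: rho (invmx M') e0.
  rewrite (SL2Z_invM hgS hM') (rhoM rhoWeil _ iS' iS).
  by rewrite (rho_Gamma0 Dform Dshape Nlevel rhoWeil igN) linearZ iE mxE.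
have [_ x2] : chiD N d2 (g 1 1) = chiD N d2 (g 0 0) /\ chiD N d2 (g 1 1) ^+ 2 = 1.
  apply: (chiD_inv N0 locc); apply/eqP; rewrite eqz_mod_dvd.
  move: hgS; rewrite {1}(mat2_eta g) SL2ZE => <-.
  have -> : g 1 1 * g 0 0 - (g 0 0 * g 1 1 - g 0 1 * g 1 0) = g 0 1 * g 1 0 by ring.
  exact: dvdz_mull.
have x2' : (chiD N d2 (g 1 1))%:~R * (chiD N d2 (g 1 1))%:~R = 1 :> R[i].
  by rewrite -intrM -expr2 x2.
by rewrite /H e1 e2 scalerA mulrAC x2' mul1r.
Qed.

(** Right translation by M permutes the cosets, and rho(M) applied to (K M)^-1 e_0 gives K^-1
    e_0. *)
Lemma psi_slash M t g : SL2Z M -> sl M (component (psi f) g) t = rho M (psi f t) g.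
Proof.
move=> hM; have [_ iS] := SL2Z_inv hM; pose h K : R[i] := rho M (H t K) g.
transitivity (psi_const * \sum_(K <- reps) h (K *m M)).
  rewrite psi_component /sl slash_sum fct_sumE mulr_sumr !big_seq.
  apply: eq_bigr => K /repsS hK; rewrite slashZ /h /H (slM k _ hK hM) linearZ ffunE.
  rewrite -(rhoM rhoWeil _ hM); last by case: (SL2Z_inv (SL2Z_mul hK hM)).
  rewrite (SL2Z_invM hK hM) mulmxA (mulmxV (SL2Z_unit hM)) mul1mx.
  have e (a b c : R[i]) : a * b * c = a * (c * b) by ring.
  exact: e.
have -> : rho M (psi f t) = psi_const *: \sum_(K <- reps) rho M (H t K).
  rewrite psiE; set v := \sum_(K <- _) _.
  by rewrite [LHS](linearZ_LR (rho M)) linear_sum.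
rewrite ffunE sum_ffunE; apply: (congr1 (fun c : R[i] => psi_const * c)).
rewrite -[LHS](sum_reps (fun K => h (K *m M))) -[RHS](sum_reps h).
apply/esym/(coset_sum_mulr Ereps hM) => K K' hK hK' e.
by rewrite /h (start_coset t hK hK' e).
Qed.

Hypothesis f_hol : holomorphic f.
Hypothesis f_mer : forall M, SL2Z M -> meromorphic_infty (sl M f).

Lemma psi_vector_forms : vector_forms_inv q rho k (psi f).
Proof.
split; first split.
- move=> M hM t; apply/ffunP => g; rewrite sum_basis_vec; exact: psi_slash.
- move=> g; rewrite psi_component big_seq; split.
    apply: holomorphic_sum => K /repsS hK; apply: holomorphicZ.
    apply: holomorphic_slash; first exact: (sl_det_gt0 R hK).
    apply: holomorphic_slash; first exact: (sl_det_gt0 R SL2Z_S).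
    exact: (holomorphic_shrunk k Nlevel).
  apply: meromorphic_sum => K /repsS hK; apply: meromorphicZ.
  rewrite /start -(slM k _ SL2Z_S hK).
  exact: (meromorphic_shrunk Nlevel f_mer (SL2Z_mul SL2Z_S hK)).
move=> s sa g t; rewrite psiE !ffunE !sum_ffunE; congr (_ * _).
rewrite !big_seq; apply: eq_bigr => K /repsS hK; rewrite !ffunE.
by rewrite (rho_e0_aut Nlevel rhoWeil g _ sa) //; case: (SL2Z_inv hK).
Qed.

(* For [coprimez (N q(g)) N] only the cosets of [S^-1 T^i] contribute. *)
Lemma psi_coprime g : coprimez (Nq q N g) N ->
  component (psi f) g = tcomp (Nq q N g) (shrunk N f).
Proof.
move=> gN; apply/funext => t.
pose h K : R[i] := H t K g.
pose m (i : 'I_N) : 'M[int]_2 := invmx matS *m upT i%:Z.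
have [SE iS] := SL2Z_inv SL2Z_S.
have mE i : m i = mat2 0 1 (-1) (- i%:Z).
  rewrite /m SE /matS !mxE /= /upT mat2_mul; congr mat2; ring.
have mS i : SL2Z (m i) by exact: SL2Z_mul.
have sumE : \sum_(K <- reps) h K = \sum_(i < N) h (m i).
  rewrite -(sum_reps h).
  have -> : \sum_(i < N) h (m i) = \sum_(i \in [set` (predT : {pred 'I_N})]) h (m i).
    apply: bigfs => [|i _]; first exact: index_enum_uniq.
    by rewrite mem_index_enum.
  apply: (coset_sum Ereps).
  - by move=> i _; exact: mS.
  - move=> i j _ _; rewrite !mE /same_coset !mxE /=.
    have -> : -1 * - j%:Z - - i%:Z * -1 = j%:Z - i%:Z by ring.
    rewrite -eqz_mod_dvd => /eqP; rewrite !modz_nat !modn_small ?ltn_ord // => -[e].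
    exact/val_inj.
  - by move=> K K' hK hK' e; rewrite /h (start_coset t hK hK' e).
  move=> K hK h0; have [KE iK] := SL2Z_inv hK.
  have v0 : rho (invmx K) e0 g != 0.
    by apply/eqP => v0; apply: h0; rewrite /h /H ffunE v0; exact: mulr0.
  (* A prime dividing both N and the lower left entry would divide N q(g) by [rho_e0_support]. *)
  have cN : coprimez (K 1%R 0%R) N.
    rewrite coprimezE /=; apply: contraT => nc.
    set x := gcdn `|K 1%R 0%R| N in nc *.
    have x1 : (1 < x)%N by rewrite ltn_neqAle eq_sym nc /= gcdn_gt0 N0 orbT.
    have px := pdiv_prime x1; have pdx := pdiv_dvd x.
    have pN : pdiv x \in primes N.
      by rewrite mem_primes px N0 (dvdn_trans pdx) // dvdn_gcdr.
    have pc : (pdiv x %| (invmx K) 1%R 0%R)%Z.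
      by rewrite KE mxE /= rpredN dvdzE /= (dvdn_trans pdx) // dvdn_gcdl.
    have pg := rho_e0_support Dform Dshape Nlevel rhoWeil iK pN pc v0.
    have : (pdiv x %| gcdn `|Nq q N g| N)%N.
      by move: pg; rewrite dvdzE /= dvdn_gcd => ->; rewrite (dvdn_trans pdx) // dvdn_gcdr.
    move: gN; rewrite coprimezE /= /coprime => /eqP ->.
    by rewrite dvdn1 => /eqP p1; move: px; rewrite p1.
  (* With u inverse to the lower left entry c modulo N, the row (c, d) is proportional to (-1, -i)
     modulo N for i = u d. *)
  have [[u v] /= uv] := coprimezP _ _ cN.
  have [i iN ei] := modz_lt (u * K 1%R 1%R) N0; exists (Ordinal iN) => //.
  rewrite mE /same_coset !mxE /=.
  move/eqP: ei; rewrite eqz_mod_dvd => /dvdzP[l hl].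
  apply/dvdzP; exists (K 1%R 1%R * v + K 1%R 0%R * l).
  have h1 : v * N%:Z = 1 - u * K 1%R 0%R by rewrite -uv; ring.
  have -> : (K 1%R 1%R * v + K 1%R 0%R * l) * N%:Z = K 1%R 1%R * (v * N%:Z) + K 1%R 0%R * (l * N%:Z) by ring.
  by rewrite h1 -hl; ring.
have hE i : h (m i) = w * ee R (- (i%:R * q g)) * sl (upT i%:Z) (shrunk N f) t.
  have -> : h (m i) = sl (m i) (start f) t * rho (invmx (m i)) e0 g by rewrite /h /H ffunE.
  have -> : sl (m i) (start f) = sl (upT i%:Z) (shrunk N f).
    rewrite /start -(slM k _ SL2Z_S (mS i)) /m mulmxA (mulmxV (SL2Z_unit SL2Z_S)) mul1mx //.
  have -> : invmx (m i) = upT (- i%:Z) *m matS.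
    rewrite /m (SL2Z_invM iS (SL2Z_upT _)) invmxK.
    have [-> _] := SL2Z_inv (SL2Z_upT i%:Z); rewrite /upT !mxE /= oppr0 //.
  rewrite (rhoM rhoWeil _ (SL2Z_upT _) SL2Z_S) (rho_upT Nlevel rhoWeil) (rho_S_e0 Dform rhoWeil).
  rewrite rmorphN /= mulNr mulrC; congr (_ * _); exact: mulrC.
have -> : component (psi f) g t = psi_const * \sum_(K <- reps) h K.
  by rewrite /component psiE ffunE sum_ffunE.
rewrite sumE.
have -> : tcomp (Nq q N g) (shrunk N f) t =
    N%:R^-1 * \sum_(i < N) ee R (- (i%:R * q g)) * sl (upT i%:Z) (shrunk N f) t.
  rewrite /t_component -[LHS]/(_ * (\sum_(i < N) _) t) fct_sumE; congr (_ * _).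
  by apply: eq_bigr => i _; rewrite (NqE _ Nlevel) [N%:R * _]mulrC mulfK.
rewrite -psi_const_weil -[RHS]mulrA; congr (_ * _); rewrite [RHS]mulr_sumr; apply: eq_bigr => i _.
by rewrite hE; exact: (esym (mulrA _ _ _)).
Qed.

End OneForm.
End Psi.

Lemma s_mult_mod (N : nat) (m n : int) : (m = n %[mod N])%Z -> s_mult N m = s_mult N n.
Proof.
move=> e; rewrite /s_mult; congr (2 ^ omega _)%N.
have : gcdz m N = gcdz n N by rewrite -gcdz_modl e gcdz_modl.
by case.
Qed.

(** * The maps are inverse to each other *)

Section Main.
Variables (R : realType) (D : finZmodType) (q : D -> rat) (delta : nat -> int).
Variables (d2 : two_part) (N : nat) (r k : int).
Variable rho : 'M[int]_2 -> {linear group_space R D -> group_space R D}.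
Variable E : set 'M[int]_2.
Hypotheses (Dform : discriminant_form q) (Dshape : special_shape q delta d2).
Hypotheses (Nlevel : is_level q N) (rhoWeil : weil_rep q r rho).
Hypothesis Ereps : coset_reps N E.
Local Notation C := (R[i]^o).
Local Notation sl := (@sl R k).
Local Notation tcomp := (t_component sl N).
Local Notation psi := (psi rho N r k E).
Local Notation phi := (phi N r k).
Implicit Types (f : upper R -> C) (F : upper R -> group_space R D) (t : upper R).

Let N0 := level_gt0 Nlevel.
Let loc p (pN : p \in primes N) := local_structure_of_shape Dform Dshape Nlevel pN.
Let locc p (pN : p \in primes N) := local_char (loc pN).

Lemma scalar_forms_eigen f : scalar_forms_eps N k delta d2 f -> eigen k N d2 (Gamma0 N) f.
Proof. by move=> [[_ _ h] _] M hM; apply/funext => t; exact: h. Qed.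

Lemma psi_inv f : scalar_forms_eps N k delta d2 f -> vector_forms_inv q rho k (psi f).
Proof.
move=> hf; have fe := scalar_forms_eigen hf; case: hf => [[f1 f2 _] _].
exact: (psi_vector_forms Dform Dshape Nlevel rhoWeil Ereps fe f1 f2).
Qed.

(** If N q misses the class j, some chi_p takes the value -eps_p on the whole class, and the sign
    condition kills every coefficient there. *)
Lemma tcomp_shrunk_eq0 f j : scalar_forms_eps N k delta d2 f ->
  level_count q N N j = 0%N -> tcomp j (shrunk N f) = 0.
Proof.
move=> [_ [a [ha a0]]] /(level_count0 Dform Nlevel loc)[p pN pj].
have ha' : fourier N (shrunk N f) a by rewrite -[N in fourier N _ _]mul1n; exact: fourier_shrink.
apply: (fourier_unique_zero (fourier_t_component k j N0 ha')) => n.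
case: ifP => // /eqP nj; apply: (a0 n p pN); rewrite -pj.
apply: (qchar_mod (locc pN)); apply/eqP; rewrite eqz_mod_dvd.
apply: (dvdz_trans (n := N)); first by rewrite dvdzE /= dvdn_part.
by rewrite -eqz_mod_dvd nj.
Qed.

Lemma total_psi f : scalar_forms_eps N k delta d2 f ->
  component_sum (psi f) = 2 ^+ omega N *: shrunk N f.
Proof.
move=> hf; have fe := scalar_forms_eigen hf; have [hF _] := psi_inv hf.
apply/esym/eqP; rewrite -subr_eq0; apply/eqP.
apply: (eq0_of_coprime_components (act := sl) (@sl1 R k) (@slM R k) (@sl_lin R k) N0 locc).
  apply: eigenB; first exact/eigenZ/eigen_shrunk.
  exact: (total_eigen Dform Dshape Nlevel rhoWeil).
move=> j jN; rewrite -scaleN1r tcompD !tcompZ (tcomp_total Nlevel rhoWeil j hF).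
have -> : \sum_(g | (Nq q N g == j %[mod N])%Z) component (psi f) g =
    (level_count q N N j)%:R *: tcomp j (shrunk N f).
  rewrite (level_set_count Dform Nlevel).
  transitivity (\sum_(g | (Nq q N g == j %[mod N])%Z) tcomp j (shrunk N f)).
    apply: eq_bigr => g /eqP gj; rewrite (psi_coprime Dform Dshape Nlevel rhoWeil Ereps fe).
      exact: (tcomp_mod k Nlevel _ gj).
    by rewrite /coprimez -gcdz_modl gj gcdz_modl.
  rewrite sumr_const scaler_nat; congr (_ *+ _); apply: eq_card => b.
  by rewrite [RHS]inE; exact: level_condE.
(* For j prime to N the count is either 0, and then f has no such exponents, or 2^omega(N), because
   s(j) = 1; both times the two contributions cancel. *)
have [c0|c0] := eqVneq (level_count q N N j) 0%N.
  by rewrite (tcomp_shrunk_eq0 hf c0) !scaler0 addr0.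
rewrite -natrX -(level_count_s Dform Nlevel loc c0).
have -> : s_mult N j = 1%N.
  by move: jN; rewrite /s_mult coprimezE /= /coprime => /eqP ->.
by rewrite muln1 scaleN1r subrr.
Qed.

(** Both sides are invariant, so it is enough to compare the sums of their components. *)
Lemma phiK F : vector_forms_inv q rho k F -> psi (phi F) = F.
Proof.
move=> hF; have hf := phi_scalar_forms Dform Dshape Nlevel rhoWeil hF.
apply: (inv_of_total Dform Dshape Nlevel rhoWeil (psi_inv hf) hF).
rewrite (total_psi hf) (phiE Dform Dshape Nlevel rhoWeil hF.1).
rewrite -[X in 2 ^+ _ *: X]/(2 ^- omega N *: shrunk N (dilated N (component_sum F))) (dilatedK N0).
by rewrite scalerA mulfV ?scale1r // expf_neq0 // pnatr_eq0.
Qed.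

Lemma psiK f : scalar_forms_eps N k delta d2 f -> phi (psi f) = f.
Proof.
move=> hf; rewrite (phiE Dform Dshape Nlevel rhoWeil (psi_inv hf).1) (total_psi hf).
rewrite -[dilated _ _]/(2 ^+ omega N *: dilated N (shrunk N f)) (shrunkK N0).
by rewrite scalerA mulVf ?scale1r // expf_neq0 // pnatr_eq0.
Qed.

Lemma phi_linear (A : set (upper R -> group_space R D)) : linear_on A phi.
Proof.
move=> c x y _ _; apply/funext => t; rewrite /Defs.phi.
have -> : component (c *: x + y) 0 = c *: component x 0 + component y 0.
  by apply/funext => s; rewrite /component !ffunE.
rewrite slash_lin.
rewrite -[X in _ * X = _]/(c * slash k (matW R N) (component x 0) t + slash k (matW R N) (component y 0) t).
have e (a u v : R[i]) : a * (c * u + v) = c * (a * u) + a * v by ring.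
exact: e.
Qed.

Lemma psi_linear (A : set (upper R -> C)) : linear_on A psi.
Proof.
move=> c x y _ _; apply/funext => t.
rewrite -[RHS]/(c *: psi x t + psi y t) !(psiE r k rho Nlevel Ereps).
have -> : start N k (c *: x + y) = c *: start N k x + start N k y.
  by rewrite /start -[shrunk _ _]/(c *: shrunk N x + shrunk N y) [LHS]slash_lin.
have e (a : R[i]) (u v : group_space R D) : c *: (a *: u) + a *: v = a *: (c *: u + v).
  by rewrite scalerDr !scalerA [a * c]mulrC.
rewrite e; apply: (congr1 (GRing.scale _)).
rewrite scaler_sumr -big_split; apply: eq_bigr => M _.
rewrite /sl slash_lin scalerA; exact: scalerDl.
Qed.

End Main.

Theorem theorem3p3 (R : realType) (D : finZmodType) (q : D -> rat)
    (delta : nat -> int) (d2 : two_part) (N : nat) (r k : int)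
    (rho : 'M[int]_2 -> {linear group_space R D -> group_space R D})
    (E : set 'M[int]_2)
    (Dform : discriminant_form q)
    (Dshape : special_shape q delta d2)
    (Nlevel : is_level q N)
    (rsign : is_signature q r)
    (kr : (2 * k = r %[mod 4])%Z)
    (rhoWeil : weil_rep q r rho)
    (Ereps : coset_reps N E) :
  inverse_isomorphisms
    (vector_forms_inv q rho k) (scalar_forms_eps N k delta d2)
    (phi N r k) (psi rho N r k E) /\
  forall (f : upper R -> R[i]^o) (a : int -> R[i]^o),
    scalar_forms_eps N k delta d2 f -> fourier 1 f a ->
    forall g : D,
      let F_g := component (psi rho N r k E f) g in
      let m := Nq q N g in
      let b := fun n : int => if (n == m %[mod N])%Z then a n else 0 in
      (exists G : upper R -> R[i]^o, fourier N G b /\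
         forall t, F_g t = (s_mult N m)%:R * G t) /\
      fourier N F_g (fun n => (s_mult N n)%:R * b n).
Proof.
have N0 := level_gt0 Nlevel; split; first split.
- exact: (phi_scalar_forms Dform Dshape Nlevel rhoWeil).
- exact: (psi_inv Dform Dshape Nlevel rhoWeil Ereps).
- split; [exact: phi_linear|exact: (psi_linear r k rho Nlevel Ereps)].
- exact: (phiK Dform Dshape Nlevel rhoWeil Ereps).
- exact: (psiK Dform Dshape Nlevel rhoWeil Ereps).
move=> f a hf ha g F_g m b.
have FE : F_g = (s_mult N m)%:R *: t_component (@sl R k) N m (shrunk N f).
  apply: (component_of_total Dform Dshape Nlevel rhoWeil g).
    exact: (psi_inv Dform Dshape Nlevel rhoWeil Ereps).
  exact: (total_psi Dform Dshape Nlevel rhoWeil Ereps).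
have ha' : fourier N (shrunk N f) a by rewrite -[N in fourier N _ _]mul1n; exact: fourier_shrink.
have hb := fourier_t_component k m N0 ha'.
split; first by exists (t_component (@sl R k) N m (shrunk N f)); split; [exact: hb|move=> t; rewrite FE].
have := fourierZ (s_mult N m)%:R hb; rewrite -FE.
(* s is constant on the residue class of m, which contains the support of [b]. *)
suff -> : (fun n => (s_mult N m)%:R * b n) = (fun n => (s_mult N n)%:R * b n) by [].
apply/funext => n; rewrite /b; case: ifP => [/eqP nm|_]; last by rewrite !mulr0.
by rewrite (s_mult_mod nm).
Qed.
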